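(* Work in $\mathsf{ZF}$. The statements $\mathsf{LT1}$, $\mathsf{LT2}$ and $\mathsf{LT3}$ are equivalent.
   Context: Base theory is $\mathsf{ZF}$ (no choice). Ultrafilters are proper ultrafilters on the Boolean algebra $\mathcal P(I)$. For an ultrafilter $U$ over a set $I$ and an indexed family $\{M_i\mid i\in I\}$ of first-order structures in a common language $\mathcal L$, the ultraproduct $\prod_{i\in I}M_i/U$ has universe the classes $[f]$ of $f\in\prod_{i\in I}M_i$ under $f\simeq g\iff\{i: f(i)=g(i)\}\in U$; a relation symbol $R$ holds of $[f_0],\dots,[f_n]$ iff $\{i: M_i\models R(f_0(i),\dots,f_n(i))\}\in U$, and function and constant symbols are interpreted similarly. The ultrapower ${}^IM/U$ is the ultraproduct with all $M_i=M$. $\mathsf{LT1}(M,U)$: $M$ is elementarily equivalent to ${}^IM/U$. $\mathsf{LT2}(M,U)$: for every $\mathcal L$-formula $\varphi(v_0,\dots,v_n)$ and all $f_0,\dots,f_n\in{}^IM$, ${}^IM/U\models\varphi([f_0],\dots,[f_n])$ iff $\{i\in I: M\models\varphi(f_0(i),\dots,f_n(i))\}\in U$. $\mathsf{LT3}(\{M_i\mid i\in I\},U)$: if $\prod_{i\in I}M_i\neq\emptyset$, then for every $\mathcal L$-formula $\varphi(v_0,\dots,v_n)$ and all $f_0,\dots,f_n\in\prod_{i\in I}M_i$, $\prod_{i\in I}M_i/U\models\varphi([f_0],\dots,[f_n])$ iff $\{i\in I: M_i\models\varphi(f_0(i),\dots,f_n(i))\}\in U$. $\mathsf{LT1}$ (resp.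 $\mathsf{LT2}$) is the statement that $\mathsf{LT1}(M,U)$ (resp. $\mathsf{LT2}(M,U)$) holds for every structure $M$ and every ultrafilter $U$ over every set $I$; $\mathsf{LT3}$ is the statement that $\mathsf{LT3}(\{M_i\mid i\in I\},U)$ holds for every family of structures in a common language and every ultrafilter $U$ over $I$. *)

(* Defs.v *)
(** * Models of ZF

    "ZF proves A" is rendered as "A holds in every model (V, E) of ZF".
    Separation and Replacement are schemes over first-order formulas with
    parameters: quantifying over all predicates [V -> Prop] instead would give
    second-order ZF, whose models inherit choice from a metatheory with
    choice. *)

(** Formulas of the language {∈}, with de Bruijn indices: [fEx] binds 0. *)
Inductive fml : Type :=
| fEq  (i j : nat)
| fMem (i j : nat)
| fNeg (p : fml)
| fAnd (p q : fml)
| fEx  (p : fml).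

Definition scons {V : Type} (x : V) (e : nat -> V) (n : nat) : V :=
  match n with 0 => x | S m => e m end.

Fixpoint holds {V : Type} (E : V -> V -> Prop) (e : nat -> V) (p : fml) : Prop :=
  match p with
  | fEq i j  => e i = e j
  | fMem i j => E (e i) (e j)
  | fNeg q   => ~ holds E e q
  | fAnd q r => holds E e q /\ holds E e r
  | fEx q    => exists x : V, holds E (scons x e) q
  end.

(** * Notions of set theory inside a structure (V, E)

    Apart from the assignments [nat -> V] in [ZF], every quantifier below
    ranges over [V] (or over records of elements of [V]), so that each notion
    is a first-order formula in E.  In particular natural numbers, terms,
    formulas and satisfaction are those of the model, which need not be
    standard. *)
Section Internal.

Context {V : Type} (E : V -> V -> Prop).

Notation "x ∈ y" := (E x y) (at level 70, no associativity).

Definition subset (a b : V) : Prop := forall x, x ∈ a -> x ∈ b.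
Definition is_empty (z : V) : Prop := forall x, ~ x ∈ z.
Definition is_upair (p a b : V) : Prop := forall x, x ∈ p <-> x = a \/ x = b.
Definition is_adjoin (y x a : V) : Prop := forall z, z ∈ y <-> z ∈ x \/ z = a.
Definition is_succ (y x : V) : Prop := is_adjoin y x x.

Record ZF : Prop := {
  ZF_extensionality :
    forall a b, (forall x, x ∈ a <-> x ∈ b) -> a = b;
  ZF_foundation :
    forall a, (exists x, x ∈ a) ->
      exists x, x ∈ a /\ forall y, y ∈ a -> ~ y ∈ x;
  ZF_pairing :
    forall a b, exists p, is_upair p a b;
  ZF_union :
    forall a, exists u, forall x, x ∈ u <-> exists b, b ∈ a /\ x ∈ b;
  ZF_powerset :
    forall a, exists p, forall x, x ∈ p <-> subset x a;
  ZF_infinity :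
    exists a, (exists z, is_empty z /\ z ∈ a) /\
      forall x, x ∈ a -> exists y, is_succ y x /\ y ∈ a;
  ZF_separation :
    forall (p : fml) (e : nat -> V) (a : V),
      exists b, forall x, x ∈ b <-> x ∈ a /\ holds E (scons x e) p;
  ZF_replacement :
    forall (p : fml) (e : nat -> V) (a : V),
      (forall x y z, x ∈ a ->
         holds E (scons x (scons y e)) p -> holds E (scons x (scons z e)) p ->
         y = z) ->
      exists b, forall y, y ∈ b <->
        exists x, x ∈ a /\ holds E (scons x (scons y e)) p
}.

(** ** Pairs, functions, natural numbers *)

Definition is_opair (p a b : V) : Prop :=
  exists s d, is_upair s a a /\ is_upair d a b /\ is_upair p s d.

Definition pair_in (a b f : V) : Prop := exists p, is_opair p a b /\ p ∈ f.

Notation "⟨ a , b ⟩ ∈ f" := (pair_in a b f)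
  (at level 70, a at level 69, b at level 69, f at level 69).

Definition is_function (f d : V) : Prop :=
  (forall p, p ∈ f -> exists x y, x ∈ d /\ is_opair p x y) /\
  (forall x, x ∈ d -> exists! y, ⟨x, y⟩ ∈ f).

Definition maps (f d c : V) : Prop :=
  is_function f d /\ forall x y, ⟨x, y⟩ ∈ f -> y ∈ c.

Definition is_inductive (a : V) : Prop :=
  (forall z, is_empty z -> z ∈ a) /\
  (forall x y, x ∈ a -> is_succ y x -> y ∈ a).

Definition is_nat (n : V) : Prop := forall a, is_inductive a -> n ∈ a.

Fixpoint is_numeral (k : nat) (z : V) : Prop :=
  match k with
  | 0 => is_empty z
  | S j => exists y, is_numeral j y /\ is_succ z y
  end.

(** ** Languages

    [rels] and [funs] are functions of the model, sending each relation
    (respectively function) symbol to its arity; constant symbols are the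
    function symbols of arity 0. *)
Record language : Type := Language { rels : V; funs : V }.

Definition wf_language (L : language) : Prop :=
  (exists d, is_function (rels L) d) /\
  (exists d, is_function (funs L) d) /\
  (forall r n, ⟨r, n⟩ ∈ rels L -> is_nat n /\ ~ is_empty n) /\
  (forall g n, ⟨g, n⟩ ∈ funs L -> is_nat n).

(** ** Structures

    n-tuples are functions with domain the von Neumann natural number n.  An
    n-ary relation is a set of n-tuples, an n-ary operation is a function on
    the set of all n-tuples. *)
Record structure : Type := Structure { univ : V; relI : V; funI : V }.

Definition is_operation (G n a : V) : Prop :=
  exists T, (forall s, s ∈ T <-> maps s n a) /\ maps G T a.

Definition wf_structure (L : language) (M : structure) : Prop :=
  (exists a, a ∈ univ M) /\
  (exists d, is_function (rels L) d /\ is_function (relI M) d) /\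
  (forall r n X, ⟨r, n⟩ ∈ rels L -> ⟨r, X⟩ ∈ relI M ->
     forall s, s ∈ X -> maps s n (univ M)) /\
  (exists d, is_function (funs L) d /\ is_function (funI M) d) /\
  (forall g n G, ⟨g, n⟩ ∈ funs L -> ⟨g, G⟩ ∈ funI M ->
     is_operation G n (univ M)).

Definition codes (m : V) (M : structure) : Prop :=
  exists p, is_opair p (relI M) (funI M) /\ is_opair m (univ M) p.

(** ** Syntax

    Terms and formulas are coded by tagged tuples, with variables v_n for n a
    natural number of the model. *)

Definition is_tagged (k : nat) (c a : V) : Prop :=
  exists z, is_numeral k z /\ is_opair c z a.
Definition is_tagged2 (k : nat) (c a b : V) : Prop :=
  exists p, is_opair p a b /\ is_tagged k c p.

Definition is_var (c n : V) : Prop := is_tagged 0 c n.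
Definition is_app (c g ts : V) : Prop := is_tagged2 1 c g ts.

Definition is_eqn (c t u : V) : Prop := is_tagged2 0 c t u.
Definition is_rel (c r ts : V) : Prop := is_tagged2 1 c r ts.
Definition is_neg (c p : V) : Prop := is_tagged 2 c p.
Definition is_and (c p q : V) : Prop := is_tagged2 3 c p q.
Definition is_ex (c n p : V) : Prop := is_tagged2 4 c n p.

(** [is_term L x t]: t is an L-term all of whose variables have their index in
    x, i.e. t lies in the least set closed under term formation. *)
Definition term_closed (L : language) (x T : V) : Prop :=
  (forall n c, n ∈ x -> is_var c n -> c ∈ T) /\
  (forall g n ts c, ⟨g, n⟩ ∈ funs L -> maps ts n T -> is_app c g ts -> c ∈ T).

Definition is_term (L : language) (x t : V) : Prop :=
  forall T, term_closed L x T -> t ∈ T.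

Definition is_terms (L : language) (x n ts : V) : Prop :=
  is_function ts n /\ forall k t, ⟨k, t⟩ ∈ ts -> is_term L x t.

Definition is_context (x : V) : Prop := forall n, n ∈ x -> is_nat n.

(** [is_formula L x p]: p is an L-formula all of whose free variables have
    their index in x.  Since [x] may or may not contain n in the clause for
    ∃v_n, variables may be rebound. *)
Definition formula_closed (L : language) (W : V) : Prop :=
  forall x, is_context x ->
  (forall t u c, is_term L x t -> is_term L x u -> is_eqn c t u -> ⟨x, c⟩ ∈ W) /\
  (forall r n ts c, ⟨r, n⟩ ∈ rels L -> is_terms L x n ts -> is_rel c r ts ->
     ⟨x, c⟩ ∈ W) /\
  (forall p c, ⟨x, p⟩ ∈ W -> is_neg c p -> ⟨x, c⟩ ∈ W) /\
  (forall p q c, ⟨x, p⟩ ∈ W -> ⟨x, q⟩ ∈ W -> is_and c p q -> ⟨x, c⟩ ∈ W) /\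
  (forall n y p c, is_nat n -> is_adjoin y x n -> ⟨y, p⟩ ∈ W -> is_ex c n p ->
     ⟨x, c⟩ ∈ W).

Definition is_formula (L : language) (x p : V) : Prop :=
  forall W, formula_closed L W -> ⟨x, p⟩ ∈ W.

(** ** Satisfaction *)

(** as = e ∘ ts, for a tuple ts of length n *)
Definition is_comp (as_ e ts n : V) : Prop :=
  is_function as_ n /\
  forall k t a, ⟨k, t⟩ ∈ ts -> ⟨t, a⟩ ∈ e -> ⟨k, a⟩ ∈ as_.

(** e is the function sending each term with variables in x to its value in M
    under the assignment s : x → M. *)
Definition is_evaluation (L : language) (M : structure) (x s e : V) : Prop :=
  (exists T, (forall t, t ∈ T <-> is_term L x t) /\ maps e T (univ M)) /\
  (forall n c a, is_var c n -> ⟨n, a⟩ ∈ s -> ⟨c, a⟩ ∈ e) /\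
  (forall g n ts c G as_ b,
     ⟨g, n⟩ ∈ funs L -> is_terms L x n ts -> is_app c g ts ->
     ⟨g, G⟩ ∈ funI M -> is_comp as_ e ts n -> ⟨as_, b⟩ ∈ G -> ⟨c, b⟩ ∈ e).

(** s' : y → M is the assignment s modified to take the value a at n *)
Definition is_update (s' y s n a : V) : Prop :=
  is_function s' y /\ ⟨n, a⟩ ∈ s' /\
  forall k b, k <> n -> ⟨k, b⟩ ∈ s -> ⟨k, b⟩ ∈ s'.

(** Tarski's clauses for a set S of pairs ⟨formula, assignment⟩ *)
Definition is_satisfaction (L : language) (M : structure) (S : V) : Prop :=
  forall x s e,
  is_context x -> maps s x (univ M) -> is_evaluation L M x s e ->
  (forall t u c, is_term L x t -> is_term L x u -> is_eqn c t u ->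
     (⟨c, s⟩ ∈ S <-> exists a, ⟨t, a⟩ ∈ e /\ ⟨u, a⟩ ∈ e)) /\
  (forall r n ts c, ⟨r, n⟩ ∈ rels L -> is_terms L x n ts -> is_rel c r ts ->
     (⟨c, s⟩ ∈ S <->
      exists as_ X, is_comp as_ e ts n /\ ⟨r, X⟩ ∈ relI M /\ as_ ∈ X)) /\
  (forall p c, is_formula L x p -> is_neg c p ->
     (⟨c, s⟩ ∈ S <-> ~ ⟨p, s⟩ ∈ S)) /\
  (forall p q c, is_formula L x p -> is_formula L x q -> is_and c p q ->
     (⟨c, s⟩ ∈ S <-> ⟨p, s⟩ ∈ S /\ ⟨q, s⟩ ∈ S)) /\
  (forall n y p c, is_nat n -> is_adjoin y x n -> is_formula L y p ->
     is_ex c n p ->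
     (⟨c, s⟩ ∈ S <->
      exists a s', a ∈ univ M /\ is_update s' y s n a /\ ⟨p, s'⟩ ∈ S)).

Definition sat (L : language) (M : structure) (p s : V) : Prop :=
  exists S, is_satisfaction L M S /\ ⟨p, s⟩ ∈ S.

(** The empty set is both the empty context and the empty assignment. *)
Definition elementarily_equivalent (L : language) (M N : structure) : Prop :=
  forall z p, is_empty z -> is_formula L z p -> (sat L M p z <-> sat L N p z).

(** ** Ultraproducts *)

Definition is_ultrafilter (I U : V) : Prop :=
  (forall X, X ∈ U -> subset X I) /\
  I ∈ U /\
  (forall X, is_empty X -> ~ X ∈ U) /\
  (forall X Y, X ∈ U -> subset X Y -> subset Y I -> Y ∈ U) /\
  (forall X Y Z, X ∈ U -> Y ∈ U -> (forall i, i ∈ Z <-> i ∈ X /\ i ∈ Y) ->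
     Z ∈ U) /\
  (forall X Y, subset X I -> (forall i, i ∈ Y <-> i ∈ I /\ ~ i ∈ X) ->
     X ∈ U \/ Y ∈ U).

(** {i ∈ I | P i} ∈ U.  Only used for P given by a first-order formula. *)
Definition large (I U : V) (P : V -> Prop) : Prop :=
  exists X, X ∈ U /\ forall i, i ∈ X <-> i ∈ I /\ P i.

Definition member (F i : V) (M : structure) : Prop :=
  exists m, ⟨i, m⟩ ∈ F /\ codes m M.

Definition is_family (L : language) (I F : V) : Prop :=
  is_function F I /\
  forall i, i ∈ I -> exists M, member F i M /\ wf_structure L M.

Definition in_product (I F f : V) : Prop :=
  is_function f I /\
  forall i M a, member F i M -> ⟨i, a⟩ ∈ f -> a ∈ univ M.

(** c = [f] *)
Definition is_class (I F U c f : V) : Prop :=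
  forall g, g ∈ c <->
    in_product I F g /\
    large I U (fun i => exists a, ⟨i, a⟩ ∈ f /\ ⟨i, a⟩ ∈ g).

(** fs is an n-tuple (f_k) of elements of the product *)
Definition is_product_tuple (I F n fs : V) : Prop :=
  is_function fs n /\ forall k f, ⟨k, f⟩ ∈ fs -> in_product I F f.

(** cs = ([f_k])_{k<n} *)
Definition is_class_tuple (I F U n cs fs : V) : Prop :=
  is_function cs n /\
  forall k f c, ⟨k, f⟩ ∈ fs -> is_class I F U c f -> ⟨k, c⟩ ∈ cs.

(** as = (f_k(i))_{k<n} *)
Definition is_slice (as_ n fs i : V) : Prop :=
  is_function as_ n /\
  forall k f a, ⟨k, f⟩ ∈ fs -> ⟨i, a⟩ ∈ f -> ⟨k, a⟩ ∈ as_.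

Definition is_ultraproduct
    (L : language) (I F U : V) (N : structure) : Prop :=
  (forall c, c ∈ univ N <-> exists f, in_product I F f /\ is_class I F U c f) /\
  (exists d, is_function (rels L) d /\ is_function (relI N) d) /\
  (forall r n X, ⟨r, n⟩ ∈ rels L -> ⟨r, X⟩ ∈ relI N ->
     (forall cs, cs ∈ X -> maps cs n (univ N)) /\
     (forall fs cs,
        is_product_tuple I F n fs -> is_class_tuple I F U n cs fs ->
        (cs ∈ X <->
         large I U (fun i => exists M Y as_,
           member F i M /\ ⟨r, Y⟩ ∈ relI M /\ is_slice as_ n fs i /\
           as_ ∈ Y)))) /\
  (exists d, is_function (funs L) d /\ is_function (funI N) d) /\
  (forall g n G, ⟨g, n⟩ ∈ funs L -> ⟨g, G⟩ ∈ funI N ->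
     is_operation G n (univ N) /\
     (forall fs cs h c,
        is_product_tuple I F n fs -> is_class_tuple I F U n cs fs ->
        in_product I F h ->
        (forall i M H as_ b,
           member F i M -> ⟨g, H⟩ ∈ funI M -> is_slice as_ n fs i ->
           ⟨as_, b⟩ ∈ H -> ⟨i, b⟩ ∈ h) ->
        is_class I F U c h ->
        ⟨cs, c⟩ ∈ G)).

Definition is_constant_family (I : V) (M : structure) (F : V) : Prop :=
  is_function F I /\ forall i, i ∈ I -> member F i M.

(** ** The three forms of Łoś's theorem

    In ZF there is exactly one N with [is_ultraproduct L I F U N], so
    quantifying universally over such N refers to the ultraproduct.  A formula p(v_0,...,v_n) has its free variables in the
    successor m = {0,...,n} of n. *)

Definition LT1_at (L : language) (M : structure) (I U : V) : Prop :=
  forall F N,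
  is_constant_family I M F -> is_ultraproduct L I F U N ->
  elementarily_equivalent L M N.

Definition LT2_at (L : language) (M : structure) (I U : V) : Prop :=
  forall F N,
  is_constant_family I M F -> is_ultraproduct L I F U N ->
  forall n m p fs cs,
  is_nat n -> is_succ m n -> is_formula L m p ->
  is_product_tuple I F m fs -> is_class_tuple I F U m cs fs ->
  (sat L N p cs <->
   large I U (fun i => exists as_, is_slice as_ m fs i /\ sat L M p as_)).

Definition LT3_at (L : language) (I F U : V) : Prop :=
  (exists f, in_product I F f) ->
  forall N, is_ultraproduct L I F U N ->
  forall n m p fs cs,
  is_nat n -> is_succ m n -> is_formula L m p ->
  is_product_tuple I F m fs -> is_class_tuple I F U m cs fs ->
  (sat L N p cs <->
   large I U (fun i => exists M as_,
     member F i M /\ is_slice as_ m fs i /\ sat L M p as_)).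

Definition LT1 : Prop :=
  forall L M I U, wf_language L -> wf_structure L M -> is_ultrafilter I U ->
  LT1_at L M I U.

Definition LT2 : Prop :=
  forall L M I U, wf_language L -> wf_structure L M -> is_ultrafilter I U ->
  LT2_at L M I U.

Definition LT3 : Prop :=
  forall L I F U, wf_language L -> is_family L I F -> is_ultrafilter I U ->
  LT3_at L I F U.

End Internal.

(* Main.v *)
(** Each form of Łoś's theorem is equivalent to a choice principle for
    ultrafilters: if {i ∈ I | B_i ≠ ∅} ∈ U, then some function g on I satisfies
    {i ∈ I | g(i) ∈ B_i} ∈ U.  This principle is exactly what the existential
    step of the usual induction on formulas needs, so it implies LT1, LT2 and
    LT3.  Conversely, let a structure have a single binary relation R, with R(x, y)
    iff y ∈ B_x or B_x is empty (or undefined).  It satisfies ∀x ∃y R(x, y), and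
    a witness [g] for y at x = [id] in its ultrapower is a function g as
    required.

    Inductions and recursions inside the model are limited to definable
    predicates.  The evaluation of terms and the satisfaction relation are
    sets of the model, obtained by recursion along "is an immediate
    constituent of". *)

Require Import Defs.
From Stdlib Require Import Classical ClassicalEpsilon Arith.

Existing Class ZF.

(** Separation and Replacement are available only for formulas, so every set and function built
    below needs a proof that its defining condition is expressible. These proofs are found by
    search, from the closure of definable predicates under connectives, quantifiers and
    substitution. Since the numbers of the model may be nonstandard, Rocq's own recursion on syntax
    is of no use: tuples have any internal length, and even the existence of a set containing all
    codes of formulas has to be proved inside the model.

    The clause that makes R(x, y) true when B_x is empty lets M satisfy ∀x ∃y R(x, y) with no
    choice, as witnesses are found for one x at a time. The ultrapower has to produce one class [g],
    which is a whole function. LT1 detects this through the sentence, LT2 through the formula ∃y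
    R(v_0, y) at [id]. Since the statements quantify over ultraproducts N, such an N must also be
    shown to exist, but only for a language with one binary symbol. *)

Fixpoint rename (r : nat -> nat) (p : fml) : fml :=
  match p with
  | fEq i j => fEq (r i) (r j)
  | fMem i j => fMem (r i) (r j)
  | fNeg q => fNeg (rename r q)
  | fAnd q q' => fAnd (rename r q) (rename r q')
  | fEx q => fEx (rename (fun n => match n with 0 => 0 | S m => S (r m) end) q)
  end.

(** * Definable predicates *)

Section Definability.
Context {V : Type} (E : V -> V -> Prop).

Lemma holds_rename p : forall r (e e' : nat -> V), (forall n, e' n = e (r n)) ->
  holds E e (rename r p) <-> holds E e' p.
Proof.
  induction p as [i j|i j|p IH|p IHp q IHq|p IH]; intros r e e' H; simpl.
  - now rewrite !H.
  - now rewrite !H.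
  - now rewrite (IH r e e' H).
  - now rewrite (IHp r e e' H), (IHq r e e' H).
  - assert (K : forall x, holds E (scons x e)
       (rename (fun n => match n with 0 => 0 | S m => S (r m) end) p)
       <-> holds E (scons x e') p).
    { intros x. apply IH. intros [|n]; simpl; auto. }
    split; intros [x Hx]; exists x; now apply K.
Qed.

(** A variable of a formula refers either to the environment or to a parameter
    in [V]. *)
Definition look (r : nat -> nat + V) (e : nat -> V) (n : nat) : V :=
  match r n with inl k => e k | inr v => v end.

(** Definability with parameters, for predicates of a whole environment rather than of a tuple, so
    that connectives and binders need no bookkeeping of arities. The parameters sit in r, apart from
    the formula. *)
Definition Dfn (P : (nat -> V) -> Prop) : Prop :=
  exists p r, forall e, P e <-> holds E (look r e) p.

(** Binders shift the environment: the value of [t] is variable 0, and its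
    arguments start at variable 1. *)
Definition DT (t : (nat -> V) -> V) : Prop :=
  Dfn (fun e => e 0 = t (fun k => e (S k))).

Lemma Dfn_ext P Q : (forall e, Q e <-> P e) -> Dfn P -> Dfn Q.
Proof. intros H (p & r & K). exists p, r. intros e. now rewrite H. Qed.

Lemma Dfn_ren f P : Dfn P -> Dfn (fun e => P (fun k => e (f k))).
Proof.
  intros (p & r & H).
  exists (rename (fun n => n) p).
  exists (fun n => match r n with inl k => inl (f k) | inr v => inr v end).
  intros e. rewrite H. symmetry. apply holds_rename.
  intros n. unfold look. now destruct (r n).
Qed.

Lemma Dfn_not P : Dfn P -> Dfn (fun e => ~ P e).
Proof. intros (p & r & H). exists (fNeg p), r. intros e. simpl. now rewrite H. Qed.

Lemma Dfn_and P Q : Dfn P -> Dfn Q -> Dfn (fun e => P e /\ Q e).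
Proof.
  intros (p & r & H) (p' & r' & H').
  (* The two formulas come with different look-up functions: the first is moved to the even
     variables, the second to the odd ones. *)
  exists (fAnd (rename (fun n => 2 * n) p) (rename (fun n => S (2 * n)) p')).
  exists (fun n => if Nat.even n then r (Nat.div2 n) else r' (Nat.div2 n)).
  intros e. cbn [holds]. rewrite H, H'.
  rewrite (holds_rename p _ _ (look r e)), (holds_rename p' _ _ (look r' e)).
  - reflexivity.
  - intros n. unfold look.
    rewrite Nat.even_succ, <- Nat.negb_even, Nat.even_mul, Nat.div2_succ_double. reflexivity.
  - intros n. unfold look.
    rewrite Nat.even_mul, Nat.div2_double. reflexivity.
Qed.

Lemma Dfn_ex (Q : (nat -> V) -> V -> Prop) : Dfn (fun e => Q (fun k => e (S k)) (e 0)) ->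
  Dfn (fun e => exists x, Q e x).
Proof.
  intros (p & r & H).
  (* Several variables may refer to entry 0 of the environment, the one to be bound; all of them
     become variable 0. The others move to S n, and their environment entries go down by one. The
     entries left at [inl 0] are never read. *)
  exists (fEx (rename (fun n => match r n with inl 0 => 0 | _ => S n end) p)).
  exists (fun n => match r n with inl (S k) => inl k | a => a end).
  intros e. simpl.
  enough (K : forall x, Q e x <-> holds E (scons x (look
     (fun n => match r n with inl (S k) => inl k | a => a end) e))
     (rename (fun n => match r n with inl 0 => 0 | _ => S n end) p))
    by (split; intros [x Hx]; exists x; now apply K).
  intros x. specialize (H (scons x e)). simpl in H.
  change (fun k => e k) with e in H. rewrite H.
  symmetry. apply holds_rename. intros n. unfold look.
  destruct (r n) as [[|k]|v] eqn:Er; simpl; try reflexivity; now rewrite Er.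
Qed.

Lemma Dfn_or P Q : Dfn P -> Dfn Q -> Dfn (fun e => P e \/ Q e).
Proof.
  intros HP HQ. apply Dfn_ext with (fun e => ~ (~ P e /\ ~ Q e)).
  - intros e. tauto.
  - auto using Dfn_not, Dfn_and.
Qed.

Lemma Dfn_imp P Q : Dfn P -> Dfn Q -> Dfn (fun e => P e -> Q e).
Proof.
  intros HP HQ. apply Dfn_ext with (fun e => ~ (P e /\ ~ Q e)).
  - intros e. tauto.
  - auto using Dfn_not, Dfn_and.
Qed.

Lemma Dfn_iff P Q : Dfn P -> Dfn Q -> Dfn (fun e => P e <-> Q e).
Proof. intros HP HQ. apply Dfn_and; now apply Dfn_imp. Qed.

Lemma Dfn_all (Q : (nat -> V) -> V -> Prop) : Dfn (fun e => Q (fun k => e (S k)) (e 0)) ->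
  Dfn (fun e => forall x, Q e x).
Proof.
  intros HQ. apply Dfn_ext with (fun e => ~ exists x, ~ Q e x).
  - intros e. split.
    + intros H [x Hx]. auto.
    + intros H x. apply NNPP. eauto.
  - apply Dfn_not, (Dfn_ex (fun e x => ~ Q e x)), Dfn_not, HQ.
Qed.

Lemma Dfn_exu (Q : (nat -> V) -> V -> Prop) : Dfn (fun e => exists x, Q e x /\ forall y, Q e y -> x = y) ->
  Dfn (fun e => exists! x, Q e x).
Proof. intros H; exact H. Qed.

Lemma Dfn_ex_structure (Q : (nat -> V) -> @structure V -> Prop) :
  Dfn (fun e => exists u r f, Q e (Structure u r f)) ->
  Dfn (fun e => exists M, Q e M).
Proof.
  apply Dfn_ext. intros e. split.
  - intros [[u r f] H]. eauto.
  - intros (u & r & f & H). eauto.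
Qed.

Lemma Dfn_all_structure (Q : (nat -> V) -> @structure V -> Prop) :
  Dfn (fun e => forall u r f, Q e (Structure u r f)) ->
  Dfn (fun e => forall M, Q e M).
Proof.
  apply Dfn_ext. intros e. split.
  - auto.
  - intros H [u r f]. auto.
Qed.

Lemma Dfn_var_eq i j : Dfn (fun e => e i = e j).
Proof. exists (fEq 0 1), (fun n => inl (match n with 0 => i | _ => j end)). reflexivity. Qed.

Lemma Dfn_var_mem i j : Dfn (fun e => E (e i) (e j)).
Proof. exists (fMem 0 1), (fun n => inl (match n with 0 => i | _ => j end)). reflexivity. Qed.

(** By excluded middle the proposition is equivalent to a fixed true or false formula. Clauses about
    parameters alone are thus definable without being analysed. *)
Lemma Dfn_const (A : Prop) : Dfn (fun _ => A).
Proof.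
  destruct (classic A).
  - exists (fNeg (fAnd (fEq 0 0) (fNeg (fEq 0 0)))), inl. simpl. tauto.
  - exists (fAnd (fEq 0 0) (fNeg (fEq 0 0))), inl. simpl. tauto.
Qed.

Lemma DT_var k : DT (fun e => e k).
Proof. apply (Dfn_var_eq 0 (S k)). Qed.

Lemma DT_const v : DT (fun _ => v).
Proof.
  exists (fEq 0 1), (fun n => match n with 0 => inl 0 | _ => inr v end).
  reflexivity.
Qed.

(** The language has no terms, so P(t) is read as ∃x (x = t ∧ P(x)). *)
Lemma Dfn_sub (P : (nat -> V) -> V -> Prop) t : Dfn (fun e => P (fun k => e (S k)) (e 0)) -> DT t ->
  Dfn (fun e => P e (t e)).
Proof.
  intros HP Ht. apply Dfn_ext with (fun e => exists x, x = t e /\ P e x).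
  - intros e. split; [eauto|]. intros (x & -> & H). exact H.
  - apply (Dfn_ex (fun e x => x = t e /\ P e x)). now apply Dfn_and.
Qed.

Lemma DT_up n t : DT t -> DT (fun e => t (fun k => e (n + k))).
Proof.
  intros H.
  exact (Dfn_ren (fun k => match k with 0 => 0 | S k => S (n + k) end) _ H).
Qed.

(** Definability of relations on V, as type classes: the instances form the database from which the
    proof search composes formulas. *)
Class D1 (R : V -> Prop) : Prop := d1 : Dfn (fun e => R (e 0)).
Class D2 (R : V -> V -> Prop) : Prop := d2 : Dfn (fun e => R (e 0) (e 1)).
Class D3 (R : V -> V -> V -> Prop) : Prop :=
  d3 : Dfn (fun e => R (e 0) (e 1) (e 2)).
Class D4 (R : V -> V -> V -> V -> Prop) : Prop :=
  d4 : Dfn (fun e => R (e 0) (e 1) (e 2) (e 3)).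
Class D5 (R : V -> V -> V -> V -> V -> Prop) : Prop :=
  d5 : Dfn (fun e => R (e 0) (e 1) (e 2) (e 3) (e 4)).
Class D6 (R : V -> V -> V -> V -> V -> V -> Prop) : Prop :=
  d6 : Dfn (fun e => R (e 0) (e 1) (e 2) (e 3) (e 4) (e 5)).

Lemma Dfn_S1 R t : D1 R -> DT t -> Dfn (fun e => R (t e)).
Proof.
  intros H Ht. apply (Dfn_sub (fun e x => R x)); auto.
Qed.

(** The arguments are abstracted one at a time, and each new binder pushes the earlier ones up by
    one. They end up in reverse order, which a final renaming undoes; the lemmas for more arguments
    follow the same pattern. *)
Lemma Dfn_S2 R t u : D2 R -> DT t -> DT u -> Dfn (fun e => R (t e) (u e)).
Proof.
  intros H Ht Hu.
  apply (Dfn_sub (fun e x => R x (u e))); auto.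
  apply (Dfn_sub (fun e x => R (e 0) x)); [|now apply (DT_up 1)].
  exact (Dfn_ren (fun k => match k with 0 => 1 | 1 => 0 | k => k end) _ H).
Qed.

Lemma Dfn_S3 R t u w : D3 R -> DT t -> DT u -> DT w ->
  Dfn (fun e => R (t e) (u e) (w e)).
Proof.
  intros H Ht Hu Hw.
  apply (Dfn_sub (fun e x => R x (u e) (w e))); auto.
  apply (Dfn_sub (fun e x => R (e 0) x (w (fun k => e (S k))))); [|now apply (DT_up 1)].
  apply (Dfn_sub (fun e x => R (e 1) (e 0) x)); [|now apply (DT_up 2)].
  exact (Dfn_ren (fun k => match k with 0 => 2 | 1 => 1 | _ => 0 end) _ H).
Qed.

Lemma Dfn_S4 R t u w v : D4 R -> DT t -> DT u -> DT w -> DT v ->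
  Dfn (fun e => R (t e) (u e) (w e) (v e)).
Proof.
  intros H Ht Hu Hw Hv.
  apply (Dfn_sub (fun e x => R x (u e) (w e) (v e))); auto.
  apply (Dfn_sub (fun e x => R (e 0) x (w (fun k => e (S k)))
    (v (fun k => e (S k))))); [|now apply (DT_up 1)].
  apply (Dfn_sub (fun e x => R (e 1) (e 0) x (v (fun k => e (S (S k))))));
    [|now apply (DT_up 2)].
  apply (Dfn_sub (fun e x => R (e 2) (e 1) (e 0) x)); [|now apply (DT_up 3)].
  exact (Dfn_ren (fun k => match k with 0 => 3 | 1 => 2 | 2 => 1 | _ => 0 end) _ H).
Qed.

Lemma Dfn_S5 R t u w v y : D5 R -> DT t -> DT u -> DT w -> DT v -> DT y ->
  Dfn (fun e => R (t e) (u e) (w e) (v e) (y e)).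
Proof.
  intros H Ht Hu Hw Hv Hy.
  apply (Dfn_sub (fun e x => R x (u e) (w e) (v e) (y e))); auto.
  apply (Dfn_sub (fun e x => R (e 0) x (w (fun k => e (S k)))
    (v (fun k => e (S k))) (y (fun k => e (S k))))); [|now apply (DT_up 1)].
  apply (Dfn_sub (fun e x => R (e 1) (e 0) x (v (fun k => e (S (S k))))
    (y (fun k => e (S (S k)))))); [|now apply (DT_up 2)].
  apply (Dfn_sub (fun e x => R (e 2) (e 1) (e 0) x (y (fun k => e (S (S (S k)))))));
    [|now apply (DT_up 3)].
  apply (Dfn_sub (fun e x => R (e 3) (e 2) (e 1) (e 0) x)); [|now apply (DT_up 4)].
  exact (Dfn_ren (fun k => match k with 0 => 4 | 1 => 3 | 2 => 2 | 3 => 1 | _ => 0 end) _ H).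
Qed.

Lemma Dfn_S6 R t u w v y z : D6 R -> DT t -> DT u -> DT w -> DT v -> DT y ->
  DT z -> Dfn (fun e => R (t e) (u e) (w e) (v e) (y e) (z e)).
Proof.
  intros H Ht Hu Hw Hv Hy Hz.
  apply (Dfn_sub (fun e x => R x (u e) (w e) (v e) (y e) (z e))); auto.
  apply (Dfn_sub (fun e x => R (e 0) x (w (fun k => e (S k)))
    (v (fun k => e (S k))) (y (fun k => e (S k))) (z (fun k => e (S k)))));
    [|now apply (DT_up 1)].
  apply (Dfn_sub (fun e x => R (e 1) (e 0) x (v (fun k => e (S (S k))))
    (y (fun k => e (S (S k)))) (z (fun k => e (S (S k))))));
    [|now apply (DT_up 2)].
  apply (Dfn_sub (fun e x => R (e 2) (e 1) (e 0) x (y (fun k => e (S (S (S k)))))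
    (z (fun k => e (S (S (S k)))))));
    [|now apply (DT_up 3)].
  apply (Dfn_sub (fun e x => R (e 3) (e 2) (e 1) (e 0) x
    (z (fun k => e (S (S (S (S k)))))))); [|now apply (DT_up 4)].
  apply (Dfn_sub (fun e x => R (e 4) (e 3) (e 2) (e 1) (e 0) x));
    [|now apply (DT_up 5)].
  exact (Dfn_ren (fun k => match k with 0 => 5 | 1 => 4 | 2 => 3 | 3 => 2 | 4 => 1 | _ => 0 end) _ H).
Qed.

(** Operations with a definable graph may occur as arguments of definable relations. This covers
    operations introduced by [the], such as [op] below, which are not given by any formula
    syntactically. *)
Class F1 (f : V -> V) : Prop := f1 : D2 (fun y a => y = f a).
Class F2 (f : V -> V -> V) : Prop := f2 : D3 (fun y a b => y = f a b).

Lemma DT_F1 f t : F1 f -> DT t -> DT (fun e => f (t e)).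
Proof.
  intros H Ht. unfold DT. apply (Dfn_S2 (fun y a => y = f a)).
  - exact H.
  - apply DT_var.
  - apply (DT_up 1 t Ht).
Qed.

Lemma DT_F2 f t u : F2 f -> DT t -> DT u -> DT (fun e => f (t e) (u e)).
Proof.
  intros H Ht Hu. unfold DT.
  apply (Dfn_S3 (fun y a b => y = f a b)).
  - exact H.
  - apply DT_var.
  - apply (DT_up 1 t Ht).
  - apply (DT_up 1 u Hu).
Qed.

Global Instance D2_eq : D2 (@eq V).
Proof. apply Dfn_var_eq. Qed.

Global Instance D2_mem : D2 E.
Proof. apply Dfn_var_mem. Qed.

Lemma separation {hZF : ZF E} P : D1 P ->
  forall a, exists b, forall x, E x b <-> E x a /\ P x.
Proof.
  intros (p & r & H) a.
  (* The predicate reads variable 0 alone, so the rest of the environment can be filled with any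
     element, here a; every other variable of the formula becomes a parameter. *)
  destruct (ZF_separation E hZF
    (rename (fun n => match r n with inl 0 => 0 | _ => S n end) p)
    (look (fun n => match r n with inl (S k) => inl k | u => u end) (fun _ => a)) a)
    as [b Hb].
  exists b. intros x. rewrite Hb. specialize (H (scons x (fun _ => a))). simpl in H.
  rewrite H. rewrite (holds_rename p _ _ (look r (scons x (fun _ => a)))).
  - reflexivity.
  - intros n. unfold look.
    destruct (r n) as [[|k]|v] eqn:Er; simpl; try reflexivity; now rewrite Er.
Qed.

Lemma replacement {hZF : ZF E} R : D2 R -> forall a,
  (forall x y z, E x a -> R x y -> R x z -> y = z) ->
  exists b, forall y, E y b <-> exists x, E x a /\ R x y.
Proof.
  intros (p & r & H) a Hu.
  pose (p' := rename (fun n => match r n with inl 0 => 0 | inl 1 => 1 | _ => S (S n) end) p).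
  pose (e := look (fun n => match r n with inl (S (S k)) => inl k | u => u end) (fun _ => a)).
  assert (K : forall x y, R x y <-> holds E (scons x (scons y e)) p').
  { intros x y. specialize (H (scons x (scons y (fun _ => a)))). simpl in H.
    rewrite H. symmetry. apply holds_rename. intros n. unfold e, look.
    destruct (r n) as [[|[|k]]|v] eqn:Er; simpl; try reflexivity; now rewrite Er. }
  destruct (ZF_replacement E hZF p' e a) as [b Hb].
  - intros x y z. rewrite <- !K. apply Hu.
  - exists b. intros y. rewrite Hb. split; intros (x & Hx & Hr); exists x;
      split; auto; now apply K.
Qed.
End Definability.

(** * Proof search for definability *)

Ltac dt := first
  [ apply DT_var | apply DT_const | simple eapply DT_F2; [typeclasses eauto|..]
  | simple eapply DT_F1; [typeclasses eauto|..] ].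

Ltac dfn_atom :=
  first
  [ simple apply Dfn_const
  | simple eapply Dfn_S6; [typeclasses eauto|..]
  | simple eapply Dfn_S5; [typeclasses eauto|..]
  | simple eapply Dfn_S4; [typeclasses eauto|..]
  | simple eapply Dfn_S3; [typeclasses eauto|..]
  | simple eapply Dfn_S2; [typeclasses eauto|..]
  | simple eapply Dfn_S1; [typeclasses eauto|..] ].

(** Under each connective or quantifier [Dfn_const] is tried before the clause is decomposed.
    Quantifiers over structures are split into three quantifiers over V. Relations applied to an
    explicit [Structure] get branches of their own, because the instances speak of its three
    components as separate arguments. *)
Ltac dfn_step :=
  cbv beta; cbn [univ relI funI rels funs];
  lazymatch goal with
  | |- D1 _ _ => unfold D1
  | |- D2 _ _ => unfold D2
  | |- D3 _ _ => unfold D3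
  | |- D4 _ _ => unfold D4
  | |- D5 _ _ => unfold D5
  | |- D6 _ _ => unfold D6
  | |- DT _ _ => dt
  | |- Dfn _ (fun e => ~ _) => first [simple apply Dfn_const | simple apply Dfn_not]
  | |- Dfn _ (fun e => _ /\ _) => first [simple apply Dfn_const | simple apply Dfn_and]
  | |- Dfn _ (fun e => _ \/ _) => first [simple apply Dfn_const | simple apply Dfn_or]
  | |- Dfn _ (fun e => _ <-> _) => first [simple apply Dfn_const | simple apply Dfn_iff]
  | |- Dfn _ (fun e => exists! x, _) => first [simple apply Dfn_const | simple apply Dfn_exu]
  | |- Dfn _ (fun e => exists x : structure, _) =>
      first [simple apply Dfn_const | simple apply Dfn_ex_structure]
  | |- Dfn _ (fun e => exists x, _) => first [simple apply Dfn_const | simple apply Dfn_ex]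
  | |- Dfn _ (fun e => forall x : structure, _) =>
      first [simple apply Dfn_const | simple apply Dfn_all_structure]
  | |- Dfn _ (fun e => _ -> _) =>
      first [simple apply Dfn_const | simple apply Dfn_imp | simple apply Dfn_all]
  | |- Dfn ?E (fun e => codes _ _ (Structure _ _ _)) =>
      first [simple apply Dfn_const |
        apply (Dfn_S4 E (fun m u r f => codes E m (Structure u r f)));
        [typeclasses eauto|..]]
  | |- Dfn ?E (fun e => is_evaluation _ ?L (Structure _ _ _) _ _ _) =>
      first [simple apply Dfn_const |
        apply (Dfn_S6 E (fun u r f => is_evaluation E L (Structure u r f)));
        [typeclasses eauto|..]]
  | |- Dfn ?E (fun e => is_satisfaction _ ?L (Structure _ _ _) _) =>
      first [simple apply Dfn_const |
        apply (Dfn_S4 E (fun u r f => is_satisfaction E L (Structure u r f)));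
        [typeclasses eauto|..]]
  | |- Dfn ?E (fun e => sat _ ?L (Structure _ _ _) _ _) =>
      first [simple apply Dfn_const |
        apply (Dfn_S5 E (fun u r f => sat E L (Structure u r f)));
        [typeclasses eauto|..]]
  | |- Dfn _ _ => dfn_atom
  end.

Ltac dfn := repeat dfn_step.

(** * Definability of the notions of set theory and logic *)

Section Notions.
Context {V : Type} (E : V -> V -> Prop).

Global Instance D2_subset : D2 E (subset E).
Proof. unfold subset. dfn. Qed.
Global Instance D1_is_empty : D1 E (is_empty E).
Proof. unfold is_empty. dfn. Qed.
Global Instance D3_is_upair : D3 E (is_upair E).
Proof. unfold is_upair. dfn. Qed.
Global Instance D3_is_adjoin : D3 E (is_adjoin E).
Proof. unfold is_adjoin. dfn. Qed.
Global Instance D2_is_succ : D2 E (is_succ E).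
Proof. unfold is_succ. dfn. Qed.
Global Instance D3_is_opair : D3 E (is_opair E).
Proof. unfold is_opair. dfn. Qed.
Global Instance D3_pair_in : D3 E (pair_in E).
Proof. unfold pair_in. dfn. Qed.
Global Instance D2_is_function : D2 E (is_function E).
Proof. unfold is_function. dfn. Qed.
Global Instance D3_maps : D3 E (maps E).
Proof. unfold maps. dfn. Qed.
Global Instance D1_is_inductive : D1 E (is_inductive E).
Proof. unfold is_inductive. dfn. Qed.
Global Instance D1_is_nat : D1 E (is_nat E).
Proof. unfold is_nat. dfn. Qed.
Global Instance D1_is_numeral k : D1 E (is_numeral E k).
Proof. induction k; simpl; dfn. Qed.
(** An environment holds elements of V only, so a structure that varies enters through its three
    components. *)
Global Instance D4_codes : D4 E (fun m u r f => codes E m (Structure u r f)).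
Proof. unfold codes. dfn. Qed.
Global Instance D2_is_tagged k : D2 E (is_tagged E k).
Proof. unfold is_tagged. dfn. Qed.
Global Instance D3_is_tagged2 k : D3 E (is_tagged2 E k).
Proof. unfold is_tagged2. dfn. Qed.
Global Instance D2_term_closed L : D2 E (term_closed E L).
Proof. unfold term_closed. dfn. Qed.
Global Instance D2_is_term L : D2 E (is_term E L).
Proof. unfold is_term. dfn. Qed.
Global Instance D3_is_terms L : D3 E (is_terms E L).
Proof. unfold is_terms. dfn. Qed.
Global Instance D1_is_context : D1 E (is_context E).
Proof. unfold is_context. dfn. Qed.
Global Instance D1_formula_closed L : D1 E (formula_closed E L).
Proof. unfold formula_closed. dfn. Qed.
Global Instance D2_is_formula L : D2 E (is_formula E L).
Proof. unfold is_formula. dfn. Qed.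
Global Instance D4_is_comp : D4 E (is_comp E).
Proof. unfold is_comp. dfn. Qed.
Global Instance D6_is_evaluation L :
  D6 E (fun u r f => is_evaluation E L (Structure u r f)).
Proof. unfold is_evaluation. dfn. Qed.
Global Instance D3_is_evaluation L M : D3 E (is_evaluation E L M).
Proof. unfold is_evaluation. dfn. Qed.
Global Instance D5_is_update : D5 E (is_update E).
Proof. unfold is_update. dfn. Qed.
Global Instance D4_is_satisfaction L :
  D4 E (fun u r f => is_satisfaction E L (Structure u r f)).
Proof. unfold is_satisfaction. dfn. Qed.
Global Instance D5_sat L : D5 E (fun u r f => sat E L (Structure u r f)).
Proof. unfold sat. dfn. Qed.
Global Instance D1_is_satisfaction L M : D1 E (is_satisfaction E L M).
Proof. destruct M. unfold is_satisfaction. dfn. Qed.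
Global Instance D2_sat L M : D2 E (sat E L M).
Proof. unfold sat. dfn. Qed.
End Notions.

Section Model.
Context {V : Type} {E : V -> V -> Prop} {hZF : ZF E}.

Notation "x ∈ y" := (E x y) (at level 70, no associativity).

(** * Set theory inside the model *)

Lemma inhabited_universe : inhabited V.
Proof. destruct (ZF_infinity E hZF) as (a & _). exact (inhabits a). Qed.

(** Applied only to predicates with exactly one witness, so that no choice is
    imported from the metatheory into the model. *)
Definition the (P : V -> Prop) : V := epsilon inhabited_universe P.

Lemma the_spec P : (exists x, P x) -> P (the P).
Proof. apply epsilon_spec. Qed.

Lemma ext a b : (forall x, x ∈ a <-> x ∈ b) -> a = b.
Proof. apply (ZF_extensionality E hZF). Qed.

(** Foundation applied to {a, b}. Its purpose is the injectivity of the successor operation. *)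
Lemma mem_asym a b : a ∈ b -> ~ b ∈ a.
Proof.
  intros H H'. destruct (ZF_pairing E hZF a b) as [p Hp].
  destruct (ZF_foundation E hZF p) as (x & Hx & K).
  - exists a. apply Hp. auto.
  - apply Hp in Hx. destruct Hx; subst x.
    + apply (K b); auto. apply Hp; auto.
    + apply (K a); auto. apply Hp; auto.
Qed.

Definition op (a b : V) : V := the (fun p => is_opair E p a b).

Lemma is_upair_unique p q a b : is_upair E p a b -> is_upair E q a b -> p = q.
Proof. intros H K. apply ext. intros x. rewrite (H x), (K x). reflexivity. Qed.

Lemma op_spec a b : is_opair E (op a b) a b.
Proof.
  apply (the_spec (fun p => is_opair E p a b)). destruct (ZF_pairing E hZF a a) as [s Hs].
  destruct (ZF_pairing E hZF a b) as [d Hd].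
  destruct (ZF_pairing E hZF s d) as [p Hp].
  exists p, s, d. auto.
Qed.

Lemma is_opairE p a b : is_opair E p a b <-> p = op a b.
Proof.
  split; [|intros ->; apply op_spec].
  intros (s & d & Hs & Hd & Hp). destruct (op_spec a b) as (s' & d' & Hs' & Hd' & Hp').
  rewrite (is_upair_unique _ _ _ _ Hs' Hs), (is_upair_unique _ _ _ _ Hd' Hd) in Hp'.
  exact (is_upair_unique _ _ _ _ Hp Hp').
Qed.

Lemma is_upair_inj p a b c d : is_upair E p a b -> is_upair E p c d ->
  (a = c /\ b = d) \/ (a = d /\ b = c).
Proof.
  intros H K.
  assert (Ha : a = c \/ a = d) by (apply K, H; auto).
  assert (Hb : b = c \/ b = d) by (apply K, H; auto).
  assert (Hc : c = a \/ c = b) by (apply H, K; auto).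
  assert (Hd : d = a \/ d = b) by (apply H, K; auto).
  intuition congruence.
Qed.

Lemma op_inj a b c d : op a b = op c d -> a = c /\ b = d.
Proof.
  intros H. destruct (op_spec a b) as (s & t & Hs & Ht & Hp).
  destruct (op_spec c d) as (s' & t' & Hs' & Ht' & Hp').
  rewrite <- H in Hp'.
  destruct (is_upair_inj _ _ _ _ _ Hp Hp') as [[-> ->]|[-> ->]].
  - destruct (is_upair_inj _ _ _ _ _ Hs Hs') as [[-> _]|[-> _]];
    destruct (is_upair_inj _ _ _ _ _ Ht Ht'); intuition congruence.
  - destruct (is_upair_inj _ _ _ _ _ Hs Ht');
    destruct (is_upair_inj _ _ _ _ _ Ht Hs'); intuition congruence.
Qed.

#[export] Instance F2_op : F2 E op.
Proof.
  red. unfold D3. apply Dfn_ext with (fun e => is_opair E (e 0) (e 1) (e 2)).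
  - intros e. symmetry. apply is_opairE.
  - dfn.
Qed.

Lemma pair_inE a b f : pair_in E a b f <-> op a b ∈ f.
Proof.
  split.
  - intros (p & Hp & H). apply is_opairE in Hp. now subst.
  - intros H. exists (op a b). split; [apply op_spec|auto].
Qed.

Lemma empty_exists : exists z, is_empty E z.
Proof. destruct (ZF_infinity E hZF) as (a & (z & H & _) & _). eauto. Qed.

Definition empty : V := the (is_empty E).

Lemma emptyE x : ~ x ∈ empty.
Proof. exact (the_spec _ empty_exists x). Qed.

Lemma is_emptyE z : is_empty E z <-> z = empty.
Proof.
  split; [|intros -> x; apply emptyE].
  intros H. apply ext. intros x. split; intros K; [now apply H in K | now apply emptyE in K].
Qed.

Lemma union_exists a : exists u, forall x, x ∈ u <-> exists b, b ∈ a /\ x ∈ b.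
Proof. apply (ZF_union E hZF). Qed.

Definition bigU (a : V) : V := the (fun u => forall x, x ∈ u <-> exists b, b ∈ a /\ x ∈ b).

Lemma bigUE a x : x ∈ bigU a <-> exists b, b ∈ a /\ x ∈ b.
Proof. exact (the_spec _ (union_exists a) x). Qed.

Lemma union2_exists a b : exists u, forall x, x ∈ u <-> x ∈ a \/ x ∈ b.
Proof.
  destruct (ZF_pairing E hZF a b) as [p Hp]. exists (bigU p). intros x.
  rewrite bigUE. split.
  - intros (c & Hc & Hx). apply Hp in Hc. destruct Hc; subst; auto.
  - intros [H|H]; [exists a | exists b]; split; auto; apply Hp; auto.
Qed.

Definition cup (a b : V) : V := the (fun u => forall x, x ∈ u <-> x ∈ a \/ x ∈ b).

Lemma cupE a b x : x ∈ cup a b <-> x ∈ a \/ x ∈ b.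
Proof. exact (the_spec _ (union2_exists a b) x). Qed.

Definition pow (a : V) : V := the (fun p => forall x, x ∈ p <-> subset E x a).

Lemma powE a x : x ∈ pow a <-> subset E x a.
Proof. exact (the_spec _ (ZF_powerset E hZF a) x). Qed.

Definition upair (a b : V) : V := the (fun p => is_upair E p a b).

Lemma upairE a b x : x ∈ upair a b <-> x = a \/ x = b.
Proof. exact (the_spec _ (ZF_pairing E hZF a b) x). Qed.

Definition adjoin (x a : V) : V := cup x (upair a a).

Lemma adjoinE x a z : z ∈ adjoin x a <-> z ∈ x \/ z = a.
Proof. unfold adjoin. rewrite cupE, upairE. tauto. Qed.

Lemma is_adjoinE y x a : is_adjoin E y x a <-> y = adjoin x a.
Proof.
  split.
  - intros H. apply ext. intros z. rewrite adjoinE. apply H.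
  - intros -> z. apply adjoinE.
Qed.

#[export] Instance F2_adjoin : F2 E adjoin.
Proof.
  red. unfold D3. apply Dfn_ext with (fun e => is_adjoin E (e 0) (e 1) (e 2)).
  - intros e. symmetry. apply is_adjoinE.
  - dfn.
Qed.

(** The Kuratowski pair {{a}, {a, b}} is a set of subsets of A. This is the bound that lets
    Separation form relations and sets of functions. *)
Lemma op_subset_pow a b A : a ∈ A -> b ∈ A -> op a b ∈ pow (pow A).
Proof.
  intros Ha Hb. destruct (op_spec a b) as (s & d & Hs & Hd & Hp).
  apply powE. intros x Hx. apply Hp in Hx. apply powE. intros y Hy.
  destruct Hx; subst x; [apply Hs in Hy | apply Hd in Hy]; destruct Hy; now subst.
Qed.

Lemma op_in_UU a b f : op a b ∈ f -> a ∈ bigU (bigU f) /\ b ∈ bigU (bigU f).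
Proof.
  intros H. destruct (op_spec a b) as (s & d & Hs & Hd & Hp).
  assert (d ∈ bigU f) by (apply bigUE; exists (op a b); split; auto; apply Hp; auto).
  split; apply bigUE; exists d; split; auto; apply Hd; auto.
Qed.

Lemma relation_exists R : D2 E R -> forall A B, exists f,
  (forall p, p ∈ f -> exists a b, a ∈ A /\ b ∈ B /\ p = op a b) /\
  forall a b, pair_in E a b f <-> a ∈ A /\ b ∈ B /\ R a b.
Proof.
  intros HR A B.
  destruct (separation E (fun p => exists a b, a ∈ A /\ b ∈ B /\ p = op a b /\ R a b))
    with (a := pow (pow (cup A B))) as [f Hf]; [dfn|].
  exists f. split.
  - intros p Hp. apply Hf in Hp. destruct Hp as (_ & a & b & H). exists a, b. tauto.
  - intros a b. rewrite pair_inE, Hf. split.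
    + intros (_ & a' & b' & Ha & Hb & He & H). apply op_inj in He.
      destruct He; subst. auto.
    + intros (Ha & Hb & H). split.
      * apply op_subset_pow; apply cupE; auto.
      * exists a, b. auto.
Qed.

(** * Functions, updates and compositions *)

Lemma fn_total f d x : is_function E f d -> x ∈ d -> exists y, pair_in E x y f.
Proof. intros [_ H] Hx. destruct (H x Hx) as (y & Hy & _). eauto. Qed.

Lemma fn_dom f d x y : is_function E f d -> pair_in E x y f -> x ∈ d.
Proof.
  intros [H _] (p & Hp & K). destruct (H p K) as (x' & y' & Hx & Hp').
  apply is_opairE in Hp. apply is_opairE in Hp'. subst p.
  apply op_inj in Hp'. destruct Hp'; now subst.
Qed.

Lemma fn_fun f d x y y' : is_function E f d ->
  pair_in E x y f -> pair_in E x y' f -> y = y'.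
Proof.
  intros H Hy Hy'. assert (Hx := fn_dom _ _ _ _ H Hy).
  destruct H as [_ H]. destruct (H x Hx) as (z & _ & Hz).
  now rewrite <- (Hz y Hy), <- (Hz y' Hy').
Qed.

Lemma fn_elt f d p : is_function E f d -> p ∈ f ->
  exists x y, p = op x y /\ x ∈ d /\ pair_in E x y f.
Proof.
  intros [H _] Hp. destruct (H p Hp) as (x & y & Hx & Hxy).
  apply is_opairE in Hxy. exists x, y. subst. now rewrite pair_inE.
Qed.

Lemma fn_ext f d g : is_function E f d -> is_function E g d ->
  (forall x y, x ∈ d -> pair_in E x y f -> pair_in E x y g) -> f = g.
Proof.
  intros Hf Hg H. apply ext. intros p. split; intros Hp.
  - destruct (fn_elt _ _ _ Hf Hp) as (x & y & -> & Hx & K).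
    apply pair_inE. auto.
  - destruct (fn_elt _ _ _ Hg Hp) as (x & y & -> & Hx & K).
    destruct (fn_total _ _ _ Hf Hx) as (y' & Hy').
    rewrite (fn_fun _ _ _ _ _ Hg K (H _ _ Hx Hy')). now apply pair_inE.
Qed.

Lemma fn_dom_unique f d d' : is_function E f d -> is_function E f d' -> d = d'.
Proof.
  intros H K. apply ext. intros x. split; intros Hx.
  - destruct (fn_total _ _ _ H Hx) as (y & Hy). exact (fn_dom _ _ _ _ K Hy).
  - destruct (fn_total _ _ _ K Hx) as (y & Hy). exact (fn_dom _ _ _ _ H Hy).
Qed.

(** Replacement applied to x ↦ ⟨x, y⟩, so that no codomain has to be known beforehand. Unique
    existence of y is what keeps this free of choice. *)
Lemma function_exists R : D2 E R -> forall d, (forall x, x ∈ d -> exists! y, R x y) ->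
  exists f, is_function E f d /\ forall x y, pair_in E x y f <-> x ∈ d /\ R x y.
Proof.
  intros HR d H.
  destruct (replacement E (fun x p => exists y, p = op x y /\ R x y)) with (a := d)
    as [f Hf].
  - dfn.
  - intros x p q Hx (y & -> & Hy) (y' & -> & Hy').
    destruct (H x Hx) as (z & _ & Hz). now rewrite <- (Hz y Hy), <- (Hz y' Hy').
  - assert (K : forall x y, pair_in E x y f <-> x ∈ d /\ R x y).
    { intros x y. rewrite pair_inE, Hf. split.
      - intros (x' & Hx & y' & He & Hy). apply op_inj in He. destruct He; now subst.
      - intros [Hx Hy]. eauto. }
    exists f. split; [split|]; auto.
    + intros p Hp. apply Hf in Hp. destruct Hp as (x & Hx & y & -> & _).
      exists x, y. split; auto. apply op_spec.
    + intros x Hx. destruct (H x Hx) as (y & Hy & Hu). exists y. split.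
      * apply K. auto.
      * intros y' Hy'. apply Hu. now apply K.
Qed.

Lemma maps_exists d c : exists T, forall s, s ∈ T <-> maps E s d c.
Proof.
  destruct (separation E (fun s => maps E s d c)) with (a := pow (pow (pow (cup d c))))
    as [T HT]; [dfn|].
  exists T. intros s. rewrite HT. split; [tauto|]. intros H. split; auto.
  apply powE. intros p Hp. destruct H as [Hf H].
  destruct (fn_elt _ _ _ Hf Hp) as (x & y & -> & Hx & K).
  apply op_subset_pow; apply cupE; eauto.
Qed.

Lemma update_exists s x n a c : maps E s x c -> a ∈ c ->
  exists s', is_update E s' (adjoin x n) s n a /\ maps E s' (adjoin x n) c.
Proof.
  intros [Hs Hc] Ha.
  destruct (function_exists (fun k b => (k = n /\ b = a) \/ (k <> n /\ pair_in E k b s)))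
    with (d := adjoin x n) as (s' & Hs' & K).
  - dfn.
  - intros k Hk. apply adjoinE in Hk. destruct (classic (k = n)) as [->|Hn].
    + exists a. split; [auto|]. intros b [[_ Hb]|[Hb _]]; [auto|tauto].
    + destruct Hk as [Hk|]; [|tauto]. destruct (fn_total _ _ _ Hs Hk) as (b & Hb).
      exists b. split; auto. intros b' [[Hk' _]|[_ Hb']]; [tauto|].
      exact (fn_fun _ _ _ _ _ Hs Hb Hb').
  - exists s'. split; [split; [|split]|split]; auto.
    + apply K. split; auto. apply adjoinE; auto.
    + intros k b Hk Hb. apply K. split; auto. apply adjoinE. left.
      exact (fn_dom _ _ _ _ Hs Hb).
    + intros k b Hb. apply K in Hb. destruct Hb as (_ & [[_ ->]|[_ Hb]]); auto. eauto.
Qed.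

(** [is_update] only lists pairs that s' must contain; that there are no others holds because s' is
    a function on x ∪ {n}. *)
Lemma update_inv s' s x y n a k b : is_function E s x -> is_adjoin E y x n ->
  is_update E s' y s n a -> pair_in E k b s' ->
  (k = n /\ b = a) \/ (k <> n /\ pair_in E k b s).
Proof.
  intros Hs Hy (Hf & Hn & H) Hk. destruct (classic (k = n)) as [->|Hkn].
  - left. split; auto. exact (fn_fun _ _ _ _ _ Hf Hk Hn).
  - right. split; auto. assert (K := fn_dom _ _ _ _ Hf Hk).
    apply Hy in K. destruct K as [K|]; [|tauto].
    destruct (fn_total _ _ _ Hs K) as (b' & Hb').
    rewrite (fn_fun _ _ _ _ _ Hf Hk (H _ _ Hkn Hb')). auto.
Qed.

Lemma update_maps s' s x y n a c : maps E s x c -> a ∈ c -> is_adjoin E y x n ->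
  is_update E s' y s n a -> maps E s' y c.
Proof.
  intros [Hs Hc] Ha Hy Hu. split; [apply Hu|]. intros k b Hk.
  destruct (update_inv _ _ _ _ _ _ _ _ Hs Hy Hu Hk) as [[_ ->]|[_ H]]; eauto.
Qed.

Lemma update_unique s' s'' s x y n a : is_function E s x -> is_adjoin E y x n ->
  is_update E s' y s n a -> is_update E s'' y s n a -> s' = s''.
Proof.
  intros Hs Hy H K. destruct K as (Hf & Hn & K). apply (fn_ext _ y); [apply H|auto|].
  intros k b _ Hk.
  destruct (update_inv _ _ _ _ _ _ _ _ Hs Hy H Hk) as [[-> ->]|[Hk' Hb]]; auto.
Qed.

Lemma comp_exists as_ts e T c n : is_function E as_ts n ->
  (forall k t, pair_in E k t as_ts -> t ∈ T) -> maps E e T c ->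
  exists as_, is_comp E as_ e as_ts n /\ maps E as_ n c /\
    forall k a, pair_in E k a as_ -> exists t, pair_in E k t as_ts /\ pair_in E t a e.
Proof.
  intros Hts HT [He Hc].
  destruct (function_exists (fun k a => exists t, pair_in E k t as_ts /\ pair_in E t a e))
    with (d := n) as (as_ & Hf & K).
  - dfn.
  - intros k Hk. destruct (fn_total _ _ _ Hts Hk) as (t & Ht).
    destruct (fn_total _ _ _ He (HT _ _ Ht)) as (a & Ha).
    exists a. split; [eauto|]. intros a' (t' & Ht' & Ha').
    rewrite (fn_fun _ _ _ _ _ Hts Ht' Ht) in Ha'.
    exact (fn_fun _ _ _ _ _ He Ha Ha').
  - exists as_. split; [split|split; [split|]]; auto.
    + intros k t a Ht Ha. apply K. split; eauto. exact (fn_dom _ _ _ _ Hts Ht).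
    + intros k a H. apply K in H. destruct H as (_ & t & _ & Ha). eauto.
    + intros k a H. apply K in H. tauto.
Qed.

Lemma comp_unique as_ as' e ts n T : is_function E ts n -> is_function E e T ->
  (forall k t, pair_in E k t ts -> t ∈ T) ->
  is_comp E as_ e ts n -> is_comp E as' e ts n -> as_ = as'.
Proof.
  intros Hts He HT [Hf H] [Hf' H']. apply (fn_ext _ n); auto.
  intros k a Hk Ha. destruct (fn_total _ _ _ Hts Hk) as (t & Ht).
  destruct (fn_total _ _ _ He (HT _ _ Ht)) as (b & Hb).
  rewrite (fn_fun _ _ _ _ _ Hf Ha (H _ _ _ Ht Hb)). eauto.
Qed.

(** * Natural numbers of the model *)

Definition succ (n : V) : V := adjoin n n.

Lemma succE n z : z ∈ succ n <-> z ∈ n \/ z = n.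
Proof. apply adjoinE. Qed.

Lemma is_succE m n : is_succ E m n <-> m = succ n.
Proof. apply is_adjoinE. Qed.

#[export] Instance F1_succ : F1 E succ.
Proof. unfold F1, D2, succ. dfn. Qed.

Lemma nat_empty : is_nat E empty.
Proof. intros a [H _]. apply H. intros x. apply emptyE. Qed.

Lemma nat_succ n : is_nat E n -> is_nat E (succ n).
Proof. intros H a Ha. apply Ha with n; auto. now apply is_succE. Qed.

Lemma omega_exists : exists w, forall n, n ∈ w <-> is_nat E n.
Proof.
  destruct (ZF_infinity E hZF) as (a & (z & Hz & Hza) & Ha).
  destruct (separation E (is_nat E)) with (a := a) as [w Hw]; [dfn|].
  exists w. intros n. rewrite Hw. split; [tauto|]. intros H. split; auto.
  apply H. split.
  - intros z' Hz'. apply is_emptyE in Hz, Hz'. now subst.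
  - intros x y Hx Hy. destruct (Ha x Hx) as (y' & Hy' & K).
    apply is_succE in Hy, Hy'. now subst.
Qed.

Definition omega : V := the (fun w => forall n, n ∈ w <-> is_nat E n).

Lemma omegaE n : n ∈ omega <-> is_nat E n.
Proof. exact (the_spec _ omega_exists n). Qed.

(** Separation cuts an inductive set out of ω, which is why P has to be definable. *)
Lemma nat_induction P : D1 E P -> P empty ->
  (forall n, is_nat E n -> P n -> P (succ n)) -> forall n, is_nat E n -> P n.
Proof.
  intros HP H0 HS n Hn.
  destruct (separation E P HP omega) as [w Hw].
  enough (K : n ∈ w) by (now apply Hw in K).
  apply Hn. split.
  - intros z Hz. apply is_emptyE in Hz. subst. apply Hw. split; auto.
    apply omegaE, nat_empty.
  - intros x y Hx Hy. apply is_succE in Hy. subst.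
    apply Hw in Hx. destruct Hx as [Hx HPx]. apply omegaE in Hx.
    apply Hw. split; auto. apply omegaE. now apply nat_succ.
Qed.

Lemma nat_elt : forall n, is_nat E n -> forall m, m ∈ n -> is_nat E m.
Proof.
  apply (nat_induction (fun n => forall m, m ∈ n -> is_nat E m)); [dfn| |].
  - intros m H. now apply emptyE in H.
  - intros n Hn IH m Hm. apply succE in Hm. destruct Hm; subst; auto.
Qed.

Lemma nat_cases n : is_nat E n -> n = empty \/ exists m, is_nat E m /\ n = succ m.
Proof.
  revert n.
  apply (nat_induction (fun n => n = empty \/ exists m, is_nat E m /\ n = succ m)).
  - apply Dfn_ext with (fun e => e 0 = empty \/ exists m, is_nat E m /\ is_succ E (e 0) m).
    + intros e. split; (intros [H|(m & H & K)]; [auto|right; exists m; split; auto; now apply is_succE]).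
    + dfn.
  - auto.
  - intros n Hn _. right. eauto.
Qed.

Lemma succ_inj m n : succ m = succ n -> m = n.
Proof.
  intros H. assert (Hm : m ∈ succ n) by (rewrite <- H; apply succE; auto).
  assert (Hn : n ∈ succ m) by (rewrite H; apply succE; auto).
  apply succE in Hm, Hn. destruct Hm as [Hm|]; auto. destruct Hn as [Hn|]; auto.
  now apply mem_asym in Hm.
Qed.

Lemma succ_neq_empty n : succ n <> empty.
Proof. intros H. apply (emptyE n). rewrite <- H. apply succE. auto. Qed.

(** The standard numerals, indexed by the natural numbers of the metatheory. They serve as tags of
    codes and as small contexts; a nonstandard model has further natural numbers. *)
Fixpoint num (k : nat) : V := match k with 0 => empty | S j => succ (num j) end.

Lemma is_numeralE k z : is_numeral E k z <-> z = num k.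
Proof.
  revert z. induction k as [|k IH]; intros z; simpl.
  - apply is_emptyE.
  - split.
    + intros (y & Hy & H). apply IH in Hy. apply is_succE in H. now subst.
    + intros ->. exists (num k). split; [now apply IH|now apply is_succE].
Qed.

Lemma nat_num k : is_nat E (num k).
Proof. induction k; simpl; [apply nat_empty|now apply nat_succ]. Qed.

Lemma num_inj j k : num j = num k -> j = k.
Proof.
  revert k. induction j as [|j IH]; intros [|k]; simpl; intros H; auto.
  - symmetry in H. now apply succ_neq_empty in H.
  - now apply succ_neq_empty in H.
  - f_equal. now apply IH, succ_inj.
Qed.

Lemma is_taggedE k c a : is_tagged E k c a <-> c = op (num k) a.
Proof.
  split.
  - intros (z & Hz & H). apply is_numeralE in Hz. apply is_opairE in H. now subst.
  - intros ->. exists (num k). split; [now apply is_numeralE|apply op_spec].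
Qed.

Lemma is_tagged2E k c a b : is_tagged2 E k c a b <-> c = op (num k) (op a b).
Proof.
  split.
  - intros (p & Hp & H). apply is_opairE in Hp. apply is_taggedE in H. now subst.
  - intros ->. exists (op a b). split; [apply op_spec|now apply is_taggedE].
Qed.

Lemma context_adjoin y x n : is_context E x -> is_nat E n -> is_adjoin E y x n ->
  is_context E y.
Proof. intros Hx Hn Hy m Hm. apply Hy in Hm. destruct Hm; subst; auto. Qed.

Lemma context_nat n : is_nat E n -> is_context E n.
Proof. exact (nat_elt n). Qed.

(** * Recursion *)

(** Recursion along a relation [Sub] that is inductive on the set [A]:
    the value at p is {z | Ψ p h z}, with h the restriction of the function
    being defined to the predecessors of p. *)
Section General.
Variables (A : V) (Sub : V -> V -> Prop) (Ψ : V -> V -> V -> Prop).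
Context (HSub : D2 E Sub) (HΨ : D3 E Ψ).
Hypothesis Sub_ind : forall P, D1 E P ->
  (forall p, p ∈ A -> (forall q, q ∈ A -> Sub q p -> P q) -> P p) ->
  forall p, p ∈ A -> P p.
Hypothesis value_exists : forall p h, exists v, forall z, z ∈ v <-> Ψ p h z.

Definition restr (h f p : V) : Prop :=
  forall u, u ∈ h <-> u ∈ f /\ exists q w, u = op q w /\ Sub q p.

Lemma restr_exists f p : exists h, restr h f p.
Proof. apply separation; auto. dfn. Qed.

#[local] Instance D3_restr : D3 E restr.
Proof. unfold restr. dfn. Qed.

(** Partial solutions of the recursion. The domain d contains all predecessors of its elements, so
    the restriction of f passed to Ψ is already the final one. *)
Definition attempt (f d : V) : Prop :=
  subset E d A /\ (forall p q, p ∈ d -> q ∈ A -> Sub q p -> q ∈ d) /\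
  is_function E f d /\
  forall p v h, pair_in E p v f -> restr h f p -> forall z, z ∈ v <-> Ψ p h z.

#[local] Instance D2_attempt : D2 E attempt.
Proof. unfold attempt. dfn. Qed.

Lemma attempt_agree f d f' d' : attempt f d -> attempt f' d' -> forall p, p ∈ A ->
  forall v v', pair_in E p v f -> pair_in E p v' f' -> v = v'.
Proof.
  intros (HdA & Hd & Hf & HΨf) (HdA' & Hd' & Hf' & HΨf').
  apply (Sub_ind (fun p => forall v v', pair_in E p v f -> pair_in E p v' f' -> v = v'));
    [dfn|].
  intros p Hp IH v v' Hv Hv'.
  destruct (restr_exists f p) as [h Hh]. destruct (restr_exists f' p) as [h' Hh'].
  assert (h = h').
  { apply ext. intros u. rewrite (Hh u), (Hh' u).
    split; intros (Hu & q & w & -> & Hq); split; eauto; apply pair_inE in Hu;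
      apply pair_inE.
    - assert (Hqd := fn_dom _ _ _ _ Hf Hu).
      assert (Hqd' : q ∈ d').
      { apply Hd' with p; auto. exact (fn_dom _ _ _ _ Hf' Hv'). }
      destruct (fn_total _ _ _ Hf' Hqd') as (w' & Hw').
      rewrite (IH q (HdA _ Hqd) Hq _ _ Hu Hw'). auto.
    - assert (Hqd' := fn_dom _ _ _ _ Hf' Hu).
      assert (Hqd : q ∈ d).
      { apply Hd with p; auto. exact (fn_dom _ _ _ _ Hf Hv). }
      destruct (fn_total _ _ _ Hf Hqd) as (w' & Hw').
      rewrite <- (IH q (HdA' _ Hqd') Hq _ _ Hw' Hu). auto. }
  subst h'. apply ext. intros z. now rewrite (HΨf p v h), (HΨf' p v' h).
Qed.

Theorem recursion : exists f, is_function E f A /\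
  forall p v, pair_in E p v f -> exists h,
    (forall q w, pair_in E q w h <-> pair_in E q w f /\ Sub q p) /\
    forall z, z ∈ v <-> Ψ p h z.
Proof.
  pose (Val := fun p v => exists f d, attempt f d /\ pair_in E p v f).
  assert (HVal : D2 E Val) by (unfold Val; dfn).
  destruct (separation E (fun p => exists v, Val p v)) with (a := A) as [D HD]; [dfn|].
  destruct (function_exists Val HVal D) as (F0 & HF0 & KF0).
  { intros p Hp. apply HD in Hp. destruct Hp as (Hp & v & f & d & Hf & Hv).
    exists v. split; [exists f, d; auto|].
    intros v' (f' & d' & Hf' & Hv'). exact (attempt_agree _ _ _ _ Hf Hf' p Hp _ _ Hv Hv'). }
  assert (Hatt : attempt F0 D).
  { split; [|split; [|split]]; auto.
    - intros p Hp. now apply HD in Hp.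
    - intros p q Hp Hq Hqp. apply HD in Hp. destruct Hp as (Hp & v & f & d & Hatt & Hv).
      apply HD. split; auto. assert (Hatt' := Hatt).
      destruct Hatt' as (HdA & Hd & Hf & HΨf).
      assert (Hqd : q ∈ d).
      { apply Hd with p; auto. exact (fn_dom _ _ _ _ Hf Hv). }
      destruct (fn_total _ _ _ Hf Hqd) as (w & Hw). exists w, f, d. auto.
    - intros p v h Hv Hh. apply KF0 in Hv. destruct Hv as (Hp & f & d & Hatt & Hv).
      assert (Hatt' := Hatt). destruct Hatt' as (HdA & Hd & Hf & HΨf).
      apply HΨf; auto. intros u. rewrite (Hh u).
      split; intros (Hu & q & w & -> & Hq); split; eauto; apply pair_inE in Hu;
        apply pair_inE.
      + apply KF0 in Hu. destruct Hu as (HqD & Hw). apply HD in HqD.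
        assert (Hqd : q ∈ d).
        { apply Hd with p; [|tauto|auto]. exact (fn_dom _ _ _ _ Hf Hv). }
        destruct (fn_total _ _ _ Hf Hqd) as (w' & Hw'). destruct Hw as (f' & d' & Hf' & Hw).
        rewrite (attempt_agree _ _ _ _ Hf' Hatt q (proj1 HqD) _ _ Hw Hw'). auto.
      + apply KF0. assert (Hqd := fn_dom _ _ _ _ Hf Hu). split.
        * apply HD. split; auto. exists w, f, d. auto.
        * exists f, d. auto. }
  (* If p were missing from D while all its predecessors are present, adjoining the pair of p and
     the value v prescribed by Ψ would give an attempt defined at p. *)
  assert (HDA : forall p, p ∈ A -> p ∈ D).
  { apply (Sub_ind (fun p => p ∈ D)); [dfn|]. intros p Hp IH.
    apply NNPP. intros HpD. destruct (restr_exists F0 p) as [h Hh].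
    destruct (value_exists p h) as [v Hv].
    assert (HF1 : forall x y, pair_in E x y (adjoin F0 (op p v)) <->
      pair_in E x y F0 \/ (x = p /\ y = v)).
    { intros x y. rewrite !pair_inE, adjoinE. split; (intros [H|H]; [auto|right]).
      - now apply op_inj.
      - now destruct H; subst. }
    (* The new pair enters no restriction: if p preceded an element of D, closure of D would put p
       into D, and if p preceded itself, the induction hypothesis would. *)
    assert (Hres : forall q h', (q ∈ D \/ q = p) -> restr h' (adjoin F0 (op p v)) q ->
      restr h' F0 q).
    { intros q h' Hq H u. rewrite (H u), adjoinE. split; [|tauto].
      intros ([Hu|Hu] & q' & w & Hu' & Hq'); [eauto|].
      rewrite Hu in Hu'. apply op_inj in Hu'. destruct Hu'; subst q' w.
      exfalso. destruct Hq; subst; auto.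
      apply HpD. apply (proj1 (proj2 Hatt) q); auto. }
    assert (H1 : attempt (adjoin F0 (op p v)) (adjoin D p)).
    { destruct Hatt as (HdA & Hd & Hf & HΨf). split; [|split; [|split]].
      - intros q Hq. apply adjoinE in Hq. destruct Hq; subst; auto.
      - intros q q' Hq Hq' Hs. apply adjoinE. apply adjoinE in Hq.
        destruct Hq; subst; eauto.
      - split.
        + intros u Hu. apply adjoinE in Hu. destruct Hu as [Hu|Hu].
          * destruct (fn_elt _ _ _ Hf Hu) as (x & y & -> & Hx & _).
            exists x, y. rewrite adjoinE. split; [auto|apply op_spec].
          * subst u. exists p, v. rewrite adjoinE. split; [auto|apply op_spec].
        + intros x Hx. apply adjoinE in Hx. destruct (classic (x = p)) as [->|Hxp].
          * exists v. split; [apply HF1; auto|]. intros y Hy. apply HF1 in Hy.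
            destruct Hy as [Hy|[_ ->]]; auto. apply (fn_dom _ _ _ _ Hf) in Hy. tauto.
          * destruct Hx as [Hx|]; [|tauto]. destruct (fn_total _ _ _ Hf Hx) as (y & Hy).
            exists y. split; [apply HF1; auto|]. intros y' Hy'. apply HF1 in Hy'.
            destruct Hy' as [Hy'|[]]; [|tauto]. exact (fn_fun _ _ _ _ _ Hf Hy Hy').
      - intros q w h' Hw Hh'. apply HF1 in Hw. destruct Hw as [Hw|[-> ->]].
        + apply HΨf; auto. apply Hres; auto. left. exact (fn_dom _ _ _ _ Hf Hw).
        + apply Hres in Hh'; auto. replace h' with h; auto.
          apply ext. intros u. now rewrite (Hh u), (Hh' u). }
    apply HpD, HD. split; auto. exists v, (adjoin F0 (op p v)), (adjoin D p).
    split; auto. apply HF1; auto. }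
  assert (HDeq : D = A).
  { apply ext. intros p. split; auto. apply (proj1 Hatt). }
  subst D. exists F0. split; auto. intros p v Hv.
  destruct (restr_exists F0 p) as [h Hh]. exists h. split.
  - intros q w. rewrite !pair_inE, (Hh (op q w)). split; intros [H K]; split; eauto.
    destruct K as (q' & w' & He & K). apply op_inj in He. destruct He; now subst.
  - intros z. destruct Hatt as (_ & _ & _ & H). now apply H.
Qed.
End General.

Lemma nat_Sub_ind P : D1 E P ->
  (forall p, p ∈ omega -> (forall q, q ∈ omega -> p = succ q -> P q) -> P p) ->
  forall p, p ∈ omega -> P p.
Proof.
  intros HP H p Hp. apply omegaE in Hp. revert p Hp. apply nat_induction; auto.
  - apply H; [apply omegaE, nat_empty|]. intros q _ He. symmetry in He.
    now apply succ_neq_empty in He.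
  - intros n Hn IH. apply H; [now apply omegaE, nat_succ|].
    intros q _ He. apply succ_inj in He. now subst.
Qed.

(** H is the union of the iterates of X ↦ X ∪ P(X), starting from B. *)
Lemma closure_exists B : subset E omega B -> exists H,
  subset E B H /\ (forall x, subset E x B -> x ∈ H) /\
  (forall a b, a ∈ H -> b ∈ H -> op a b ∈ H) /\
  (forall n ts, is_nat E n -> maps E ts n H -> ts ∈ H).
Proof.
  intros HB.
  destruct (recursion omega (fun m n => n = succ m)
    (fun n h z => (n = empty /\ z ∈ B) \/
       exists m w, pair_in E m w h /\ (z ∈ w \/ subset E z w))) as (f & Hf & K).
  - dfn.
  - dfn.
  - exact nat_Sub_ind.
  (* Every value w of h lies in ⋃⋃h, so the elements and the subsets of w are bounded by ⋃U and its
     power set. *)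
  - intros n h. pose (U := bigU (bigU h)).
    destruct (separation E (fun z => (n = empty /\ z ∈ B) \/
       exists m w, pair_in E m w h /\ (z ∈ w \/ subset E z w)))
      with (a := cup B (cup (bigU U) (pow (bigU U)))) as [v Hv]; [dfn|].
    exists v. intros z. rewrite Hv. split; [tauto|]. intros H. split; auto.
    apply cupE. destruct H as [[_ H]|(m & w & H & Hz)]; auto.
    right. apply cupE.
    apply pair_inE in H. apply op_in_UU in H. destruct H as [_ H].
    destruct Hz as [Hz|Hz]; [left; apply bigUE; eauto|].
    right. apply powE. intros y Hy. apply bigUE. eauto.
  - assert (Lex : forall n, is_nat E n -> exists v, pair_in E n v f).
    { intros n Hn. apply (fn_total _ _ _ Hf). now apply omegaE. }
    assert (L0 : forall v, pair_in E empty v f -> v = B).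
    { intros v Hv. destruct (K _ _ Hv) as (h & Hh & Hz). apply ext. intros z.
      rewrite Hz. split; [|auto]. intros [[_ H]|(m & w & H & _)]; auto.
      apply Hh in H. destruct H as [_ H]. symmetry in H. now apply succ_neq_empty in H. }
    assert (LS : forall n v w, pair_in E n v f -> pair_in E (succ n) w f ->
      forall z, z ∈ w <-> z ∈ v \/ subset E z v).
    { intros n v w Hv Hw z. destruct (K _ _ Hw) as (h & Hh & Hz). rewrite Hz. split.
      - intros [[H _]|(m & u & H & Hu)]; [now apply succ_neq_empty in H|].
        apply Hh in H. destruct H as [H He]. apply succ_inj in He. subst m.
        now rewrite (fn_fun _ _ _ _ _ Hf Hv H).
      - intros H. right. exists n, v. split; auto. apply Hh. auto. }
    assert (LB : forall n, is_nat E n -> forall v, pair_in E n v f -> subset E B v).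
    { apply (nat_induction (fun n => forall v, pair_in E n v f -> subset E B v)); [dfn| |].
      - intros v Hv x. now rewrite (L0 v Hv).
      - intros n Hn IH w Hw x Hx. destruct (Lex n Hn) as [v Hv].
        apply (LS n v w Hv Hw). left. now apply (IH v). }
    (* The stages are directed. Instead of comparing m and n, both are lowered together until one of
       them is 0, where the stage is B and lies in every other; the step X ↦ X ∪ P(X) is monotone
       and carries the common bound back up. *)
    assert (Ldir : forall m, is_nat E m -> forall n, is_nat E n ->
      exists k u, is_nat E k /\ pair_in E k u f /\
      forall v w, pair_in E m v f -> pair_in E n w f -> subset E v u /\ subset E w u).
    { apply (nat_induction (fun m => forall n, is_nat E n ->
        exists k u, is_nat E k /\ pair_in E k u f /\
        forall v w, pair_in E m v f -> pair_in E n w f -> subset E v u /\ subset E w u));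
        [dfn| |].
      - intros n Hn. destruct (Lex n Hn) as [u Hu]. exists n, u. split; [auto|split; auto].
        intros v w Hv Hw. rewrite (fn_fun _ _ _ _ _ Hf Hw Hu). apply L0 in Hv. subst v.
        split; [now apply (LB n)|intros x; auto].
      - intros m Hm IH n Hn. destruct (nat_cases n Hn) as [->|(n' & Hn' & ->)].
        + destruct (Lex _ (nat_succ m Hm)) as [u Hu].
          exists (succ m), u. split; [now apply nat_succ|split; auto].
          intros v w Hv Hw. rewrite (fn_fun _ _ _ _ _ Hf Hv Hu). apply L0 in Hw. subst w.
          split; [intros x; auto|]. apply (LB (succ m)); auto using nat_succ.
        + destruct (IH n' Hn') as (k & u & Hk & Hu & H).
          destruct (Lex _ (nat_succ k Hk)) as [u' Hu'].
          exists (succ k), u'. split; [now apply nat_succ|split; auto].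
          intros v w Hv Hw. destruct (Lex m Hm) as [v' Hv']. destruct (Lex n' Hn') as [w' Hw'].
          destruct (H v' w' Hv' Hw') as [H1 H2]. split; intros x Hx.
          * apply (LS k u u' Hu Hu'). apply (LS m v' v Hv' Hv) in Hx.
            destruct Hx as [Hx|Hx]; [auto|right; intros y Hy; auto].
          * apply (LS k u u' Hu Hu'). apply (LS n' w' w Hw' Hw) in Hx.
            destruct Hx as [Hx|Hx]; [auto|right; intros y Hy; auto]. }
    destruct (replacement E (fun n v => pair_in E n v f)) with (a := omega) as [L HL].
    { dfn. }
    { intros x y z _ Hy Hz. exact (fn_fun _ _ _ _ _ Hf Hy Hz). }
    pose (H := bigU L).
    assert (HH : forall x, x ∈ H <-> exists n v, is_nat E n /\ pair_in E n v f /\ x ∈ v).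
    { intros x. unfold H. rewrite bigUE. split.
      - intros (v & Hv & Hx). apply HL in Hv. destruct Hv as (n & Hn & Hv).
        apply omegaE in Hn. eauto.
      - intros (n & v & Hn & Hv & Hx). exists v. split; auto. apply HL. exists n.
        split; auto. now apply omegaE. }
    assert (HS : forall x n v, is_nat E n -> pair_in E n v f -> subset E x v -> x ∈ H).
    { intros x n v Hn Hv Hx. destruct (Lex _ (nat_succ n Hn)) as [w Hw].
      apply HH. exists (succ n), w. split; [now apply nat_succ|split; auto].
      apply (LS n v w); auto. }
    (* A Kuratowski pair is two power sets above its components, hence the stage n + 2. *)
    assert (Hpow : forall n v, is_nat E n -> pair_in E n v f ->
      exists m w, is_nat E m /\ pair_in E m w f /\ forall a b, a ∈ v -> b ∈ v -> op a b ∈ w).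
    { intros n v Hn Hv. destruct (Lex _ (nat_succ n Hn)) as [w Hw].
      destruct (Lex _ (nat_succ _ (nat_succ n Hn))) as [u Hu].
      exists (succ (succ n)), u. split; [now do 2 apply nat_succ|split; auto].
      intros a b Ha Hb. apply (LS _ w u Hw Hu). right.
      assert (Hab := op_subset_pow a b v Ha Hb). apply powE in Hab.
      intros y Hy. apply Hab, powE in Hy. apply (LS _ v w Hv Hw). auto. }
    assert (H2 : forall a b, a ∈ H -> b ∈ H ->
      exists n v, is_nat E n /\ pair_in E n v f /\ a ∈ v /\ b ∈ v).
    { intros a b Ha Hb. apply HH in Ha, Hb. destruct Ha as (n & v & Hn & Hv & Ha).
      destruct Hb as (m & w & Hm & Hw & Hb).
      destruct (Ldir n Hn m Hm) as (k & u & Hk & Hu & Hs).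
      destruct (Hs v w Hv Hw). exists k, u. auto. }
    exists H. split; [|split; [|split]].
    + intros x Hx. destruct (Lex _ nat_empty) as [v Hv]. apply HH. exists empty, v.
      split; [apply nat_empty|split; auto]. now rewrite (L0 v Hv).
    + intros x Hx. destruct (Lex _ nat_empty) as [v Hv].
      apply (HS x empty v nat_empty Hv). now rewrite (L0 v Hv).
    + intros a b Ha Hb. destruct (H2 a b Ha Hb) as (n & v & Hn & Hv & Hav & Hbv).
      destruct (Hpow n v Hn Hv) as (m & w & Hm & Hw & Hop). apply HH. exists m, w. auto.
    (* The entries of a tuple lie in a single stage. The length n may be nonstandard, so this needs
       an induction inside the model. The positions cause no trouble: they are natural numbers and
       belong to B, the first stage. *)
    + assert (Hrange : forall n, is_nat E n -> forall ts, maps E ts n H ->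
        exists k u, is_nat E k /\ pair_in E k u f /\ forall j t, pair_in E j t ts -> t ∈ u).
      { apply (nat_induction (fun n => forall ts, maps E ts n H ->
          exists k u, is_nat E k /\ pair_in E k u f /\
          forall j t, pair_in E j t ts -> t ∈ u)); [dfn| |].
        - intros ts [Hts _]. destruct (Lex _ nat_empty) as [v Hv]. exists empty, v.
          split; [apply nat_empty|split; auto]. intros j t Hj.
          apply (fn_dom _ _ _ _ Hts) in Hj. now apply emptyE in Hj.
        - intros n Hn IH ts [Hts HtsH].
          destruct (function_exists (fun j t => pair_in E j t ts)) with (d := n)
            as (ts' & Hts' & Kts').
          { dfn. }
          { intros j Hj. destruct (fn_total _ _ _ Hts (proj2 (succE n j) (or_introl Hj)))
              as [t Ht]. exists t. split; auto. intros t' Ht'.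
            exact (fn_fun _ _ _ _ _ Hts Ht Ht'). }
          destruct (IH ts') as (k & u & Hk & Hu & Hr).
          { split; auto. intros j t Hj. apply Kts' in Hj. apply (HtsH j). tauto. }
          destruct (fn_total _ _ n Hts (proj2 (succE n n) (or_intror eq_refl))) as [t Ht].
          assert (HtH := HtsH _ _ Ht). apply HH in HtH.
          destruct HtH as (m & w & Hm & Hw & Htw).
          destruct (Ldir k Hk m Hm) as (l & x & Hl & Hx & Hs).
          destruct (Hs u w Hu Hw) as [Hux Hwx]. exists l, x. split; auto. split; auto.
          intros j t' Hj. assert (Hjn := fn_dom _ _ _ _ Hts Hj). apply succE in Hjn.
          destruct Hjn as [Hjn|Hjn]; [|subst j].
          + apply Hux. apply (Hr j). apply Kts'. auto.
          + apply Hwx. now rewrite (fn_fun _ _ _ _ _ Hts Hj Ht). }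
      intros n ts Hn Hts. destruct (Hrange n Hn ts Hts) as (k & u & Hk & Hu & Hr).
      destruct (Hpow k u Hk Hu) as (m & w & Hm & Hw & Hop).
      apply (HS ts m w); auto. intros p Hp.
      destruct (fn_elt _ _ _ (proj1 Hts) Hp) as (j & t & -> & Hj & Hjt). apply Hop; eauto.
      apply (LB k Hk u Hu), HB, omegaE. exact (nat_elt n Hn j Hj).
Qed.

Ltac tag_inversion :=
  repeat match goal with
  | H : op _ _ = op _ _ |- _ =>
      apply op_inj in H; destruct H as [H ?]
  | H : num ?j = num ?k |- _ =>
      apply num_inj in H; first [discriminate H | clear H]
  end.

(** * Syntax and satisfaction *)

Lemma is_varE c n : is_var E c n <-> c = op (num 0) n.
Proof. apply is_taggedE. Qed.
Lemma is_appE c g ts : is_app E c g ts <-> c = op (num 1) (op g ts).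
Proof. apply is_tagged2E. Qed.
Lemma is_eqnE c t u : is_eqn E c t u <-> c = op (num 0) (op t u).
Proof. apply is_tagged2E. Qed.
Lemma is_relE c r ts : is_rel E c r ts <-> c = op (num 1) (op r ts).
Proof. apply is_tagged2E. Qed.
Lemma is_negE c p : is_neg E c p <-> c = op (num 2) p.
Proof. apply is_taggedE. Qed.
Lemma is_andE c p q : is_and E c p q <-> c = op (num 3) (op p q).
Proof. apply is_tagged2E. Qed.
Lemma is_exE c n p : is_ex E c n p <-> c = op (num 4) (op n p).
Proof. apply is_tagged2E. Qed.

(** * Terms and formulas *)

Section Syntax.
Context (L : @language V).
Hypothesis HL : wf_language E L.

(** [is_term] and [is_formula] quantify over closed sets, and would hold of everything if no set
    were closed. H contains all raw material of the syntax and is closed under the formation of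
    codes; it bounds every separation below. Contexts belong to H as subsets of ω. *)
Lemma syntax_set : exists H,
  (forall n, is_nat E n -> n ∈ H) /\ (forall x, is_context E x -> x ∈ H) /\
  (forall a b, a ∈ H -> b ∈ H -> op a b ∈ H) /\
  (forall g n, pair_in E g n (funs L) -> g ∈ H) /\
  (forall r n, pair_in E r n (rels L) -> r ∈ H) /\
  (forall n ts, is_nat E n -> maps E ts n H -> ts ∈ H).
Proof.
  destruct HL as ((dr & Hr) & (df & Hf) & _).
  destruct (closure_exists (cup omega (cup dr df))) as (H & HB & Hsub & Hop & Hts).
  { intros x Hx. apply cupE. auto. }
  exists H. repeat split; auto.
  - intros n Hn. apply HB, cupE. left. now apply omegaE.
  - intros x Hx. apply Hsub. intros n Hn. apply cupE. left. now apply omegaE, Hx.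
  - intros g n Hg. apply HB. rewrite !cupE. right. right. exact (fn_dom _ _ _ _ Hf Hg).
  - intros r n Hn. apply HB. rewrite !cupE. right. left. exact (fn_dom _ _ _ _ Hr Hn).
Qed.

Lemma term_var x n c : n ∈ x -> is_var E c n -> is_term E L x c.
Proof. intros Hn Hc T HT. exact (proj1 HT n c Hn Hc). Qed.

Lemma term_app x g n ts c : pair_in E g n (funs L) -> is_terms E L x n ts ->
  is_app E c g ts -> is_term E L x c.
Proof.
  intros Hg [Hts Ht] Hc T HT. apply (proj2 HT g n ts c); auto.
  split; auto. intros k t Hk. exact (Ht k t Hk T HT).
Qed.

(** A term lies in every closed set, in particular in {t ∈ H | t is a term and P(t)}; H is there
    because Separation needs a bound. *)
Lemma term_induction P x : D1 E P -> is_context E x ->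
  (forall n c, n ∈ x -> is_var E c n -> P c) ->
  (forall g n ts c, pair_in E g n (funs L) -> is_terms E L x n ts ->
     (forall k t, pair_in E k t ts -> P t) -> is_app E c g ts -> P c) ->
  forall t, is_term E L x t -> P t.
Proof.
  intros HP Hx Hvar Happ t Ht. destruct syntax_set as (H & Hn & _ & Hop & Hg & _ & Hts).
  destruct (separation E (fun t => is_term E L x t /\ P t)) with (a := H) as [T HT]; [dfn|].
  enough (K : t ∈ T) by (now apply HT in K).
  apply Ht. split.
  - intros n c Hnx Hc. apply HT. split; [|split].
    + apply is_varE in Hc. subst c. apply Hop; apply Hn; [apply nat_num|auto].
    + exact (term_var x n c Hnx Hc).
    + eauto.
  - intros g n ts c Hgn [Hf HfT] Hc.
    assert (Hnat : is_nat E n) by (apply (proj2 (proj2 (proj2 HL)) g n Hgn)).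
    assert (Hterms : is_terms E L x n ts).
    { split; auto. intros k u Hu. apply HfT in Hu. apply HT in Hu. tauto. }
    apply HT. split; [|split].
    + apply is_appE in Hc. subst c. apply Hop; [apply Hn, nat_num|]. apply Hop; eauto.
      apply (Hts n); auto. split; auto. intros k u Hu. apply HfT in Hu. apply HT in Hu. tauto.
    + exact (term_app x g n ts c Hgn Hterms Hc).
    + apply (Happ g n ts c); auto. intros k u Hu. apply HfT in Hu. apply HT in Hu. tauto.
Qed.

Lemma terms_exist x : is_context E x -> exists T, forall t, t ∈ T <-> is_term E L x t.
Proof.
  intros Hx. destruct syntax_set as (H & Hn & _ & Hop & Hg & _ & Hts).
  destruct (separation E (is_term E L x)) with (a := H) as [T HT]; [dfn|].
  exists T. intros t. rewrite HT. split; [tauto|]. intros Ht. split; auto.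
  revert t Ht. apply term_induction; [dfn|auto| |].
  - intros n c Hnx Hc. apply is_varE in Hc. subst c. apply Hop; apply Hn; [apply nat_num|auto].
  - intros g n ts c Hgn [Hf _] IH Hc. apply is_appE in Hc. subst c.
    apply Hop; [apply Hn, nat_num|]. apply Hop; eauto.
    apply (Hts n); [apply (proj2 (proj2 (proj2 HL)) g n Hgn)|]. split; auto.
Qed.

Lemma formula_eqn x t u c : is_context E x -> is_term E L x t -> is_term E L x u ->
  is_eqn E c t u -> is_formula E L x c.
Proof. intros Hx Ht Hu Hc W HW. destruct (HW x Hx) as (H & _). eauto. Qed.

Lemma formula_rel x r n ts c : is_context E x -> pair_in E r n (rels L) ->
  is_terms E L x n ts -> is_rel E c r ts -> is_formula E L x c.
Proof. intros Hx Hr Hts Hc W HW. destruct (HW x Hx) as (_ & H & _). eauto. Qed.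

Lemma formula_neg x p c : is_context E x -> is_formula E L x p -> is_neg E c p ->
  is_formula E L x c.
Proof.
  intros Hx Hp Hc W HW. destruct (HW x Hx) as (_ & _ & H & _). apply (H p); auto.
Qed.

Lemma formula_and x p q c : is_context E x -> is_formula E L x p ->
  is_formula E L x q -> is_and E c p q -> is_formula E L x c.
Proof.
  intros Hx Hp Hq Hc W HW. destruct (HW x Hx) as (_ & _ & _ & H & _). apply (H p q); auto.
Qed.

Lemma formula_ex x n y p c : is_context E x -> is_nat E n -> is_adjoin E y x n ->
  is_formula E L y p -> is_ex E c n p -> is_formula E L x c.
Proof.
  intros Hx Hn Hy Hp Hc W HW. destruct (HW x Hx) as (_ & _ & _ & _ & H).
  apply (H n y p); auto.
Qed.

(** The closed set {⟨x, p⟩ ∈ H × H | p is a formula in x and Q(x, p)} yields at once the induction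
    principle and a bound for the codes of formulas. The context takes part in the induction because
    ∃v_n changes it. *)
Lemma formula_induction_aux Q : D2 E Q ->
  (forall x t u c, is_context E x -> is_term E L x t -> is_term E L x u ->
     is_eqn E c t u -> Q x c) ->
  (forall x r n ts c, is_context E x -> pair_in E r n (rels L) -> is_terms E L x n ts ->
     is_rel E c r ts -> Q x c) ->
  (forall x p c, is_context E x -> is_formula E L x p -> Q x p -> is_neg E c p -> Q x c) ->
  (forall x p q c, is_context E x -> is_formula E L x p -> is_formula E L x q ->
     Q x p -> Q x q -> is_and E c p q -> Q x c) ->
  (forall x n y p c, is_context E x -> is_nat E n -> is_adjoin E y x n ->
     is_formula E L y p -> Q y p -> is_ex E c n p -> Q x c) ->
  exists H, forall x p, is_formula E L x p -> p ∈ H /\ Q x p.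
Proof.
  intros HQ H1 H2 H3 H4 H5. destruct syntax_set as (H & Hn & Hctx & Hop & Hg & Hr & Hts).
  destruct (relation_exists (fun x p => is_context E x /\ is_formula E L x p /\ Q x p))
    with (A := H) (B := H) as (W & _ & HW); [dfn|].
  exists H. intros x p Hp. enough (K : pair_in E x p W) by (apply HW in K; tauto).
  assert (HtH : forall x, is_context E x -> forall t, is_term E L x t -> t ∈ H).
  { intros z Hz. apply term_induction; [dfn|auto| |].
    - intros n c Hnx Hc. apply is_varE in Hc. subst c.
      apply Hop; apply Hn; [apply nat_num|auto].
    - intros g n ts c Hgn [Hf _] IH Hc. apply is_appE in Hc. subst c.
      apply Hop; [apply Hn, nat_num|]. apply Hop; eauto.
      apply (Hts n); [apply (proj2 (proj2 (proj2 HL)) g n Hgn)|]. split; auto. }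
  apply Hp. clear x p Hp. intros x Hx. repeat split.
  - intros t u c Ht Hu Hc. apply HW. repeat split; eauto using formula_eqn.
    apply is_eqnE in Hc. subst c. apply Hop; [apply Hn, nat_num|]. apply Hop; eauto.
  - intros r n ts c Hrn Hterms Hc. apply HW. repeat split; eauto using formula_rel.
    apply is_relE in Hc. subst c. apply Hop; [apply Hn, nat_num|]. apply Hop; eauto.
    apply (Hts n); [apply (proj1 (proj2 (proj2 HL)) r n Hrn)|].
    destruct Hterms as [Hf Ht]. split; eauto.
  - intros p c Hp Hc. apply HW in Hp. destruct Hp as (_ & Hp & _ & Hp' & Hp'').
    apply HW. repeat split; auto; [|now apply (formula_neg x p)|now apply (H3 x p)].
    apply is_negE in Hc. subst c. apply Hop; auto. apply Hn, nat_num.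
  - intros p q c Hp Hq Hc. apply HW in Hp, Hq. destruct Hp as (_ & Hp & _ & Hp' & Hp'').
    destruct Hq as (_ & Hq & _ & Hq' & Hq'').
    apply HW. repeat split; auto; [|now apply (formula_and x p q)|now apply (H4 x p q)].
    apply is_andE in Hc. subst c. apply Hop; auto. apply Hn, nat_num.
  - intros n y p c Hnat Hy Hp Hc. apply HW in Hp. destruct Hp as (_ & Hp & _ & Hp' & Hp'').
    apply HW. repeat split; auto; [|now apply (formula_ex x n y p)|now apply (H5 x n y p)].
    apply is_exE in Hc. subst c. apply Hop; auto. apply Hn, nat_num.
Qed.

Lemma formulas_bounded : exists H, forall x p, is_formula E L x p -> p ∈ H.
Proof.
  destruct (formula_induction_aux (fun _ _ => True)) as [H HH]; auto; [dfn|].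
  exists H. intros x p Hp. now apply (HH x).
Qed.

Lemma formula_induction Q : D2 E Q ->
  (forall x t u c, is_context E x -> is_term E L x t -> is_term E L x u ->
     is_eqn E c t u -> Q x c) ->
  (forall x r n ts c, is_context E x -> pair_in E r n (rels L) -> is_terms E L x n ts ->
     is_rel E c r ts -> Q x c) ->
  (forall x p c, is_context E x -> is_formula E L x p -> Q x p -> is_neg E c p -> Q x c) ->
  (forall x p q c, is_context E x -> is_formula E L x p -> is_formula E L x q ->
     Q x p -> Q x q -> is_and E c p q -> Q x c) ->
  (forall x n y p c, is_context E x -> is_nat E n -> is_adjoin E y x n ->
     is_formula E L y p -> Q y p -> is_ex E c n p -> Q x c) ->
  forall x p, is_formula E L x p -> Q x p.
Proof.
  intros HQ H1 H2 H3 H4 H5 x p Hp.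
  destruct (formula_induction_aux Q HQ H1 H2 H3 H4 H5) as [H HH]. now apply HH.
Qed.

End Syntax.

(** * Evaluation and satisfaction in a structure *)

Section Structures.
Context (L : @language V) (M : @structure V).
Hypothesis HL : wf_language E L.
Hypothesis HM : wf_structure E L M.

Lemma relI_total r n : pair_in E r n (rels L) -> exists X, pair_in E r X (relI M).
Proof.
  intros Hr. destruct HM as (_ & (d & Hd & Hd') & _).
  exact (fn_total _ _ _ Hd' (fn_dom _ _ _ _ Hd Hr)).
Qed.

Lemma relI_unique r X X' : pair_in E r X (relI M) -> pair_in E r X' (relI M) -> X = X'.
Proof. destruct HM as (_ & (d & _ & Hd) & _). apply (fn_fun _ _ _ _ _ Hd). Qed.

Lemma funI_total g n : pair_in E g n (funs L) ->
  exists G, pair_in E g G (funI M) /\ is_operation E G n (univ M).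
Proof.
  intros Hg. destruct HM as (_ & _ & _ & (d & Hd & Hd') & Hop).
  destruct (fn_total _ _ _ Hd' (fn_dom _ _ _ _ Hd Hg)) as [G HG]. eauto.
Qed.

Lemma funI_unique g G G' : pair_in E g G (funI M) -> pair_in E g G' (funI M) -> G = G'.
Proof. destruct HM as (_ & _ & _ & (d & _ & Hd) & _). apply (fn_fun _ _ _ _ _ Hd). Qed.

Lemma operation_total G n a as_ : is_operation E G n a -> maps E as_ n a ->
  exists b, pair_in E as_ b G /\ b ∈ a.
Proof.
  intros (T & HT & HG & Hc) Has. apply HT in Has.
  destruct (fn_total _ _ _ HG Has) as [b Hb]. eauto.
Qed.

Lemma operation_fun G n a as_ b b' : is_operation E G n a ->
  pair_in E as_ b G -> pair_in E as_ b' G -> b = b'.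
Proof. intros (T & HT & HG & Hc). apply (fn_fun _ _ _ _ _ HG). Qed.

Lemma evaluation_fun x s e t a b : is_evaluation E L M x s e ->
  pair_in E t a e -> pair_in E t b e -> a = b.
Proof. intros ((T & _ & He & _) & _). apply (fn_fun _ _ _ _ _ He). Qed.

Lemma evaluation_total x s e t : is_evaluation E L M x s e -> is_term E L x t ->
  exists a, pair_in E t a e /\ a ∈ univ M.
Proof.
  intros ((T & HT & He & Hc) & _) Ht. apply HT in Ht.
  destruct (fn_total _ _ _ He Ht) as [a Ha]. eauto.
Qed.

Lemma evaluation_term x s e t a : is_evaluation E L M x s e -> pair_in E t a e ->
  is_term E L x t /\ a ∈ univ M.
Proof.
  intros ((T & HT & He & Hc) & _) Ha. split; [|eauto].
  apply HT. exact (fn_dom _ _ _ _ He Ha).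
Qed.

Lemma evaluation_comp x s e ts n : is_evaluation E L M x s e -> is_terms E L x n ts ->
  exists as_, is_comp E as_ e ts n /\ maps E as_ n (univ M).
Proof.
  intros ((T & HT & He) & _) [Hts Ht].
  destruct (comp_exists ts e T (univ M) n) as (as_ & H1 & H2 & _); eauto.
  intros k t Hk. apply HT. eauto.
Qed.

Lemma evaluation_comp_unique x s e ts n as_ as' : is_evaluation E L M x s e ->
  is_terms E L x n ts -> is_comp E as_ e ts n -> is_comp E as' e ts n -> as_ = as'.
Proof.
  intros ((T & HT & He & _) & _) [Hts Ht]. apply (comp_unique _ _ _ _ _ T); auto.
  intros k t Hk. apply HT. eauto.
Qed.

Lemma evaluation_unique x s e e' : is_context E x -> maps E s x (univ M) ->
  is_evaluation E L M x s e -> is_evaluation E L M x s e' -> e = e'.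
Proof.
  intros Hx [Hs _] He He'.
  assert (He0 := He). assert (He0' := He').
  destruct He0 as ((T & HT & Hf & _) & Hv & Ha).
  destruct He0' as ((T' & HT' & Hf' & _) & Hv' & Ha').
  assert (T = T') by (apply ext; intros t; now rewrite HT, HT'). subst T'.
  apply (fn_ext _ T); auto. intros t a Ht. apply HT in Ht. revert t Ht a.
  apply (term_induction L HL (fun t => forall a, pair_in E t a e -> pair_in E t a e'));
    [dfn|auto| |].
  - intros n c Hn Hc a Hca. destruct (fn_total _ _ _ Hs Hn) as [b Hb].
    rewrite (fn_fun _ _ _ _ _ Hf Hca (Hv n c b Hc Hb)). eauto.
  - intros g n ts c Hg Hts IH Hc a Hca.
    destruct (funI_total g n Hg) as (G & HG & Hop).
    destruct (evaluation_comp x s e ts n He Hts) as (as_ & Has & Hm).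
    destruct (operation_total _ _ _ _ Hop Hm) as (b & Hb & _).
    rewrite (fn_fun _ _ _ _ _ Hf Hca (Ha g n ts c G as_ b Hg Hts Hc HG Has Hb)).
    apply (Ha' g n ts c G as_ b); auto.
    split; [apply Has|]. intros k t d Hk Htd. apply (proj2 Has k t); auto.
    destruct (evaluation_total x s e t He (proj2 Hts k t Hk)) as (d' & Hd' & _).
    rewrite (fn_fun _ _ _ _ _ Hf' Htd (IH k t Hk d' Hd')). auto.
Qed.

Lemma evaluation_exists x s : is_context E x -> maps E s x (univ M) ->
  exists e, is_evaluation E L M x s e.
Proof.
  intros Hx Hs. destruct (terms_exist L HL x Hx) as [T HT].
  (* R t h v: v is the value of t if h gives the values of its immediate arguments. *)
  pose (R := fun t h v => (exists n, is_var E t n /\ pair_in E n v s) \/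
    exists g n ts G as_, pair_in E g n (funs L) /\ is_app E t g ts /\
      pair_in E g G (funI M) /\ is_comp E as_ h ts n /\ pair_in E as_ v G).
  (* [recursion] describes a value by its elements, whereas R describes the value itself. The value
     is therefore taken to be the union of all v with R t h v, which is v when v is unique; the
     bound ⋃(univ M) makes it a set for every h. *)
  destruct (recursion T (fun u t => exists g ts k, is_app E t g ts /\ pair_in E k u ts)
    (fun t h z => z ∈ bigU (univ M) /\ exists v, z ∈ v /\ R t h v)) as (e & Hf & K).
  - dfn.
  - unfold R. dfn.
  - intros P HP H t Ht. apply HT in Ht.
    enough (is_term E L x t /\ P t) by tauto. revert t Ht.
    apply (term_induction L HL); [dfn|auto| |].
    + intros n c Hn Hc. assert (Hc' := term_var L x n c Hn Hc). split; auto.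
      apply H; [now apply HT|]. intros q _ (g & ts & k & Hq & _).
      apply is_varE in Hc. apply is_appE in Hq. subst c. tag_inversion.
    + intros g n ts c Hg Hts IH Hc. assert (Hc' := term_app L x g n ts c Hg Hts Hc).
      split; auto. apply H; [now apply HT|]. intros q _ (g' & ts' & k & Hq & Hk).
      apply is_appE in Hc, Hq. subst c. tag_inversion. subst. now apply (IH k).
  - intros t h. apply separation; auto. unfold R. dfn.
  (* Here the union collapses to v, the only candidate; h may be any restriction of e to the
     arguments of t. *)
  - assert (Hval : forall t v h, R t h v -> (forall v', R t h v' -> v' = v) ->
      v ∈ univ M -> (forall q w, pair_in E q w h <-> pair_in E q w e /\
        exists g ts k, is_app E t g ts /\ pair_in E k q ts) ->
      t ∈ T -> pair_in E t v e).
    { intros t v h Hv Huniq HvM Hh Ht. destruct (fn_total _ _ _ Hf Ht) as [u Hu].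
      destruct (K t u Hu) as (h' & Hh' & Hz).
      assert (HR : forall v, R t h' v <-> R t h v).
      { assert (Hp : forall g ts k q w, is_app E t g ts -> pair_in E k q ts ->
          pair_in E q w h' <-> pair_in E q w h).
        { intros. now rewrite Hh', Hh. }
        intros v'. unfold R. split; (intros [H|(g & n & ts & G & as_ & H1 & H2 & H3 & H4 & H5)];
          [auto|right; exists g, n, ts, G, as_]); repeat split; auto; try apply H4;
          intros k q a Hk Hq; apply (proj2 H4 k q); auto; now apply (Hp g ts k q a). }
      replace v with u; auto. apply ext. intros z. rewrite Hz. split.
      - intros (_ & v' & Hzv & Hv'). apply HR in Hv'. now rewrite <- (Huniq v' Hv').
      - intros Hzv. split; [apply bigUE; eauto|]. exists v. split; auto. now apply HR. }
    assert (Hh : forall t, exists h, forall q w, pair_in E q w h <-> pair_in E q w e /\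
        exists g ts k, is_app E t g ts /\ pair_in E k q ts).
    { intros t. destruct (separation E (fun p => exists q w, is_opair E p q w /\
        exists g ts k, is_app E t g ts /\ pair_in E k q ts)) with (a := e) as [h Hh]; [dfn|].
      exists h. intros q w. rewrite !pair_inE, Hh. split; intros [H1 H2]; split; auto.
      - destruct H2 as (q' & w' & He & H2). apply is_opairE, op_inj in He.
        destruct He; now subst.
      - exists q, w. split; auto. apply op_spec. }
    destruct Hs as [Hs HsM].
    assert (Hvar : forall n c a, is_var E c n -> pair_in E n a s -> pair_in E c a e).
    { intros n c a Hc Ha. destruct (Hh c) as [h Hch]. apply (Hval c a h); auto.
      - left. eauto.
      - intros v' [(n' & Hn' & Hv')|(g & n' & ts & G & as_ & _ & Hg & _)].
        + apply is_varE in Hc, Hn'. subst c. tag_inversion. subst.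
          exact (fn_fun _ _ _ _ _ Hs Hv' Ha).
        + apply is_varE in Hc. apply is_appE in Hg. subst c. tag_inversion.
      - eauto.
      - apply HT. apply (term_var L x n); auto. exact (fn_dom _ _ _ _ Hs Ha). }
    assert (Happ : forall g n ts c G as_ b, pair_in E g n (funs L) -> is_terms E L x n ts ->
      is_app E c g ts -> pair_in E g G (funI M) -> is_comp E as_ e ts n ->
      maps E as_ n (univ M) -> pair_in E as_ b G -> pair_in E c b e).
    { intros g n ts c G as_ b Hg Hts Hc HG Has Hm Hb. destruct (Hh c) as [h Hch].
      assert (Hcomp : is_comp E as_ h ts n).
      { split; [apply Has|]. intros k t a Hk Ha. apply (proj2 Has k t a Hk). now apply Hch. }
      apply (Hval c b h); auto.
      - right. exists g, n, ts, G, as_. auto.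
      - intros v' [(n' & Hn' & _)|(g' & n' & ts' & G' & as' & Hg' & Hc' & HG' & Has' & Hv')].
        + apply is_varE in Hn'. apply is_appE in Hc. subst c. tag_inversion.
        + apply is_appE in Hc, Hc'. subst c. tag_inversion. subst g' ts'.
          destruct HL as (_ & (df & Hdf) & _).
          rewrite (fn_fun _ _ _ _ _ Hdf Hg' Hg) in *.
          rewrite (funI_unique _ _ _ HG' HG) in *.
          assert (as' = as_).
          { apply (comp_unique as' as_ e ts n T); [apply Hts|auto| | |auto].
            - intros k t Hk. apply HT. apply (proj2 Hts k t Hk).
            - split; [apply Has'|]. intros k t a Hk Ha. apply (proj2 Has' k t); auto.
              apply Hch. split; auto. exists g, ts, k. split; auto. now apply is_appE. }
          subst as'. destruct (funI_total g n Hg) as (G'' & HG'' & Hop).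
          rewrite (funI_unique _ _ _ HG'' HG) in *.
          exact (operation_fun _ _ _ _ _ _ Hop Hv' Hb).
      - destruct (funI_total g n Hg) as (G' & HG'' & Hop).
        rewrite (funI_unique _ _ _ HG'' HG) in *. destruct Hop as (T' & _ & Hop). 
        exact (proj2 Hop _ _ Hb).
      - apply HT. exact (term_app L x g n ts c Hg Hts Hc). }
    assert (HeM : forall t, is_term E L x t -> forall a, pair_in E t a e -> a ∈ univ M).
    { apply (term_induction L HL (fun t => forall a, pair_in E t a e -> a ∈ univ M));
        [dfn|auto| |].
      - intros n c Hn Hc a Ha. destruct (fn_total _ _ _ Hs Hn) as [b Hb].
        rewrite (fn_fun _ _ _ _ _ Hf Ha (Hvar n c b Hc Hb)). eauto.
      - intros g n ts c Hg Hts IH Hc a Ha.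
        destruct (funI_total g n Hg) as (G & HG & Hop).
        (* It is not yet known that e takes its values in M. A crude set containing the range of e
           serves as codomain, until the induction hypothesis replaces it by [univ M]. *)
        destruct (comp_exists ts e T (bigU (pow (cup (univ M) (bigU (bigU e))))) n)
          as (as_ & Has & _ & Has').
        { apply Hts. }
        { intros k t Hk. apply HT. apply (proj2 Hts k t Hk). }
        { split; auto. intros t b Hb. apply bigUE.
          exists (cup (univ M) (bigU (bigU e))). rewrite powE, cupE.
          split; [intros z; auto|]. right. now apply pair_inE, op_in_UU in Hb. }
        assert (Hm : maps E as_ n (univ M)).
        { split; [apply Has|]. intros k b Hb. destruct (Has' k b Hb) as (t & Ht & Hbt).
          exact (IH k t Ht b Hbt). }
        destruct (operation_total _ _ _ _ Hop Hm) as (b & Hb & HbM).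
        rewrite (fn_fun _ _ _ _ _ Hf Ha (Happ g n ts c G as_ b Hg Hts Hc HG Has Hm Hb)).
        auto. }
    exists e. split; [|split].
    + exists T. split; auto. split; auto. intros t a Ha. apply (HeM t); auto.
      apply HT. exact (fn_dom _ _ _ _ Hf Ha).
    + exact Hvar.
    + intros g n ts c G as_ b Hg Hts Hc HG Has Hb.
      apply (Happ g n ts c G as_ b); auto.
      split; [apply Has|]. intros k a Ha. 
      destruct (fn_total _ _ _ (proj1 Hts) (fn_dom _ _ _ _ (proj1 Has) Ha)) as [t Ht].
      assert (Htt := proj2 Hts k t Ht). assert (HtT := Htt). apply HT in HtT.
      destruct (fn_total _ _ _ Hf HtT) as [d Hd].
      rewrite (fn_fun _ _ _ _ _ (proj1 Has) Ha (proj2 Has k t d Ht Hd)).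
      exact (HeM t Htt d Hd).
Qed.

Lemma satisfaction_exists : exists S, is_satisfaction E L M S.
Proof.
  destruct (formulas_bounded L HL) as [H HH].
  destruct (separation E (fun p => exists x, is_formula E L x p)) with (a := H)
    as [A HA0]; [dfn|].
  assert (HA : forall x p, is_formula E L x p -> p ∈ A).
  { intros x p Hp. apply HA0. eauto. }
  (* The assignments for all contexts together: the recursion runs over codes of formulas, and an
     existential formula refers to assignments in another context. *)
  destruct (separation E (fun s => exists x, is_context E x /\ maps E s x (univ M)))
    with (a := pow (pow (pow (cup omega (univ M))))) as [Ass HAss0]; [dfn|].
  assert (HAss : forall x s, is_context E x -> maps E s x (univ M) -> s ∈ Ass).
  { intros x s Hx Hs. apply HAss0. split; [|eauto]. apply powE. intros p Hp.
    destruct (fn_elt _ _ _ (proj1 Hs) Hp) as (n & a & -> & Hn & Ha).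
    apply op_subset_pow; apply cupE; [left; now apply omegaE, Hx|right].
    exact (proj2 Hs n a Ha). }
  pose (Sub := fun q p => is_neg E p q \/ (exists r, is_and E p q r) \/
    (exists r, is_and E p r q) \/ (exists n, is_ex E p n q)).
  pose (In h p s := exists w, pair_in E p w h /\ s ∈ w).
  (* Tarski's clauses, with h holding the satisfying assignments of each immediate constituent. The
     context does not occur as an argument: it is recovered as the domain of s. *)
  pose (Φ := fun c h s =>
    (exists x e t u a, maps E s x (univ M) /\ is_evaluation E L M x s e /\
       is_eqn E c t u /\ pair_in E t a e /\ pair_in E u a e) \/
    (exists x e r n ts as_ X, maps E s x (univ M) /\ is_evaluation E L M x s e /\
       is_rel E c r ts /\ pair_in E r n (rels L) /\ is_comp E as_ e ts n /\
       pair_in E r X (relI M) /\ as_ ∈ X) \/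
    (exists p, is_neg E c p /\ ~ In h p s) \/
    (exists p q, is_and E c p q /\ In h p s /\ In h q s) \/
    (exists n p a s' x y, is_ex E c n p /\ maps E s x (univ M) /\ is_adjoin E y x n /\
       a ∈ univ M /\ is_update E s' y s n a /\ In h p s')).
  destruct (recursion A Sub (fun c h s => s ∈ Ass /\ Φ c h s)) as (f & Hf & K).
  - unfold Sub. dfn.
  - unfold Φ, In. dfn.
  - intros P HP Hind p Hp. apply HA0 in Hp. destruct Hp as (_ & x & Hp). revert x p Hp.
    apply (formula_induction L HL (fun _ p => P p)); [dfn| | | | |].
    (* Atomic codes carry the tags 0 and 1, while [Sub] inspects only codes with the tags 2, 3 and
       4: there are no predecessors. *)
    + intros x t u c Hx Ht Hu Hc. apply Hind; [eauto using formula_eqn|].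
      apply is_eqnE in Hc. intros q _ [Hq|[[r Hq]|[[r Hq]|[r Hq]]]];
        apply is_negE in Hq || apply is_andE in Hq || apply is_exE in Hq;
        subst c; tag_inversion.
    + intros x r n ts c Hx Hr Hts Hc. apply Hind; [eauto using formula_rel|].
      apply is_relE in Hc. intros q _ [Hq|[[r' Hq]|[[r' Hq]|[r' Hq]]]];
        apply is_negE in Hq || apply is_andE in Hq || apply is_exE in Hq;
        subst c; tag_inversion.
    + intros x p c Hx Hp IH Hc. apply Hind; [apply (HA x), (formula_neg L x p); auto|].
      apply is_negE in Hc. intros q _ [Hq|[[r' Hq]|[[r' Hq]|[r' Hq]]]];
        apply is_negE in Hq || apply is_andE in Hq || apply is_exE in Hq;
        subst c; tag_inversion; now subst.
    + intros x p q c Hx Hp Hq IHp IHq Hc.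
      apply Hind; [apply (HA x), (formula_and L x p q); auto|].
      apply is_andE in Hc. intros q' _ [Hq'|[[r' Hq']|[[r' Hq']|[r' Hq']]]];
        apply is_negE in Hq' || apply is_andE in Hq' || apply is_exE in Hq';
        subst c; tag_inversion; now subst.
    + intros x n y p c Hx Hn Hy Hp IH Hc.
      apply Hind; [apply (HA x), (formula_ex L x n y p); auto|].
      apply is_exE in Hc. intros q' _ [Hq'|[[r' Hq']|[[r' Hq']|[r' Hq']]]];
        apply is_negE in Hq' || apply is_andE in Hq' || apply is_exE in Hq';
        subst c; tag_inversion; now subst.
  - intros p h. destruct (separation E (Φ p h)) with (a := Ass) as [v Hv].
    { unfold Φ, In. dfn. }
    exists v. exact Hv.
  - destruct (relation_exists (fun p s => exists w, pair_in E p w f /\ s ∈ w))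
      with (A := A) (B := Ass) as (S & _ & HS); [dfn|].
    (* Trades the local function h for the set S, so that each of Tarski's clauses for S becomes one
       disjunct of Φ; the other disjuncts are refuted by their tags. *)
    assert (KS : forall c s, c ∈ A -> s ∈ Ass -> exists h,
      (forall p s', Sub p c -> (In h p s' <-> pair_in E p s' S)) /\
      (pair_in E c s S <-> Φ c h s)).
    { intros c s Hc Hs. destruct (fn_total _ _ _ Hf Hc) as [w Hw].
      destruct (K c w Hw) as (h & Hh & Hz). exists h. split.
      - intros p s' Hp. rewrite HS. unfold In. split.
        + intros (u & Hu & Hs'). apply Hh in Hu. destruct Hu as [Hu _].
          split; [exact (fn_dom _ _ _ _ Hf Hu)|split; [|eauto]].
          destruct (K p u Hu) as (h' & _ & Hz'). now apply Hz' in Hs'.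
        + intros (_ & _ & u & Hu & Hs'). exists u. split; auto. apply Hh. auto.
      - rewrite HS. split.
        + intros (_ & _ & u & Hu & Hsu). rewrite (fn_fun _ _ _ _ _ Hf Hu Hw) in Hsu.
          now apply Hz in Hsu.
        + intros HΦ. split; [|split]; auto. exists w. split; auto. apply Hz. auto. }
    (* An assignment determines its context, so the evaluation occurring in Φ is the given e. *)
    assert (Hdom : forall s x x', maps E s x (univ M) -> maps E s x' (univ M) -> x = x').
    { intros s x x' [Hs _] [Hs' _]. exact (fn_dom_unique _ _ _ Hs Hs'). }
    exists S. intros x s e Hx Hs He. assert (HsA := HAss x s Hx Hs).
    split; [|split; [|split; [|split]]].
    + intros t u c Ht Hu Hc.
      destruct (KS c s (HA x c (formula_eqn L x t u c Hx Ht Hu Hc)) HsA) as (h & _ & HΦ).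
      rewrite HΦ. apply is_eqnE in Hc. split.
      * intros [H1|[H1|[H1|[H1|H1]]]].
        -- destruct H1 as (x' & e' & t' & u' & a & Hs' & He' & Hc' & Hta & Hua).
           apply is_eqnE in Hc'. subst c. tag_inversion. subst t' u'.
           rewrite <- (Hdom _ _ _ Hs Hs') in He'.
           rewrite (evaluation_unique x s e e' Hx Hs He He'). eauto.
        -- destruct H1 as (x' & e' & r & n & ts & as_ & X & _ & _ & Hc' & _).
           apply is_relE in Hc'. subst c. tag_inversion.
        -- destruct H1 as (p & Hc' & _). apply is_negE in Hc'. subst c. tag_inversion.
        -- destruct H1 as (p & q & Hc' & _). apply is_andE in Hc'. subst c. tag_inversion.
        -- destruct H1 as (n & p & a & s' & x' & y & Hc' & _).
           apply is_exE in Hc'. subst c. tag_inversion.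
      * intros (a & Hta & Hua). left. exists x, e, t, u, a.
        repeat (split; auto). now apply is_eqnE.
    + intros r n ts c Hr Hts Hc.
      destruct (KS c s (HA x c (formula_rel L x r n ts c Hx Hr Hts Hc)) HsA) as (h & _ & HΦ).
      rewrite HΦ. apply is_relE in Hc. split.
      * intros [H1|[H1|[H1|[H1|H1]]]].
        -- destruct H1 as (x' & e' & t' & u' & a & Hs' & He' & Hc' & _).
           apply is_eqnE in Hc'. subst c. tag_inversion.
        -- destruct H1 as (x' & e' & r' & n' & ts' & as_ & X & Hs' & He' & Hc' & Hr' & H2).
           apply is_relE in Hc'. subst c. tag_inversion. subst r' ts'.
           rewrite <- (Hdom _ _ _ Hs Hs') in He'.
           rewrite (evaluation_unique x s e e' Hx Hs He He').
           destruct HL as ((dr & Hdr) & _). rewrite (fn_fun _ _ _ _ _ Hdr Hr Hr').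
           exists as_, X. auto.
        -- destruct H1 as (p & Hc' & _). apply is_negE in Hc'. subst c. tag_inversion.
        -- destruct H1 as (p & q & Hc' & _). apply is_andE in Hc'. subst c. tag_inversion.
        -- destruct H1 as (n' & p & a & s' & x' & y & Hc' & _).
           apply is_exE in Hc'. subst c. tag_inversion.
      * intros (as_ & X & H1 & H2 & H3). right. left. exists x, e, r, n, ts, as_, X.
        repeat (split; auto). now apply is_relE.
    + intros p c Hp Hc.
      destruct (KS c s (HA x c (formula_neg L x p c Hx Hp Hc)) HsA) as (h & Hh & HΦ).
      rewrite <- (Hh p s) by (left; auto). rewrite HΦ. assert (Hc0 := Hc).
      apply is_negE in Hc. split.
      * intros [H1|[H1|[H1|[H1|H1]]]].
        -- destruct H1 as (x' & e' & t' & u' & a & Hs' & He' & Hc' & _).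
           apply is_eqnE in Hc'. subst c. tag_inversion.
        -- destruct H1 as (x' & e' & r & n & ts & as_ & X & _ & _ & Hc' & _).
           apply is_relE in Hc'. subst c. tag_inversion.
        -- destruct H1 as (p' & Hc' & H1). apply is_negE in Hc'. subst c. tag_inversion.
           now subst p'.
        -- destruct H1 as (p' & q & Hc' & _). apply is_andE in Hc'. subst c. tag_inversion.
        -- destruct H1 as (n' & p' & a & s' & x' & y & Hc' & _).
           apply is_exE in Hc'. subst c. tag_inversion.
      * intros H1. right. right. left. eauto.
    + intros p q c Hp Hq Hc.
      destruct (KS c s (HA x c (formula_and L x p q c Hx Hp Hq Hc)) HsA) as (h & Hh & HΦ).
      rewrite <- (Hh p s) by (right; left; eauto).
      rewrite <- (Hh q s) by (right; right; left; eauto).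
      rewrite HΦ. assert (Hc0 := Hc).
      apply is_andE in Hc. split.
      * intros [H1|[H1|[H1|[H1|H1]]]].
        -- destruct H1 as (x' & e' & t' & u' & a & Hs' & He' & Hc' & _).
           apply is_eqnE in Hc'. subst c. tag_inversion.
        -- destruct H1 as (x' & e' & r & n & ts & as_ & X & _ & _ & Hc' & _).
           apply is_relE in Hc'. subst c. tag_inversion.
        -- destruct H1 as (p' & Hc' & H1). apply is_negE in Hc'. subst c. tag_inversion.
        -- destruct H1 as (p' & q' & Hc' & H1). apply is_andE in Hc'. subst c. tag_inversion.
           now subst p' q'.
        -- destruct H1 as (n' & p' & a & s' & x' & y & Hc' & _).
           apply is_exE in Hc'. subst c. tag_inversion.
      * intros H1. right. right. right. left. exists p, q. auto.
    + intros n y p c Hn Hy Hp Hc.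
      destruct (KS c s (HA x c (formula_ex L x n y p c Hx Hn Hy Hp Hc)) HsA) as (h & Hh & HΦ).
      assert (Hsub : Sub p c) by (right; right; right; eauto).
      rewrite HΦ. assert (Hc0 := Hc).
      apply is_exE in Hc. split.
      * intros [H1|[H1|[H1|[H1|H1]]]].
        -- destruct H1 as (x' & e' & t' & u' & a & Hs' & He' & Hc' & _).
           apply is_eqnE in Hc'. subst c. tag_inversion.
        -- destruct H1 as (x' & e' & r & n' & ts & as_ & X & _ & _ & Hc' & _).
           apply is_relE in Hc'. subst c. tag_inversion.
        -- destruct H1 as (p' & Hc' & H1). apply is_negE in Hc'. subst c. tag_inversion.
        -- destruct H1 as (p' & q' & Hc' & H1). apply is_andE in Hc'. subst c. tag_inversion.
        -- destruct H1 as (n' & p' & a & s' & x' & y' & Hc' & Hs' & Hy' & Ha & Hu & H1).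
           apply is_exE in Hc'. subst c. tag_inversion. subst n' p'.
           rewrite <- (Hdom _ _ _ Hs Hs') in Hy'.
           apply is_adjoinE in Hy, Hy'. subst y y'. exists a, s'.
           repeat (split; auto). now apply Hh.
      * intros (a & s' & Ha & Hu & H1). right. right. right. right.
        exists n, p, a, s', x, y. repeat (split; auto). now apply Hh.
Qed.

(** [sat] asks for some satisfaction set containing the pair; agreement of all of them makes this as
    good as asking for every one, as the clause for negation requires. *)
Lemma satisfaction_agree S S' : is_satisfaction E L M S -> is_satisfaction E L M S' ->
  forall x p, is_formula E L x p -> is_context E x -> forall s, maps E s x (univ M) ->
  (pair_in E p s S <-> pair_in E p s S').
Proof.
  intros HS HS'.
  apply (formula_induction L HL (fun x p => is_context E x ->
    forall s, maps E s x (univ M) -> (pair_in E p s S <-> pair_in E p s S')));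
    [dfn| | | | |].
  - intros x t u c Hx Ht Hu Hc _ s Hs. destruct (evaluation_exists x s Hx Hs) as [e He].
    destruct (HS x s e Hx Hs He) as (H1 & _). destruct (HS' x s e Hx Hs He) as (H2 & _).
    now rewrite (H1 t u c), (H2 t u c).
  - intros x r n ts c Hx Hr Hts Hc _ s Hs. destruct (evaluation_exists x s Hx Hs) as [e He].
    destruct (HS x s e Hx Hs He) as (_ & H1 & _).
    destruct (HS' x s e Hx Hs He) as (_ & H2 & _).
    now rewrite (H1 r n ts c), (H2 r n ts c).
  - intros x p c Hx Hp IH Hc _ s Hs. destruct (evaluation_exists x s Hx Hs) as [e He].
    destruct (HS x s e Hx Hs He) as (_ & _ & H1 & _).
    destruct (HS' x s e Hx Hs He) as (_ & _ & H2 & _).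
    now rewrite (H1 p c), (H2 p c), (IH Hx s).
  - intros x p q c Hx Hp Hq IHp IHq Hc _ s Hs.
    destruct (evaluation_exists x s Hx Hs) as [e He].
    destruct (HS x s e Hx Hs He) as (_ & _ & _ & H1 & _).
    destruct (HS' x s e Hx Hs He) as (_ & _ & _ & H2 & _).
    now rewrite (H1 p q c), (H2 p q c), (IHp Hx s), (IHq Hx s).
  - intros x n y p c Hx Hn Hy Hp IH Hc _ s Hs.
    destruct (evaluation_exists x s Hx Hs) as [e He].
    destruct (HS x s e Hx Hs He) as (_ & _ & _ & _ & H1).
    destruct (HS' x s e Hx Hs He) as (_ & _ & _ & _ & H2).
    rewrite (H1 n y p c), (H2 n y p c); auto.
    assert (Hyc := context_adjoin y x n Hx Hn Hy).
    split; intros (a & s' & Ha & Hu & H); exists a, s'; split; auto; split; auto;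
      apply (IH Hyc s'); auto; exact (update_maps _ _ _ _ _ _ _ Hs Ha Hy Hu).
Qed.

Lemma sat_satisfaction S : is_satisfaction E L M S ->
  forall x p s, is_context E x -> is_formula E L x p -> maps E s x (univ M) ->
  (sat E L M p s <-> pair_in E p s S).
Proof.
  intros HS x p s Hx Hp Hs. split.
  - intros (S' & HS' & H). now apply (satisfaction_agree S S' HS HS' x p).
  - intros H. exists S. auto.
Qed.

Lemma sat_eqn x s e t u c : is_context E x -> maps E s x (univ M) ->
  is_evaluation E L M x s e -> is_term E L x t -> is_term E L x u -> is_eqn E c t u ->
  (sat E L M c s <-> exists a, pair_in E t a e /\ pair_in E u a e).
Proof.
  intros Hx Hs He Ht Hu Hc. destruct satisfaction_exists as [S HS].
  rewrite (sat_satisfaction S HS x c s); auto; [|now apply (formula_eqn L x t u)].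
  destruct (HS x s e Hx Hs He) as (H & _). now apply H.
Qed.

Lemma sat_rel x s e r n ts c : is_context E x -> maps E s x (univ M) ->
  is_evaluation E L M x s e -> pair_in E r n (rels L) -> is_terms E L x n ts ->
  is_rel E c r ts ->
  (sat E L M c s <->
    exists as_ X, is_comp E as_ e ts n /\ pair_in E r X (relI M) /\ as_ ∈ X).
Proof.
  intros Hx Hs He Hr Hts Hc. destruct satisfaction_exists as [S HS].
  rewrite (sat_satisfaction S HS x c s); auto; [|now apply (formula_rel L x r n ts)].
  destruct (HS x s e Hx Hs He) as (_ & H & _). now apply H.
Qed.

Lemma sat_neg x s p c : is_context E x -> maps E s x (univ M) -> is_formula E L x p ->
  is_neg E c p -> (sat E L M c s <-> ~ sat E L M p s).
Proof.
  intros Hx Hs Hp Hc. destruct satisfaction_exists as [S HS].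
  destruct (evaluation_exists x s Hx Hs) as [e He].
  rewrite !(sat_satisfaction S HS x _ s); auto; [|now apply (formula_neg L x p)].
  destruct (HS x s e Hx Hs He) as (_ & _ & H & _). now apply H.
Qed.

Lemma sat_and x s p q c : is_context E x -> maps E s x (univ M) -> is_formula E L x p ->
  is_formula E L x q -> is_and E c p q ->
  (sat E L M c s <-> sat E L M p s /\ sat E L M q s).
Proof.
  intros Hx Hs Hp Hq Hc. destruct satisfaction_exists as [S HS].
  destruct (evaluation_exists x s Hx Hs) as [e He].
  rewrite !(sat_satisfaction S HS x _ s); auto; [|now apply (formula_and L x p q)].
  destruct (HS x s e Hx Hs He) as (_ & _ & _ & H & _). now apply H.
Qed.

Lemma sat_ex x s n y p c : is_context E x -> maps E s x (univ M) -> is_nat E n ->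
  is_adjoin E y x n -> is_formula E L y p -> is_ex E c n p ->
  (sat E L M c s <->
    exists a s', a ∈ univ M /\ is_update E s' y s n a /\ sat E L M p s').
Proof.
  intros Hx Hs Hn Hy Hp Hc. destruct satisfaction_exists as [S HS].
  destruct (evaluation_exists x s Hx Hs) as [e He].
  rewrite (sat_satisfaction S HS x c s); auto; [|now apply (formula_ex L x n y p)].
  destruct (HS x s e Hx Hs He) as (_ & _ & _ & _ & H). rewrite (H n y p c); auto.
  split; intros (a & s' & Ha & Hu & H1); exists a, s'; split; auto; split; auto;
    apply (sat_satisfaction S HS y); auto;
    solve [exact (context_adjoin y x n Hx Hn Hy) |
           exact (update_maps _ _ _ _ _ _ _ Hs Ha Hy Hu)].
Qed.

End Structures.

(** * From ultrafilter choice to Łoś's theorem *)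

Section Large.

Context (I U : V).
Hypothesis HU : is_ultrafilter E I U.

(** Upward closure of U applies to sets: the one for Q comes from Separation, hence the definability
    condition, while the one for P is part of [large]. *)
Lemma large_mono P Q : D1 E Q -> (forall i, i ∈ I -> P i -> Q i) ->
  large E I U P -> large E I U Q.
Proof.
  intros HQ H (X & HX & HP). destruct (separation E Q HQ I) as [Y HY].
  exists Y. split; auto. destruct HU as (_ & _ & _ & Hup & _).
  apply (Hup X); auto.
  - intros i Hi. apply HP in Hi. apply HY. split; [tauto|]. apply H; tauto.
  - intros i Hi. now apply HY in Hi.
Qed.

Lemma large_ext P Q : (forall i, i ∈ I -> (P i <-> Q i)) ->
  (large E I U P <-> large E I U Q).
Proof.
  intros H. split; intros (X & HX & K); exists X; split; auto; intros i; rewrite K;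
    split; intros [Hi Hp]; split; auto; now apply H.
Qed.

Lemma large_and P Q : large E I U P -> large E I U Q ->
  large E I U (fun i => P i /\ Q i).
Proof.
  intros (X & HX & KX) (Y & HY & KY).
  destruct (separation E (fun i => i ∈ Y)) with (a := X) as [Z HZ]; [dfn|].
  exists Z. split.
  - destruct HU as (_ & _ & _ & _ & Hcap & _). exact (Hcap X Y Z HX HY HZ).
  - intros i. rewrite HZ, KX, KY. tauto.
Qed.

Lemma large_not P : D1 E P -> (large E I U (fun i => ~ P i) <-> ~ large E I U P).
Proof.
  intros HP. split.
  - intros H K. destruct (large_and _ _ H K) as (X & HX & KX).
    destruct HU as (_ & _ & Hne & _). apply (Hne X); auto.
    intros i Hi. apply KX in Hi. tauto.
  - intros H. destruct (separation E P HP I) as [X HX].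
    destruct (separation E (fun i => ~ P i)) with (a := I) as [Y HY]; [dfn|].
    destruct HU as (_ & _ & _ & _ & _ & Hult). destruct (Hult X Y) as [K|K].
    + intros i Hi. now apply HX in Hi.
    + intros i. rewrite HY, HX. tauto.
    + exfalso. apply H. exists X. auto.
    + exists Y. auto.
Qed.

Lemma large_all P : (forall i, i ∈ I -> P i) -> large E I U P.
Proof.
  intros H. destruct HU as (_ & HI & _). exists I. split; auto.
  intros i. split; [auto|tauto].
Qed.

(** Both the nonemptiness of the B_i and the correctness of g are demanded only for almost all i.
    This is exactly the information that a class modulo U carries; g is total on I with arbitrary
    values elsewhere. *)
Definition ultra_choice : Prop :=
  forall B, is_function E B I ->
  large E I U (fun i => exists b z, pair_in E i b B /\ z ∈ b) ->
  exists g, is_function E g I /\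
    large E I U (fun i => exists b z, pair_in E i b B /\ pair_in E i z g /\ z ∈ b).

End Large.

(** * The product of a family and its classes modulo the ultrafilter *)

Section Los.

Lemma codes_unique m M M' : codes E m M -> codes E m M' -> M = M'.
Proof.
  intros (p & Hp & Hm) (p' & Hp' & Hm').
  apply is_opairE in Hp, Hm, Hp', Hm'. subst p p' m.
  apply op_inj in Hm'. destruct Hm' as [H1 H2]. apply op_inj in H2. destruct H2.
  destruct M, M'. simpl in *. congruence.
Qed.

Lemma codes_exists M : exists m, codes E m M.
Proof.
  exists (op (univ M) (op (relI M) (funI M))), (op (relI M) (funI M)).
  split; apply op_spec.
Qed.

Context (L : @language V) (I F U : V).
Hypothesis HL : wf_language E L.
Hypothesis HF : is_family E L I F.
Hypothesis HU : is_ultrafilter E I U.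

Lemma member_exists i : i ∈ I -> exists M, member E F i M /\ wf_structure E L M.
Proof. apply HF. Qed.

Lemma member_unique i M M' : member E F i M -> member E F i M' -> M = M'.
Proof.
  intros (m & Hm & Hc) (m' & Hm' & Hc').
  rewrite (fn_fun _ _ _ _ _ (proj1 HF) Hm' Hm) in Hc'.
  exact (codes_unique m M M' Hc Hc').
Qed.

Lemma member_wf i M : member E F i M -> wf_structure E L M.
Proof.
  intros H. destruct (member_exists i) as (M' & HM' & Hwf).
  - destruct H as (m & Hm & _). exact (fn_dom _ _ _ _ (proj1 HF) Hm).
  - now rewrite (member_unique i M M' H HM').
Qed.

#[local] Instance D1_in_product : D1 E (in_product E I F).
Proof. unfold in_product, member. dfn. Qed.

#[local] Instance D2_is_class : D2 E (is_class E I F U).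
Proof. unfold is_class, large. dfn. Qed.

#[local] Instance D2_is_product_tuple : D2 E (is_product_tuple E I F).
Proof. unfold is_product_tuple. dfn. Qed.

#[local] Instance D3_is_class_tuple : D3 E (is_class_tuple E I F U).
Proof. unfold is_class_tuple. dfn. Qed.

#[local] Instance D4_is_slice : D4 E (is_slice E).
Proof. unfold is_slice. dfn. Qed.

Lemma product_set : exists P, forall f, f ∈ P <-> in_product E I F f.
Proof.
  (* A code ⟨univ, ⟨relI, funI⟩⟩ in the range of F lies in ⋃⋃F, so its universe lies two more unions
     down, and the elements of the universe one further. *)
  pose (UU := fun a => bigU (bigU a)).
  pose (B := cup I (bigU (UU (UU F)))).
  destruct (separation E (in_product E I F)) with (a := pow (pow (pow B))) as [P HP].
  { apply D1_in_product. }
  exists P. intros f. rewrite HP. split; [tauto|]. intros Hf. split; auto.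
  apply powE. intros p Hp. destruct (fn_elt _ _ _ (proj1 Hf) Hp) as (i & a & -> & Hi & Ha).
  apply op_subset_pow; apply cupE; auto. right.
  destruct (member_exists i Hi) as (M & HM & _).
  assert (HaM := proj2 Hf i M a HM Ha). destruct HM as (m & Hm & p & Hp' & Hmp).
  apply is_opairE in Hp', Hmp. subst p m. apply pair_inE in Hm.
  apply op_in_UU in Hm. destruct Hm as [_ Hm]. apply op_in_UU in Hm.
  apply bigUE. exists (univ M). split; auto. apply Hm.
Qed.

Lemma in_product_total f i : in_product E I F f -> i ∈ I ->
  exists a, pair_in E i a f.
Proof. intros [Hf _]. apply (fn_total _ _ _ Hf). Qed.

Lemma class_exists f : exists c, is_class E I F U c f.
Proof.
  destruct product_set as [P HP].
  destruct (separation E (fun g => in_product E I F g /\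
    large E I U (fun i => exists a, pair_in E i a f /\ pair_in E i a g))) with (a := P)
    as [c Hc].
  { unfold large. dfn. }
  exists c. intros g. rewrite Hc, HP. tauto.
Qed.

Lemma class_unique c c' f : is_class E I F U c f -> is_class E I F U c' f -> c = c'.
Proof. intros H K. apply ext. intros g. now rewrite (H g), (K g). Qed.

Lemma class_eq f g c d : in_product E I F f -> in_product E I F g ->
  is_class E I F U c f -> is_class E I F U d g ->
  (c = d <-> large E I U (fun i => exists a, pair_in E i a f /\ pair_in E i a g)).
Proof.
  intros Hf Hg Hc Hd. split.
  - intros ->. assert (H : g ∈ d).
    { apply Hd. split; auto. apply large_all; auto. intros i Hi.
      destruct (in_product_total g i Hg Hi) as [a Ha]. eauto. }
    apply Hc in H. tauto.
  - intros H. apply ext. intros h. rewrite (Hc h), (Hd h).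
    split; intros [Hh K]; split; auto; generalize (large_and _ _ HU _ _ H K);
      apply large_mono; auto; try dfn; intros i Hi ((a & H1 & H2) & (b & H3 & H4)).
    + rewrite (fn_fun _ _ _ _ _ (proj1 Hf) H1 H3) in H2. eauto.
    + rewrite (fn_fun _ _ _ _ _ (proj1 Hg) H2 H3) in H1. eauto.
Qed.

Section Tuples.
Context (x fs : V).
Hypothesis Hfs : is_product_tuple E I F x fs.

Lemma slice_exists i M : i ∈ I -> member E F i M ->
  exists as_, is_slice E as_ x fs i /\ maps E as_ x (univ M) /\
    forall k a, pair_in E k a as_ -> exists f, pair_in E k f fs /\ pair_in E i a f.
Proof.
  intros Hi HM. destruct Hfs as [Hf Hp].
  destruct (function_exists (fun k a => exists f, pair_in E k f fs /\ pair_in E i a f))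
    with (d := x) as (as_ & Has & K).
  - dfn.
  - intros k Hk. destruct (fn_total _ _ _ Hf Hk) as [f Hkf].
    destruct (in_product_total f i (Hp k f Hkf) Hi) as [a Ha].
    exists a. split; [eauto|]. intros b (g & Hg & Hb).
    rewrite (fn_fun _ _ _ _ _ Hf Hg Hkf) in Hb.
    exact (fn_fun _ _ _ _ _ (proj1 (Hp k f Hkf)) Ha Hb).
  - exists as_. split; [split|split; [split|]]; auto.
    + intros k f a Hkf Ha. apply K. split; [exact (fn_dom _ _ _ _ Hf Hkf)|eauto].
    + intros k a Hka. apply K in Hka. destruct Hka as (_ & f & Hkf & Ha).
      exact (proj2 (Hp k f Hkf) i M a HM Ha).
    + intros k a Hka. now apply K in Hka.
Qed.

Lemma slice_unique i as_ as' : i ∈ I ->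
  is_slice E as_ x fs i -> is_slice E as' x fs i -> as_ = as'.
Proof.
  intros Hi [Has H] [Has' H']. destruct Hfs as [Hf Hp].
  apply (fn_ext _ x); auto. intros k a Hk Ha.
  destruct (fn_total _ _ _ Hf Hk) as [f Hkf].
  destruct (in_product_total f i (Hp k f Hkf) Hi) as [b Hb].
  rewrite (fn_fun _ _ _ _ _ Has Ha (H k f b Hkf Hb)). eauto.
Qed.

Lemma class_tuple_exists : exists cs, is_class_tuple E I F U x cs fs.
Proof.
  destruct Hfs as [Hf Hp].
  destruct (function_exists (fun k c => exists f, pair_in E k f fs /\ is_class E I F U c f))
    with (d := x) as (cs & Hcs & K).
  - dfn.
  - intros k Hk. destruct (fn_total _ _ _ Hf Hk) as [f Hkf].
    destruct (class_exists f) as [c Hc]. exists c. split; [eauto|].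
    intros c' (g & Hg & Hc'). rewrite (fn_fun _ _ _ _ _ Hf Hg Hkf) in Hc'.
    exact (class_unique c c' f Hc Hc').
  - exists cs. split; auto. intros k f c Hkf Hc. apply K.
    split; [exact (fn_dom _ _ _ _ Hf Hkf)|eauto].
Qed.

Lemma class_tuple_inv cs k c : is_class_tuple E I F U x cs fs -> pair_in E k c cs ->
  exists f, pair_in E k f fs /\ is_class E I F U c f.
Proof.
  intros [Hcs H] Hc. destruct Hfs as [Hf Hp].
  destruct (fn_total _ _ _ Hf (fn_dom _ _ _ _ Hcs Hc)) as [f Hkf].
  destruct (class_exists f) as [c' Hc'].
  rewrite (fn_fun _ _ _ _ _ Hcs Hc (H k f c' Hkf Hc')). eauto.
Qed.

(** At each i the structure and the slice are unique, so the existential inside [large] can be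
    replaced by satisfaction in the actual M_i. Łoś's theorem is then compared with Tarski's clauses
    index by index. *)
Lemma local_sat p i M as_ : i ∈ I -> member E F i M -> is_slice E as_ x fs i ->
  ((exists M as_, member E F i M /\ is_slice E as_ x fs i /\ sat E L M p as_) <->
   sat E L M p as_).
Proof.
  intros Hi HM Has. split; [|eauto]. intros (M' & as' & HM' & Has' & H).
  now rewrite (member_unique i M M' HM HM'), (slice_unique i as_ as' Hi Has Has').
Qed.

Definition local_value (i t a : V) : Prop :=
  exists M as_ e, member E F i M /\ is_slice E as_ x fs i /\
    is_evaluation E L M x as_ e /\ pair_in E t a e.

#[local] Instance D3_local_value : D3 E local_value.
Proof. unfold local_value, member. dfn. Qed.

(** The function i ↦ value of t in M_i at the slice of fs; its class will be the value of t in the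
    ultraproduct. *)
Definition value_function (t h : V) : Prop :=
  is_function E h I /\ forall i a, pair_in E i a h <-> i ∈ I /\ local_value i t a.

#[local] Instance D2_value_function : D2 E value_function.
Proof. unfold value_function. dfn. Qed.

Hypothesis Hx : is_context E x.

Lemma local_evaluation i : i ∈ I -> exists M as_ e, member E F i M /\
  wf_structure E L M /\ is_slice E as_ x fs i /\ maps E as_ x (univ M) /\
  is_evaluation E L M x as_ e /\ forall t a, local_value i t a <-> pair_in E t a e.
Proof.
  intros Hi. destruct (member_exists i Hi) as (M & HM & Hwf).
  destruct (slice_exists i M Hi HM) as (as_ & Has & Hm & _).
  destruct (evaluation_exists L M HL Hwf x as_ Hx Hm) as [e He].
  exists M, as_, e. repeat (split; auto).
  - intros (M' & as' & e' & HM' & Has' & He' & H).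
    rewrite <- (member_unique i M M' HM HM') in He'.
    rewrite <- (slice_unique i as_ as' Hi Has Has') in He'.
    now rewrite (evaluation_unique L M HL Hwf x as_ e e' Hx Hm He He').
  - intros H. exists M, as_, e. auto.
Qed.

Lemma value_function_exists t : is_term E L x t ->
  exists h, value_function t h /\ in_product E I F h.
Proof.
  intros Ht. destruct (function_exists (fun i a => local_value i t a)) with (d := I)
    as (h & Hh & K).
  - dfn.
  - intros i Hi. destruct (local_evaluation i Hi) as (M & as_ & e & _ & _ & _ & _ & He & Hv).
    destruct (evaluation_total L M x as_ e t He Ht) as (a & Ha & _).
    exists a. split; [now apply Hv|]. intros b Hb. apply Hv in Hb.
    exact (evaluation_fun L M x as_ e t a b He Ha Hb).
  - exists h. split; [split; auto|split; auto]. intros i M a HM Ha. apply K in Ha.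
    destruct Ha as [Hi Ha].
    destruct (local_evaluation i Hi) as (M' & as_ & e & HM' & _ & _ & _ & He & Hv).
    rewrite (member_unique i M M' HM HM'). apply Hv in Ha.
    apply (evaluation_term L M' x as_ e t a He Ha).
Qed.

Lemma value_function_unique t h h' : value_function t h -> value_function t h' -> h = h'.
Proof.
  intros [Hh H] [Hh' H']. apply (fn_ext _ I); auto. intros i a _ Ha. apply H', H, Ha.
Qed.

Lemma value_function_product t h : is_term E L x t -> value_function t h ->
  in_product E I F h.
Proof.
  intros Ht Hh. destruct (value_function_exists t Ht) as (h' & Hh' & Hp).
  now rewrite (value_function_unique t h h' Hh Hh').
Qed.

(** For a symbol applied to ts, the arguments in the product are the value functions hs of the
    entries. The last clause turns [is_slice], the language of ultraproducts, into [is_comp], the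
    language of Tarski's clauses. *)
Lemma value_tuple_exists n ts : is_terms E L x n ts -> exists hs,
  is_product_tuple E I F n hs /\
  (forall k t h, pair_in E k t ts -> value_function t h -> pair_in E k h hs) /\
  (forall i M as_ e, i ∈ I -> member E F i M -> is_slice E as_ x fs i ->
     is_evaluation E L M x as_ e ->
     forall vs, is_slice E vs n hs i <-> is_comp E vs e ts n).
Proof.
  intros [Hts Ht].
  destruct (function_exists (fun k h => exists t, pair_in E k t ts /\ value_function t h))
    with (d := n) as (hs & Hhs & K).
  - dfn.
  - intros k Hk. destruct (fn_total _ _ _ Hts Hk) as [t Hkt].
    destruct (value_function_exists t (Ht k t Hkt)) as (h & Hh & _).
    exists h. split; [eauto|]. intros h' (t' & Ht' & Hh').
    rewrite (fn_fun _ _ _ _ _ Hts Ht' Hkt) in Hh'.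
    exact (value_function_unique t h h' Hh Hh').
  - exists hs. split; [split|split]; auto.
    + intros k h Hh. apply K in Hh. destruct Hh as (_ & t & Hkt & Hh).
      exact (value_function_product t h (Ht k t Hkt) Hh).
    + intros k t h Hkt Hh. apply K. split; [exact (fn_dom _ _ _ _ Hts Hkt)|eauto].
    + intros i M as_ e Hi HM Has He vs.
      split; intros [Hvs H]; split; auto.
      * intros k t a Hk Ha. destruct (value_function_exists t (Ht k t Hk)) as (h & Hh & _).
        apply (H k h a).
        -- apply K. split; [exact (fn_dom _ _ _ _ Hts Hk)|eauto].
        -- apply Hh. split; auto. exists M, as_, e. auto.
      * intros k h a Hk Ha. apply K in Hk. destruct Hk as (_ & t & Hkt & Hh).
        apply (H k t a Hkt). apply Hh in Ha. destruct Ha as (_ & M' & as' & e' & HM' & Has' & He' & Ha).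
        rewrite <- (member_unique i M M' HM HM') in He'.
        rewrite <- (slice_unique i as_ as' Hi Has Has') in He'.
        destruct (slice_exists i M Hi HM) as (as'' & Has'' & Hm & _).
        rewrite <- (slice_unique i as_ as'' Hi Has Has'') in Hm.
        now rewrite (evaluation_unique L M HL (member_wf i M HM) x as_ e e' Hx Hm He He').
Qed.

End Tuples.

(** This lemma and the next two say that updating at v_n is compatible with products, with passing
    to classes and with taking slices; the quantifier step of Łoś's theorem rests on them. *)
Lemma product_tuple_update x y n fs fs' h : is_product_tuple E I F x fs ->
  in_product E I F h -> is_adjoin E y x n -> is_update E fs' y fs n h ->
  is_product_tuple E I F y fs'.
Proof.
  intros [Hf Hp] Hh Hy Hu. split; [apply Hu|]. intros k f Hk.
  destruct (update_inv _ _ _ _ _ _ _ _ Hf Hy Hu Hk) as [[_ ->]|[_ H]]; eauto.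
Qed.

Lemma class_tuple_update x y n fs fs' h cs cs' c : is_product_tuple E I F x fs ->
  is_adjoin E y x n -> is_update E fs' y fs n h -> is_class_tuple E I F U x cs fs ->
  is_class E I F U c h -> is_update E cs' y cs n c ->
  is_class_tuple E I F U y cs' fs'.
Proof.
  intros [Hf Hp] Hy Hu [Hcs H] Hc Hu'. split; [apply Hu'|]. intros k f d Hk Hd.
  destruct Hu' as (_ & Hn & Hu').
  destruct (update_inv _ _ _ _ _ _ _ _ Hf Hy Hu Hk) as [[-> ->]|[Hkn K]].
  - now rewrite (class_unique d c h Hd Hc).
  - eauto.
Qed.

Lemma slice_update x y n fs fs' h i as_ as' b : is_product_tuple E I F x fs -> i ∈ I ->
  is_adjoin E y x n -> is_update E fs' y fs n h -> pair_in E i b h ->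
  is_slice E as_ x fs i -> is_slice E as' y fs' i -> is_update E as' y as_ n b.
Proof.
  intros [Hf Hp] Hi Hy (_ & Hn & Hu) Hb [Has H] [Has' H']. split; [|split]; eauto.
  intros k a Hk Ha. destruct (fn_total _ _ _ Hf (fn_dom _ _ _ _ Has Ha)) as [f Hkf].
  destruct (in_product_total f i (Hp k f Hkf) Hi) as [a' Ha'].
  rewrite (fn_fun _ _ _ _ _ Has Ha (H k f a' Hkf Ha')). eauto.
Qed.

(** * Łoś's theorem for an ultraproduct *)

Section Ultraproduct.
Context (N : @structure V).
Hypothesis HN : is_ultraproduct E L I F U N.

Lemma class_tuple_maps x fs cs : is_product_tuple E I F x fs ->
  is_class_tuple E I F U x cs fs -> maps E cs x (univ N).
Proof.
  intros Hfs Hcs. split; [apply Hcs|]. intros k c Hc.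
  destruct (class_tuple_inv x fs Hfs cs k c Hcs Hc) as (f & Hf & Hcf).
  apply HN. exists f. split; auto. exact (proj2 Hfs k f Hf).
Qed.

Hypothesis Hne : exists f, in_product E I F f.

Lemma ultraproduct_wf : wf_structure E L N.
Proof.
  destruct HN as (Hu & Hr & HR & Hf & HG). split; [|split; [|split; [|split]]]; auto.
  - destruct Hne as [f Hfp]. destruct (class_exists f) as [c Hc]. exists c. apply Hu. eauto.
  - intros r n X H1 H2. apply (HR r n X H1 H2).
  - intros g n G H1 H2. apply (HG g n G H1 H2).
Qed.

(** The case of Łoś's theorem for terms: for a variable v_k the value function is f_k itself, and
    for an application the operations of N act on representatives by definition. *)
Lemma ultraproduct_value x fs cs e : is_context E x -> is_product_tuple E I F x fs ->
  is_class_tuple E I F U x cs fs -> is_evaluation E L N x cs e ->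
  forall t, is_term E L x t -> forall h c, value_function x fs t h ->
  is_class E I F U c h -> pair_in E t c e.
Proof.
  intros Hx Hfs Hcs He.
  apply (term_induction L HL (fun t => forall h c, value_function x fs t h ->
    is_class E I F U c h -> pair_in E t c e)).
  - assert (D := D2_value_function x fs). dfn.
  - auto.
  - intros k t Hk Ht h c Hh Hc. destruct He as (_ & Hv & _).
    apply (Hv k t c Ht). destruct (fn_total _ _ _ (proj1 Hfs) Hk) as [f Hf].
    (* At every index the value of v_k is the k-th entry of the slice, so h and f_k are the same
       function. *)
    apply (proj2 Hcs k f c Hf). replace f with h; auto.
    assert (Hfp := proj2 Hfs k f Hf).
    apply (fn_ext _ I); [apply Hh|apply Hfp|]. intros i a Hi Ha. apply Hh in Ha.
    destruct Ha as [_ Ha].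
    destruct (local_evaluation x fs Hfs Hx i Hi) as (M & as_ & ei & HM & Hwf & Has & _ & Hei & Hval).
    apply Hval in Ha. destruct (in_product_total f i Hfp Hi) as [b Hb].
    assert (Hbk := proj2 Has k f b Hf Hb).
    rewrite (evaluation_fun L M x as_ ei t a b Hei Ha); auto.
    now apply (proj1 (proj2 Hei) k).
  - intros g n ts t Hg Hts IH Ht h c Hh Hc.
    assert (Htt := term_app L x g n ts t Hg Hts Ht).
    destruct (value_tuple_exists x fs Hfs Hx n ts Hts) as (hs & Hhs & Hval & Hsl).
    destruct (class_tuple_exists n hs Hhs) as [ds Hds].
    destruct (funI_total L N ultraproduct_wf g n Hg) as (G & HG & _).
    destruct HN as (_ & _ & _ & _ & HGN).
    destruct (HGN g n G Hg HG) as [_ HGv].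
    apply (proj2 (proj2 He) g n ts t G ds c); auto.
    + split; [apply Hds|]. intros k u a Hk Ha.
      destruct (value_function_exists x fs Hfs Hx u (proj2 Hts k u Hk)) as (hu & Hhu & _).
      destruct (class_exists hu) as [d Hd].
      rewrite (evaluation_fun L N x cs e u a d He Ha (IH k u Hk hu d Hhu Hd)).
      apply (proj2 Hds k hu); eauto.
    + apply (HGv hs ds h c); auto.
      * exact (value_function_product x fs Hfs Hx t h Htt Hh).
      * intros i M H vs b HM HgH Hvs Hb. apply Hh.
        assert (Hi : i ∈ I).
        { destruct HM as (m & Hm & _). exact (fn_dom _ _ _ _ (proj1 HF) Hm). }
        split; auto.
        destruct (local_evaluation x fs Hfs Hx i Hi)
          as (M' & as_ & ei & HM' & Hwf & Has & _ & Hei & Hv).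
        rewrite <- (member_unique i M M' HM HM') in *.
        apply Hv. apply (proj2 (proj2 Hei) g n ts t H vs b); auto.
        now apply (Hsl i M as_ ei).
Qed.

Hypothesis Hchoice : ultra_choice I U.

Theorem los x p : is_formula E L x p -> is_context E x -> forall fs cs,
  is_product_tuple E I F x fs -> is_class_tuple E I F U x cs fs ->
  (sat E L N p cs <-> large E I U (fun i => exists M as_,
     member E F i M /\ is_slice E as_ x fs i /\ sat E L M p as_)).
Proof.
  assert (HNwf := ultraproduct_wf).
  revert x p. apply (formula_induction L HL (fun x p => is_context E x -> forall fs cs,
    is_product_tuple E I F x fs -> is_class_tuple E I F U x cs fs ->
    (sat E L N p cs <-> large E I U (fun i => exists M as_,
       member E F i M /\ is_slice E as_ x fs i /\ sat E L M p as_)))).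
  - unfold large, member. dfn.
  - intros x t u c Hx Ht Hu Hc _ fs cs Hfs Hcs.
    assert (Hm := class_tuple_maps x fs cs Hfs Hcs).
    destruct (evaluation_exists L N HL HNwf x cs Hx Hm) as [e He].
    destruct (value_function_exists x fs Hfs Hx t Ht) as (ht & Hht & Hpt).
    destruct (value_function_exists x fs Hfs Hx u Hu) as (hu & Hhu & Hpu).
    destruct (class_exists ht) as [ct Hct]. destruct (class_exists hu) as [cu Hcu].
    assert (Hte := ultraproduct_value x fs cs e Hx Hfs Hcs He t Ht ht ct Hht Hct).
    assert (Hue := ultraproduct_value x fs cs e Hx Hfs Hcs He u Hu hu cu Hhu Hcu).
    rewrite (sat_eqn L N HL HNwf x cs e t u c Hx Hm He Ht Hu Hc).
    transitivity (ct = cu).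
    { split.
      - intros (a & Ha & Hb). rewrite <- (evaluation_fun L N x cs e t a ct He Ha Hte).
        now rewrite <- (evaluation_fun L N x cs e u a cu He Hb Hue).
      - intros ->. eauto. }
    rewrite (class_eq ht hu ct cu Hpt Hpu Hct Hcu). apply large_ext. intros i Hi.
    destruct (local_evaluation x fs Hfs Hx i Hi) as (M & as_ & ei & HM & Hwf & Has & Hasm & Hei & Hv).
    rewrite (local_sat x fs Hfs c i M as_ Hi HM Has).
    rewrite (sat_eqn L M HL Hwf x as_ ei t u c Hx Hasm Hei Ht Hu Hc).
    split; intros (a & H1 & H2); exists a; split.
    + apply Hv. now apply Hht in H1.
    + apply Hv. now apply Hhu in H2.
    + apply Hht. split; auto. now apply Hv.
    + apply Hhu. split; auto. now apply Hv.
  - intros x r n ts c Hx Hr Hts Hc _ fs cs Hfs Hcs.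
    assert (Hm := class_tuple_maps x fs cs Hfs Hcs).
    destruct (evaluation_exists L N HL HNwf x cs Hx Hm) as [e He].
    destruct (value_tuple_exists x fs Hfs Hx n ts Hts) as (hs & Hhs & Hval & Hsl).
    destruct (class_tuple_exists n hs Hhs) as [ds Hds].
    destruct (relI_total L N HNwf r n Hr) as [X HX].
    rewrite (sat_rel L N HL HNwf x cs e r n ts c Hx Hm He Hr Hts Hc).
    assert (Hcomp : is_comp E ds e ts n).
    { split; [apply Hds|]. intros k u a Hk Ha.
      destruct (value_function_exists x fs Hfs Hx u (proj2 Hts k u Hk)) as (hu & Hhu & _).
      destruct (class_exists hu) as [d Hd].
      rewrite (evaluation_fun L N x cs e u a d He Ha
        (ultraproduct_value x fs cs e Hx Hfs Hcs He u (proj2 Hts k u Hk) hu d Hhu Hd)).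
      apply (proj2 Hds k hu); eauto. }
    transitivity (ds ∈ X).
    { split; [|eauto]. intros (as_ & X' & Has & HX' & H).
      rewrite (relI_unique L N HNwf r X X' HX HX').
      now rewrite (evaluation_comp_unique L N x cs e ts n ds as_ He Hts Hcomp Has). }
    destruct HN as (_ & _ & HR & _). destruct (HR r n X Hr HX) as [_ HRv].
    rewrite (HRv hs ds Hhs Hds). apply large_ext. intros i Hi.
    destruct (local_evaluation x fs Hfs Hx i Hi) as (M & as_ & ei & HM & Hwf & Has & Hasm & Hei & Hv).
    rewrite (local_sat x fs Hfs c i M as_ Hi HM Has).
    rewrite (sat_rel L M HL Hwf x as_ ei r n ts c Hx Hasm Hei Hr Hts Hc).
    split.
    + intros (M' & Y & vs & HM' & HY & Hvs & H).
      rewrite <- (member_unique i M M' HM HM') in *. exists vs, Y. split; auto.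
      now apply (Hsl i M as_ ei).
    + intros (vs & Y & Hvs & HY & H). exists M, Y, vs.
      split; [auto|split; [auto|split; [now apply (Hsl i M as_ ei)|auto]]].
  - intros x p c Hx Hp IH Hc _ fs cs Hfs Hcs.
    assert (Hm := class_tuple_maps x fs cs Hfs Hcs).
    rewrite (sat_neg L N HL HNwf x cs p c Hx Hm Hp Hc), (IH Hx fs cs Hfs Hcs).
    (* Here the maximality of U enters: a definable set of indices or its complement belongs to
       U. *)
    rewrite <- large_not; auto; [|unfold member; dfn].
    apply large_ext. intros i Hi.
    destruct (local_evaluation x fs Hfs Hx i Hi) as (M & as_ & ei & HM & Hwf & Has & Hasm & _).
    rewrite !(local_sat x fs Hfs _ i M as_ Hi HM Has).
    now rewrite (sat_neg L M HL Hwf x as_ p c Hx Hasm Hp Hc).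
  - intros x p q c Hx Hp Hq IHp IHq Hc _ fs cs Hfs Hcs.
    assert (Hm := class_tuple_maps x fs cs Hfs Hcs).
    rewrite (sat_and L N HL HNwf x cs p q c Hx Hm Hp Hq Hc).
    rewrite (IHp Hx fs cs Hfs Hcs), (IHq Hx fs cs Hfs Hcs).
    assert (Hloc : forall i, i ∈ I ->
      ((exists M as_, member E F i M /\ is_slice E as_ x fs i /\ sat E L M c as_) <->
       (exists M as_, member E F i M /\ is_slice E as_ x fs i /\ sat E L M p as_) /\
       (exists M as_, member E F i M /\ is_slice E as_ x fs i /\ sat E L M q as_))).
    { intros i Hi.
      destruct (local_evaluation x fs Hfs Hx i Hi) as (M & as_ & ei & HM & Hwf & Has & Hasm & _).
      rewrite !(local_sat x fs Hfs _ i M as_ Hi HM Has).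
      now rewrite (sat_and L M HL Hwf x as_ p q c Hx Hasm Hp Hq Hc). }
    rewrite (large_ext _ _ _ _ Hloc). split.
    + intros [H1 H2]. now apply large_and.
    + intros H. split; revert H; apply large_mono; auto; try tauto; unfold member; dfn.
  - intros x n y p c Hx Hn Hy Hp IH Hc _ fs cs Hfs Hcs.
    assert (Hyc := context_adjoin y x n Hx Hn Hy).
    assert (Hm := class_tuple_maps x fs cs Hfs Hcs).
    destruct product_set as [P HP].
    assert (Hup : forall h, in_product E I F h -> exists fs', is_update E fs' y fs n h /\
      is_product_tuple E I F y fs').
    { intros h Hh. destruct (update_exists fs x n h P) as (fs' & Hu & Hm').
      - split; [apply Hfs|]. intros k f Hk. apply HP. exact (proj2 Hfs k f Hk).
      - now apply HP.
      - apply is_adjoinE in Hy. subst y. exists fs'. split; auto.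
        split; [apply Hm'|]. intros k f Hk. apply HP. exact (proj2 Hm' k f Hk). }
    rewrite (sat_ex L N HL HNwf x cs n y p c Hx Hm Hn Hy Hp Hc). split.
    + intros (a & cs' & Ha & Hcs' & Hsat). apply HN in Ha. destruct Ha as (h & Hh & Hah).
      destruct (Hup h Hh) as (fs' & Hfs' & Hpt).
      rewrite (IH Hyc fs' cs' Hpt) in Hsat;
        [|exact (class_tuple_update x y n fs fs' h cs cs' a Hfs Hy Hfs' Hcs Hah Hcs')].
      revert Hsat. apply large_mono; auto; [unfold member; dfn|]. intros i Hi Hsat.
      destruct (local_evaluation x fs Hfs Hx i Hi) as (M & as_ & ei & HM & Hwf & Has & Hasm & _).
      destruct (slice_exists y fs' Hpt i M Hi HM) as (as' & Has' & _).
      rewrite (local_sat y fs' Hpt p i M as' Hi HM Has') in Hsat.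
      rewrite (local_sat x fs Hfs c i M as_ Hi HM Has).
      apply (sat_ex L M HL Hwf x as_ n y p c Hx Hasm Hn Hy Hp Hc).
      destruct (in_product_total h i Hh Hi) as [b Hb]. exists b, as'.
      split; [exact (proj2 Hh i M b HM Hb)|split; auto].
      exact (slice_update x y n fs fs' h i as_ as' b Hfs Hi Hy Hfs' Hb Has Has').
    + intros Hlarge.
      (* W i is the set of witnesses for the quantifier in M_i. It is nonempty for almost all i, but
         selecting a witness for each i is where choice is needed. *)
      pose (W := fun i z => exists M as_ s', member E F i M /\ is_slice E as_ x fs i /\
        z ∈ univ M /\ is_update E s' y as_ n z /\ sat E L M p s').
      destruct (function_exists (fun i b => forall z, z ∈ b <-> W i z)) with (d := I)
        as (B & HB & KB).
      { unfold W, member. dfn. }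
      { intros i Hi. destruct (member_exists i Hi) as (M & HM & _).
        destruct (separation E (W i)) with (a := univ M) as [b Hb].
        { unfold W, member. dfn. }
        exists b. split.
        - intros z. rewrite Hb. split; [tauto|]. intros Hz. split; auto.
          destruct Hz as (M' & as_ & s' & HM' & _ & Hz & _).
          now rewrite (member_unique i M M' HM HM').
        - intros b' Hb'. apply ext. intros z. rewrite Hb, Hb'. split; [tauto|].
          intros Hz. split; auto. destruct Hz as (M' & as_ & s' & HM' & _ & Hz & _).
          now rewrite (member_unique i M M' HM HM'). }
      destruct (Hchoice B HB) as (g & Hg & Hglarge).
      { revert Hlarge. apply large_mono; auto; [dfn|]. intros i Hi Hsat.
        destruct (local_evaluation x fs Hfs Hx i Hi) as (M & as_ & ei & HM & Hwf & Has & Hasm & _).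
        rewrite (local_sat x fs Hfs c i M as_ Hi HM Has) in Hsat.
        apply (sat_ex L M HL Hwf x as_ n y p c Hx Hasm Hn Hy Hp Hc) in Hsat.
        destruct Hsat as (a & s' & Ha & Hs' & Hsat).
        destruct (fn_total _ _ _ HB Hi) as [b Hb]. exists b, a. split; auto.
        apply KB in Hb. apply Hb. exists M, as_, s'. auto. }
      (* The function g may take values outside M_i at the remaining indices. Falling back on f0
         wherever g is not a witness gives an element h of the product. *)
      destruct Hne as [f0 Hf0].
      destruct (function_exists (fun i z => (W i z /\ pair_in E i z g) \/
        (~ (exists z', W i z' /\ pair_in E i z' g) /\ pair_in E i z f0))) with (d := I)
        as (h & Hh & Kh).
      { unfold W, member. dfn. }
      { intros i Hi. destruct (classic (exists z', W i z' /\ pair_in E i z' g))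
          as [(z & Hz & Hzg)|Hno].
        - exists z. split; [auto|]. intros z' [[_ Hz']|[Hno _]].
          + exact (fn_fun _ _ _ _ _ Hg Hzg Hz').
          + exfalso. eauto.
        - destruct (in_product_total f0 i Hf0 Hi) as [z Hz]. exists z. split; [auto|].
          intros z' [[H1 H2]|[_ Hz']]; [exfalso; eauto|].
          exact (fn_fun _ _ _ _ _ (proj1 Hf0) Hz Hz'). }
      assert (Hhp : in_product E I F h).
      { split; auto. intros i M z HM Hz. apply Kh in Hz.
        destruct Hz as (_ & [[(M' & as_ & s' & HM' & _ & Hz & _) _]|[_ Hz]]).
        - now rewrite (member_unique i M M' HM HM').
        - exact (proj2 Hf0 i M z HM Hz). }
      destruct (Hup h Hhp) as (fs' & Hfs' & Hpt). destruct (class_exists h) as [d Hd].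
      assert (HdN : d ∈ univ N) by (apply HN; eauto).
      destruct (update_exists cs x n d (univ N) Hm HdN) as (cs' & Hcs' & _).
      apply is_adjoinE in Hy. rewrite <- Hy in Hcs'. apply is_adjoinE in Hy.
      exists d, cs'. split; [auto|split; [auto|]].
      apply (IH Hyc fs' cs' Hpt).
      { exact (class_tuple_update x y n fs fs' h cs cs' d Hfs Hy Hfs' Hcs Hd Hcs'). }
      revert Hglarge. apply large_mono; auto; [unfold member; dfn|].
      intros i Hi (b & z & Hb & Hzg & Hzb).
      apply KB in Hb. apply (proj2 Hb) in Hzb.
      assert (Hzh : pair_in E i z h) by (apply Kh; auto).
      destruct Hzb as (M & as_ & s' & HM & Has & HzM & Hs' & Hsat).
      destruct (slice_exists y fs' Hpt i M Hi HM) as (as' & Has' & _).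
      rewrite (local_sat y fs' Hpt p i M as' Hi HM Has').
      replace as' with s'; auto.
      apply (update_unique s' as' as_ x y n z); auto; [apply Has|].
      exact (slice_update x y n fs fs' h i as_ as' z Hfs Hi Hy Hfs' Hzh Has Has').
Qed.

End Ultraproduct.
End Los.

(** * From Łoś's theorem to ultrafilter choice *)

Lemma constant_function d v : exists f, is_function E f d /\
  forall x y, pair_in E x y f <-> x ∈ d /\ y = v.
Proof.
  apply (function_exists (fun _ y => y = v)); [dfn|].
  intros x _. exists v. split; auto.
Qed.

Lemma empty_function : is_function E empty empty.
Proof. split; intros p Hp; now apply emptyE in Hp. Qed.

Lemma pair_in_empty x y : ~ pair_in E x y empty.
Proof. rewrite pair_inE. apply emptyE. Qed.

Lemma in_num1 k : k ∈ num 1 <-> k = num 0.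
Proof.
  simpl. rewrite succE. split; [|auto]. intros [H|H]; auto. now apply emptyE in H.
Qed.

Lemma in_num2 k : k ∈ num 2 <-> k = num 0 \/ k = num 1.
Proof. change (num 2) with (succ (num 1)). rewrite succE, in_num1. tauto. Qed.

Lemma num_neq j k : j <> k -> num j <> num k.
Proof. intros H K. now apply H, num_inj. Qed.

Lemma is_adjoin_num k : is_adjoin E (num (S k)) (num k) (num k).
Proof. now apply is_adjoinE. Qed.

Definition binary_language (L : @language V) : Prop :=
  wf_language E L /\
  (forall r n, pair_in E r n (rels L) <-> r = empty /\ n = num 2) /\
  (forall g n, ~ pair_in E g n (funs L)).

Definition binary_structure (L : language) (A R : V) (M : structure) : Prop :=
  wf_structure E L M /\ univ M = A /\
  forall r X, pair_in E r X (relI M) <-> r = empty /\ X = R.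

Lemma binary_language_exists : exists L, binary_language L.
Proof.
  destruct (constant_function (num 1) (num 2)) as (f & Hf & K).
  assert (HR : forall r n, pair_in E r n f <-> r = empty /\ n = num 2).
  { intros r n. rewrite K, in_num1. reflexivity. }
  exists (Language f empty). split; [split; [|split; [|split]]|split]; simpl; auto.
  - eauto.
  - exists empty. apply empty_function.
  - intros r n H. apply HR in H. destruct H as [_ ->]. split; [apply (nat_num 2)|].
    intros H. apply is_emptyE in H. exact (num_neq 2 0 (Nat.neq_succ_0 1) H).
  - intros g n H. now apply pair_in_empty in H.
  - intros g n. apply pair_in_empty.
Qed.

Lemma binary_structure_exists L A R : binary_language L -> (exists a, a ∈ A) ->
  (forall s, s ∈ R -> maps E s (num 2) A) -> exists M, binary_structure L A R M.
Proof.
  intros (HL & HR & HF) HA HRA. destruct (constant_function (num 1) R) as (f & Hf & K).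
  destruct HL as ((dr & Hdr) & (df & Hdf) & HL).
  assert (Edr : dr = num 1).
  { apply ext. intros r. rewrite in_num1. split.
    - intros H. destruct (fn_total _ _ _ Hdr H) as [n Hn]. now apply HR in Hn.
    - intros ->. apply (fn_dom _ _ _ (num 2) Hdr). now apply HR. }
  assert (Edf : df = empty).
  { apply ext. intros g. split; intros H; [|now apply emptyE in H].
    destruct (fn_total _ _ _ Hdf H) as [n Hn]. now apply HF in Hn. }
  subst dr df.
  exists (Structure A f empty). split; [|split]; simpl; auto.
  - split; [|split; [|split; [|split]]]; simpl; auto.
    + eauto.
    + intros r n X Hn HX. apply K in HX. destruct HX as [_ ->].
      apply HR in Hn. destruct Hn as [_ ->]. auto.
    + exists empty. split; auto. apply empty_function.
    + intros g n G Hg. now apply HF in Hg.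
  - intros r X. rewrite K, in_num1. reflexivity.
Qed.

Section Formulas.
Context (L : @language V).
Hypothesis HL : binary_language L.

(** σ is ∃v_1 R(v_0, v_1) and τ is ¬∃v_0 ¬σ. *)
Lemma binary_formulas : exists σ τ,
  is_formula E L (num 1) σ /\ is_formula E L (num 0) τ /\
  (forall A R M s, binary_structure L A R M -> maps E s (num 1) A ->
     (sat E L M σ s <-> exists a s', a ∈ A /\ is_update E s' (num 2) s (num 1) a /\ s' ∈ R)) /\
  (forall A R M, binary_structure L A R M ->
     (sat E L M τ (num 0) <-> forall a s, a ∈ A ->
        is_update E s (num 1) (num 0) (num 0) a -> sat E L M σ s)).
Proof.
  destruct HL as (Hwf & HR & HF).
  assert (Hc : forall k, is_context E (num k)).
  { intros k. apply context_nat, nat_num. }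
  (* The argument tuple (v_0, v_1), with v_k coded as ⟨0, k⟩. *)
  destruct (function_exists (fun k t => t = op (num 0) k)) with (d := num 2)
    as (ts & Hts & Kts).
  { dfn. }
  { intros k _. exists (op (num 0) k). split; auto. }
  assert (Hterms : is_terms E L (num 2) (num 2) ts).
  { split; auto. intros k t Hk. apply Kts in Hk. destruct Hk as [Hk ->].
    apply (term_var L (num 2) k); auto. now apply is_varE. }
  pose (ρ := op (num 1) (op empty ts)). pose (σ := op (num 4) (op (num 1) ρ)).
  pose (ν := op (num 2) σ). pose (ε := op (num 4) (op (num 0) ν)).
  assert (Hr : pair_in E empty (num 2) (rels L)) by (now apply HR).
  assert (Hρ : is_rel E ρ empty ts) by (now apply is_relE).
  assert (Hσ : is_ex E σ (num 1) ρ) by (now apply is_exE).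
  assert (Hν : is_neg E ν σ) by (now apply is_negE).
  assert (Hε : is_ex E ε (num 0) ν) by (now apply is_exE).
  assert (Hτ : is_neg E (op (num 2) ε) ε) by (now apply is_negE).
  assert (Fρ := formula_rel L (num 2) empty (num 2) ts ρ (Hc 2) Hr Hterms Hρ).
  assert (Fσ := formula_ex L (num 1) (num 1) (num 2) ρ σ (Hc 1) (nat_num 1)
    (is_adjoin_num 1) Fρ Hσ).
  assert (Fν := formula_neg L (num 1) σ ν (Hc 1) Fσ Hν).
  assert (Fε := formula_ex L (num 0) (num 0) (num 1) ν ε (Hc 0) (nat_num 0)
    (is_adjoin_num 0) Fν Hε).
  exists σ, (op (num 2) ε). split; [auto|split; [|split]].
  - exact (formula_neg L (num 0) ε _ (Hc 0) Fε Hτ).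
  - intros A R M s (HM & HA & HRM) Hs. subst A.
    rewrite (sat_ex L M Hwf HM (num 1) s (num 1) (num 2) ρ σ (Hc 1) Hs (nat_num 1)
      (is_adjoin_num 1) Fρ Hσ).
    enough (K : forall a s', a ∈ univ M -> is_update E s' (num 2) s (num 1) a ->
      (sat E L M ρ s' <-> s' ∈ R)).
    { split; intros (a & s' & Ha & Hu & H); exists a, s'; split; auto; split; auto;
        now apply (K a s'). }
    intros a s' Ha Hu.
    assert (Hs' := update_maps _ _ _ _ _ _ _ Hs Ha (is_adjoin_num 1) Hu).
    destruct (evaluation_exists L M Hwf HM (num 2) s' (Hc 2) Hs') as [e He].
    rewrite (sat_rel L M Hwf HM (num 2) s' e empty (num 2) ts ρ (Hc 2) Hs' He Hr Hterms Hρ).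
    (* As the arguments are v_0, v_1 in order, their tuple of values is the assignment s' itself,
       and the atomic formula says s' ∈ R. *)
    assert (Hcomp : is_comp E s' e ts (num 2)).
    { split; [apply Hs'|]. intros k t b Hk Hb. apply Kts in Hk. destruct Hk as [Hk ->].
      destruct (fn_total _ _ _ (proj1 Hs') Hk) as [d Hd].
      rewrite (evaluation_fun L M (num 2) s' e (op (num 0) k) b d He Hb); auto.
      apply (proj1 (proj2 He) k); auto. now apply is_varE. }
    split.
    + intros (as_ & X & Has & HX & H). apply HRM in HX. destruct HX as [_ ->].
      now rewrite (evaluation_comp_unique L M (num 2) s' e ts (num 2) s' as_ He Hterms Hcomp Has).
    + intros H. exists s', R. split; [auto|split; auto]. now apply HRM.
  - intros A R M (HM & HA & HRM). subst A.
    assert (H0 : maps E (num 0) (num 0) (univ M)).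
    { split; [apply empty_function|]. intros x y H. now apply pair_in_empty in H. }
    rewrite (sat_neg L M Hwf HM (num 0) (num 0) ε _ (Hc 0) H0 Fε Hτ).
    rewrite (sat_ex L M Hwf HM (num 0) (num 0) (num 0) (num 1) ν ε (Hc 0) H0 (nat_num 0)
      (is_adjoin_num 0) Fν Hε).
    assert (K : forall a s, a ∈ univ M -> is_update E s (num 1) (num 0) (num 0) a ->
      (sat E L M ν s <-> ~ sat E L M σ s)).
    { intros a s Ha Hu.
      assert (Hs := update_maps _ _ _ _ _ _ _ H0 Ha (is_adjoin_num 0) Hu).
      exact (sat_neg L M Hwf HM (num 1) s σ ν (Hc 1) Hs Fσ Hν). }
    split.
    + intros H a s Ha Hs. apply NNPP. intros Hn. apply H. exists a, s.
      split; [auto|split; auto]. now apply (K a s).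
    + intros H (a & s & Ha & Hs & Hn). apply (K a s) in Hn; auto. eauto.
Qed.

End Formulas.

Lemma constant_family_is_family L I M F : wf_structure E L M ->
  is_constant_family E I M F -> is_family E L I F.
Proof. intros HM [HF H]. split; auto. intros i Hi. exists M. auto. Qed.

Lemma constant_family_exists I M : exists F, is_constant_family E I M F.
Proof.
  destruct (codes_exists M) as [m Hm]. destruct (constant_function I m) as (F & HF & K).
  exists F. split; auto. intros i Hi. exists m. split; auto. now apply K.
Qed.

Lemma constant_family_product L I M F : wf_structure E L M ->
  is_constant_family E I M F -> exists f, in_product E I F f.
Proof.
  intros HM HF. destruct (proj1 HM) as [a Ha].
  destruct (constant_function I a) as (f & Hf & K). exists f. split; auto.
  intros i M' b HM' Hb. apply K in Hb. destruct Hb as [Hi ->].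
  rewrite (member_unique L I F (constant_family_is_family L I M F HM HF) i M' M); auto.
  apply HF; auto.
Qed.

(** [LT1] and [LT2] say something about a structure M only if an ultrapower N is at hand. With a
    single relation symbol and no function symbols, it suffices to construct the set of classes and
    one relation on it. *)
Lemma binary_ultraproduct_exists L I U F : binary_language L -> is_family E L I F ->
  is_ultrafilter E I U -> (exists f, in_product E I F f) ->
  exists N A R, binary_structure L A R N /\ is_ultraproduct E L I F U N.
Proof.
  intros HLb HF HU [f0 Hf0].
  pose (Λ := fun fs i => exists M Y as_, member E F i M /\
    pair_in E empty Y (relI M) /\ is_slice E as_ (num 2) fs i /\ as_ ∈ Y).
  destruct (product_set L I F HF) as [P HP].
  destruct (separation E (fun c => exists f, in_product E I F f /\ is_class E I F U c f))
    with (a := pow P) as [A HA0].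
  { unfold is_class, in_product, large, member. dfn. }
  assert (HA : forall c, c ∈ A <-> exists f, in_product E I F f /\ is_class E I F U c f).
  { intros c. rewrite HA0. split; [tauto|]. intros H. split; auto. apply powE.
    destruct H as (f & _ & Hc). intros g Hg. apply HP. now apply Hc in Hg. }
  destruct (maps_exists (num 2) A) as [T HT].
  (* The relation is defined through some tuple of representatives; [is_ultraproduct] asks for the
     equivalence with every such tuple. *)
  destruct (separation E (fun cs => exists fs, is_product_tuple E I F (num 2) fs /\
    is_class_tuple E I F U (num 2) cs fs /\ large E I U (Λ fs))) with (a := T) as [R HR].
  { unfold Λ, is_product_tuple, is_class_tuple, is_class, in_product, large, is_slice, member.
    dfn. }
  destruct (binary_structure_exists L A R HLb) as [N HN].
  { destruct (class_exists L I F U HF f0) as [c Hc]. exists c. apply HA. eauto. }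
  { intros s Hs. apply HR in Hs. now apply HT. }
  exists N, A, R. split; auto.
  destruct HN as ((Hne & Hr & HrN & Hf & HfN) & HNA & HNR).
  destruct HLb as (HL & HLR & HLF).
  split; [now rewrite HNA|split; [auto|split; [|split; [auto|]]]].
  - intros r n X Hrn HX. apply HLR in Hrn. destruct Hrn as [-> ->].
    apply HNR in HX. destruct HX as [_ ->]. split.
    { intros cs Hcs. apply HR in Hcs. rewrite HNA. now apply HT. }
    intros fs cs Hfs Hcs. rewrite HR. split.
    + intros (_ & fs' & Hfs' & Hcs' & Hlarge).
      (* Independence of the representatives: two choices agree almost everywhere at each of the two
         positions, and the two sets of agreement are intersected. *)
      assert (Hagree : forall k, k ∈ num 2 -> large E I U (fun i =>
        forall f f', pair_in E k f fs -> pair_in E k f' fs' ->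
        forall a, pair_in E i a f <-> pair_in E i a f')).
      { intros k Hk. destruct (fn_total _ _ _ (proj1 Hcs) Hk) as [c Hc].
        destruct (class_tuple_inv L I F U HF (num 2) fs Hfs cs k c Hcs Hc) as (f & Hkf & Hcf).
        destruct (class_tuple_inv L I F U HF (num 2) fs' Hfs' cs k c Hcs' Hc)
          as (f' & Hkf' & Hcf').
        assert (Hfp := proj2 Hfs k f Hkf). assert (Hfp' := proj2 Hfs' k f' Hkf').
        assert (H := proj1 (class_eq I F U HU f f' c c Hfp Hfp' Hcf Hcf') eq_refl).
        revert H. apply large_mono; auto; [dfn|]. intros i Hi (a & Ha & Ha') g g' Hg Hg' b.
        rewrite (fn_fun _ _ _ _ _ (proj1 Hfs) Hg Hkf).
        rewrite (fn_fun _ _ _ _ _ (proj1 Hfs') Hg' Hkf').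
        split; intros Hb.
        - now rewrite (fn_fun _ _ _ _ _ (proj1 Hfp) Hb Ha).
        - now rewrite (fn_fun _ _ _ _ _ (proj1 Hfp') Hb Ha'). }
      assert (H0 := Hagree (num 0) (proj2 (in_num2 _) (or_introl eq_refl))).
      assert (H1 := Hagree (num 1) (proj2 (in_num2 _) (or_intror eq_refl))).
      generalize (large_and I U HU _ _ Hlarge (large_and I U HU _ _ H0 H1)).
      apply large_mono; auto; [unfold is_slice, member; dfn|].
      intros i Hi ((M & Y & as_ & HM & HY & Has & H) & H2 & H3).
      exists M, Y, as_. split; [auto|split; [auto|split; auto]].
      split; [apply Has|]. intros k f a Hkf Ha.
      assert (Hk := fn_dom _ _ _ _ (proj1 Hfs) Hkf).
      destruct (fn_total _ _ _ (proj1 Hfs') Hk) as [f' Hkf'].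
      apply (proj2 Has k f' a Hkf'). apply in_num2 in Hk. destruct Hk; subst k.
      * now apply (H2 f f').
      * now apply (H3 f f').
    + intros Hlarge. split; [|exists fs; auto]. apply HT. split; [apply Hcs|].
      intros k c Hc.
      destruct (class_tuple_inv L I F U HF (num 2) fs Hfs cs k c Hcs Hc) as (f & Hkf & Hcf).
      apply HA. exists f. split; auto. exact (proj2 Hfs k f Hkf).
  - intros g n G Hg. now apply HLF in Hg.
Qed.

(** The test structure has the binary relation "if B_x ≠ ∅ then y ∈ B_x".
    In it σ holds everywhere; where [id] satisfies σ in the ultrapower, a
    witness [g] chooses from almost all the B_i. *)
Lemma choice_test I U B : is_ultrafilter E I U -> is_function E B I ->
  large E I U (fun i => exists b z, pair_in E i b B /\ z ∈ b) ->
  exists L M F N σ τ fs cs, wf_language E L /\ wf_structure E L M /\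
    is_constant_family E I M F /\ is_ultraproduct E L I F U N /\
    is_formula E L (num 1) σ /\ is_formula E L (num 0) τ /\
    is_product_tuple E I F (num 1) fs /\ is_class_tuple E I F U (num 1) cs fs /\
    (forall s, maps E s (num 1) (univ M) -> sat E L M σ s) /\
    sat E L M τ (num 0) /\ (sat E L N τ (num 0) -> sat E L N σ cs) /\
    (sat E L N σ cs -> exists g, is_function E g I /\
       large E I U (fun i => exists b z, pair_in E i b B /\ pair_in E i z g /\ z ∈ b)).
Proof.
  intros HU HB Hlarge.
  (* U contains I but not the empty set; an index is needed as an element of the universe A. *)
  assert (HIne : exists i, i ∈ I).
  { apply NNPP. intros Hno. destruct HU as (_ & HI & Hne & _). apply (Hne I); auto.
    intros i Hi. apply Hno. eauto. }
  (* The universe contains the indices, as possible values of x, and the elements of all B_i, as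
     possible values of y. *)
  pose (A := cup I (bigU (bigU (bigU B)))).
  destruct (maps_exists (num 2) A) as [T HT].
  (* The element z only attests that b is nonempty; without it y is unconstrained. *)
  destruct (separation E (fun s => forall x y b z, pair_in E (num 0) x s ->
    pair_in E (num 1) y s -> pair_in E x b B -> z ∈ b -> y ∈ b)) with (a := T) as [R HR];
    [dfn|].
  destruct binary_language_exists as [L HLb]. assert (HL := proj1 HLb).
  destruct (binary_structure_exists L A R HLb) as [M HM].
  { destruct HIne as [i Hi]. exists i. apply cupE. auto. }
  { intros s Hs. apply HR in Hs. now apply HT. }
  assert (HMwf := proj1 HM). assert (HMA := proj1 (proj2 HM)).
  destruct (constant_family_exists I M) as [F HFc].
  assert (HF := constant_family_is_family L I M F HMwf HFc).
  destruct (binary_ultraproduct_exists L I U F HLb HF HU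
    (constant_family_product L I M F HMwf HFc)) as (N & AN & RN & HN & HNu).
  destruct (binary_formulas L HLb) as (σ & τ & Fσ & Fτ & Sσ & Sτ).
  destruct (function_exists (fun i a => a = i)) with (d := I) as (id & Hid & Kid).
  { dfn. }
  { intros i _. exists i. split; auto. }
  assert (Hidp : in_product E I F id).
  { split; auto. intros i M' a HM' Ha. apply Kid in Ha. destruct Ha as [Hi ->].
    rewrite (member_unique L I F HF i M' M HM' (proj2 HFc i Hi)), HMA. apply cupE. auto. }
  destruct (constant_function (num 1) id) as (fs & Hfs0 & Kfs).
  assert (Hfs : is_product_tuple E I F (num 1) fs).
  { split; auto. intros k f Hk. apply Kfs in Hk. now destruct Hk as [_ ->]. }
  destruct (class_tuple_exists L I F U HF (num 1) fs Hfs) as [cs Hcs].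
  assert (Hm := class_tuple_maps L I F U HF N HNu (num 1) fs cs Hfs Hcs).
  assert (HMσ : forall s, maps E s (num 1) A -> sat E L M σ s).
  { intros s Hs. apply (Sσ A R M s HM Hs).
    destruct (fn_total _ _ (num 0) (proj1 Hs)) as [x Hx]; [now apply in_num1|].
    assert (Hy : exists y, y ∈ A /\ forall b z, pair_in E x b B -> z ∈ b -> y ∈ b).
    { destruct (classic (exists b z, pair_in E x b B /\ z ∈ b)) as [(b & z & Hb & Hz)|Hno].
      - exists z. split.
        + apply cupE. right. apply bigUE. exists b. split; auto.
          now apply pair_inE, op_in_UU in Hb.
        + intros b' _ Hb' _. now rewrite (fn_fun _ _ _ _ _ HB Hb' Hb).
      - exists x. split; [exact (proj2 Hs _ _ Hx)|]. intros b z Hb Hz. exfalso. eauto. }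
    destruct Hy as (y & HyA & Hy).
    destruct (update_exists s (num 1) (num 1) y A Hs HyA) as (s' & Hu & Hs').
    exists y, s'. split; [auto|split; [exact Hu|]]. apply HR. split; [now apply HT|].
    intros x' y' b z Hx' Hy' Hb Hz.
    destruct (update_inv _ _ _ _ _ _ _ _ (proj1 Hs) (is_adjoin_num 1) Hu Hx')
      as [[H _]|[_ Hx'']]; [now apply num_inj in H|].
    destruct (update_inv _ _ _ _ _ _ _ _ (proj1 Hs) (is_adjoin_num 1) Hu Hy')
      as [[_ ->]|[H _]]; [|tauto].
    rewrite (fn_fun _ _ _ _ _ (proj1 Hs) Hx'' Hx) in Hb. eauto. }
  assert (H0 : forall a, maps E (num 0) (num 0) a).
  { intros a. split; [apply empty_function|]. intros x y H. now apply pair_in_empty in H. }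
  exists L, M, F, N, σ, τ, fs, cs.
  split; [auto|split; [auto|split; [auto|split; [auto|split; [auto|split; [auto|]]]]]].
  split; [auto|split; [auto|split; [now rewrite HMA|split; [|split]]]].
  - apply (Sτ A R M HM). intros a s Ha Hs. apply HMσ.
    exact (update_maps _ _ _ _ _ _ _ (H0 A) Ha (is_adjoin_num 0) Hs).
  (* The universal sentence τ is instantiated at [id], the only entry of cs. *)
  - intros Hτ. destruct (class_exists L I F U HF id) as [c Hc].
    apply (proj1 (Sτ AN RN N HN) Hτ c).
    + rewrite <- (proj1 (proj2 HN)). apply HNu. eauto.
    + split; [apply Hcs|split].
      * apply (proj2 Hcs (num 0) id c); auto. apply Kfs. split; auto. now apply in_num1.
      * intros k b _ H. now apply pair_in_empty in H.
  - intros Hσ. rewrite (proj1 (proj2 HN)) in Hm. apply (Sσ AN RN N cs HN Hm) in Hσ.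
    destruct Hσ as (c & cs' & Hc & Hu & Hcs').
    rewrite <- (proj1 (proj2 HN)) in Hc. apply HNu in Hc. destruct Hc as (g & Hg & Hcg).
    exists g. split; [apply Hg|].
    destruct (product_set L I F HF) as [P HP].
    destruct (update_exists fs (num 1) (num 1) g P) as (fs' & Hufs & _).
    { split; auto. intros k f Hk. apply HP. exact (proj2 Hfs k f Hk). }
    { now apply HP. }
    assert (Hfs' := product_tuple_update I F (num 1) (num 2) (num 1) fs fs' g Hfs Hg
      (is_adjoin_num 1) Hufs).
    assert (Hct := class_tuple_update I F U (num 1) (num 2) (num 1) fs fs' g cs cs' c
      Hfs (is_adjoin_num 1) Hufs Hcs Hcg Hu).
    destruct HNu as (_ & _ & HRN & _).
    destruct (HRN empty (num 2) RN) as [_ HRv].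
    { now apply (proj1 (proj2 HLb)). }
    { now apply (proj2 (proj2 HN)). }
    apply (HRv fs' cs' Hfs' Hct) in Hcs'.
    (* R(i, g(i)) alone could hold because B_i is empty; intersecting with the large set of nonempty
       B_i leaves g(i) ∈ B_i. *)
    generalize (large_and I U HU _ _ Hlarge Hcs'). apply large_mono; auto; [dfn|].
    intros i Hi ((b & z & Hb & Hz) & M' & Y & as_ & HM' & HY & Has & H).
    rewrite (member_unique L I F HF i M' M HM' (proj2 HFc i Hi)) in HY.
    apply (proj2 (proj2 HM)) in HY. destruct HY as [_ ->]. apply HR in H.
    destruct H as [_ H]. destruct (fn_total _ _ _ (proj1 Hg) Hi) as [y Hy].
    exists b, y. split; [auto|split; [auto|]]. apply (H i y b z); auto.
    + apply (proj2 Has (num 0) id).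
      * apply (proj2 (proj2 Hufs)); [now apply num_neq|]. apply Kfs. split; auto.
        now apply in_num1.
      * now apply Kid.
    + apply (proj2 Has (num 1) g); auto. apply (proj1 (proj2 Hufs)).
Qed.

(** * The implications between the three statements and ultrafilter choice *)

Lemma LT1_ultra_choice I U : LT1 E -> is_ultrafilter E I U -> ultra_choice I U.
Proof.
  intros H HU B HB Hlarge.
  destruct (choice_test I U B HU HB Hlarge)
    as (L & M & F & N & σ & τ & fs & cs & HL & HM & HF & HN & Fσ & Fτ & Hfs & Hcs &
        _ & Hτ & Hστ & Hg).
  apply Hg, Hστ. apply (H L M I U HL HM HU F N HF HN (num 0) τ); auto.
  now apply is_emptyE.
Qed.

Lemma LT2_ultra_choice I U : LT2 E -> is_ultrafilter E I U -> ultra_choice I U.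
Proof.
  intros H HU B HB Hlarge.
  destruct (choice_test I U B HU HB Hlarge)
    as (L & M & F & N & σ & τ & fs & cs & HL & HM & HF & HN & Fσ & Fτ & Hfs & Hcs &
        Hσ & _ & _ & Hg).
  apply Hg. apply (H L M I U HL HM HU F N HF HN (num 0) (num 1) σ fs cs); auto.
  - apply (nat_num 0).
  - now apply is_succE.
  - apply large_all; auto. intros i Hi.
    destruct (slice_exists I F (num 1) fs Hfs i M Hi (proj2 HF i Hi)) as (as_ & Has & Hm & _).
    eauto.
Qed.

Lemma ultra_choice_LT3 : (forall I U, is_ultrafilter E I U -> ultra_choice I U) ->
  LT3 E.
Proof.
  intros H L I F U HL HF HU Hne N HN n m p fs cs Hn Hm Hp Hfs Hcs.
  apply (los L I F U HL HF HU N HN Hne (H I U HU) m p Hp); auto.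
  apply is_succE in Hm. subst m. now apply context_nat, nat_succ.
Qed.

(** A constant family is a family, and its product is nonempty without choice: it contains the
    constant functions, since the universe of M is nonempty. *)
Lemma LT3_LT2 : LT3 E -> LT2 E.
Proof.
  intros H L M I U HL HM HU F N HFc HN n m p fs cs Hn Hm Hp Hfs Hcs.
  assert (HF := constant_family_is_family L I M F HM HFc).
  rewrite (H L I F U HL HF HU (constant_family_product L I M F HM HFc) N HN n m p fs cs);
    auto.
  apply large_ext. intros i Hi. split.
  - intros (M' & as_ & HM' & Has & Hsat).
    rewrite (member_unique L I F HF i M' M HM' (proj2 HFc i Hi)) in Hsat. eauto.
  - intros (as_ & Has & Hsat). exists M, as_. split; [apply HFc|]; auto.
Qed.

(** [LT2] speaks of contexts n + 1, whereas a sentence lives in the empty context. Applying [los] in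
    the empty context avoids any weakening of formulas. The condition at i then no longer depends on
    i, so it holds for almost all i iff it holds in M. *)
Lemma ultra_choice_LT1 : (forall I U, is_ultrafilter E I U -> ultra_choice I U) ->
  LT1 E.
Proof.
  intros H L M I U HL HM HU F N HFc HN z p Hz Hp.
  apply is_emptyE in Hz. subst z.
  assert (HF := constant_family_is_family L I M F HM HFc).
  assert (Hfs : is_product_tuple E I F empty empty).
  { split; [apply empty_function|]. intros k f Hk. now apply pair_in_empty in Hk. }
  assert (Hcs : is_class_tuple E I F U empty empty empty).
  { split; [apply empty_function|]. intros k f c Hk. now apply pair_in_empty in Hk. }
  rewrite (los L I F U HL HF HU N HN (constant_family_product L I M F HM HFc) (H I U HU)
    empty p Hp (context_nat empty nat_empty) empty empty Hfs Hcs).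
  assert (Hsl : forall i, is_slice E empty empty empty i).
  { intros i. split; [apply empty_function|]. intros k f a Hk. now apply pair_in_empty in Hk. }
  split.
  - intros Hsat. apply large_all; auto. intros i Hi. exists M, empty.
    split; [apply HFc|split]; auto.
  - intros (X & HX & K). 
    assert (Hi : exists i, i ∈ X).
    { apply NNPP. intros Hno. destruct HU as (_ & _ & Hne & _). apply (Hne X); auto.
      intros i Hi. apply Hno. eauto. }
    destruct Hi as [i Hi]. apply K in Hi. destruct Hi as [Hi Hsat].
    now apply (local_sat L I F HF empty empty Hfs p i M empty Hi (proj2 HFc i Hi) (Hsl i)).
Qed.

End Model.

Theorem theorem1p3 (V : Type) (E : V -> V -> Prop) (hZF : ZF E) :
  (LT1 E <-> LT2 E) /\ (LT2 E <-> LT3 E).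
Proof.
  assert (H12 : LT1 E -> LT2 E).
  { intros H. apply LT3_LT2, ultra_choice_LT3. intros I U. now apply LT1_ultra_choice. }
  assert (H21 : LT2 E -> LT1 E).
  { intros H. apply ultra_choice_LT1. intros I U. now apply LT2_ultra_choice. }
  assert (H23 : LT2 E -> LT3 E).
  { intros H. apply ultra_choice_LT3. intros I U. now apply LT2_ultra_choice. }
  split; split; auto. apply LT3_LT2.
Qed.
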